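(* Let $\{c,g,f,\mathbb R^n,U,T\}\in\mathcal M_{Lip}$ be a state unconstrained optimal control problem initialized at $x_0\in\mathbb R^n$, with value function $V^*$. Suppose there exists an open set $\Omega\subseteq\mathbb R^n$ such that $FR_f(\{x_0\},\mathbb R^n,U,[0,T])\subseteq\Omega$. Then for any function $J\in C^2(\mathbb R^n\times\mathbb R,\mathbb R)$, $$L(x_0,\mathbf u_J)\le C\,\|J-V^*\|_{W^{1,\infty}(\Omega\times[0,T],\mathbb R)},$$ where $$C:=2\max\Big\{1,\;T,\;T\max_{1\le i\le n}\sup_{(x,u)\in\Omega\times U}|f_i(x,u)|\Big\},$$ $$\mathbf u_J(t)=k_J(\phi_f(x_0,t,\mathbf u_J),t),\qquad k_J(x,t)\in\arg\inf_{u\in U}\{c(x,u,t)+\nabla_xJ(x,t)^Tf(x,u)\}.$$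
   Context: **Optimal control data.** A tuple $\{c,g,f,\Omega,U,T\}$ consists of $c:\mathbb R^n\times\mathbb R^m\times\mathbb R\to\mathbb R$ (running cost), $g:\mathbb R^n\to\mathbb R$ (terminal cost), $f:\mathbb R^n\times\mathbb R^m\to\mathbb R^n$ (vector field, components $f_i$), $\Omega\subseteq\mathbb R^n$ (state constraint set), $U\subset\mathbb R^m$ (input constraint set), and $T>0$ (final time). $F\in LocLip(\Theta_1,\Theta_2)$ means: for every compact $X\subseteq\Theta_1$ there is $K_X>0$ with $\|F(x)-F(y)\|_2\le K_X\|x-y\|_2$ for all $x,y\in X$. The tuple belongs to $\mathcal M_{Lip}$ if $c\in LocLip(\Omega\times U\times[0,T],\mathbb R)$, $g\in LocLip(\Omega,\mathbb R)$, $f\in LocLip(\Omega\times U,\mathbb R^n)$ and $U$ is compact. It is state unconstrained if the state constraint set is $\mathbb R^n$. **Admissible inputs and solution map.** The shift operator is $(\tau_s\mathbf u)(t)=\mathbf u(s+t)$. For $(x_0,t_0)\in\mathbb R^n\times[0,T]$, an input $\mathbf u:[t_0,T]\to U$ is admissible, written $\mathbf u\in\mathcal U_{\Omega,U,f,T}(x_0,t_0)$, if there exists a unique solution map $\phi_f$ with $\frac{\partial}{\partial t}\phi_f(x_0,t-t_0,\tau_{t_0}\mathbf u)=f(\phi_f(x_0,t-t_0,\tau_{t_0}\mathbf u),\mathbf u(t))$ and $\phi_f(x_0,t-t_0,\tau_{t_0}\mathbf u)\in\Omega$ for $t\in[t_0,T]$, and $\phi_f(x_0,0,\tau_{t_0}\mathbf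 u)=x_0$. **Value function.** $V^*$ is a value function of $\{c,g,f,\Omega,U,T\}$ if for all $(x,t)\in\Omega\times[0,T]$ $$V^*(x,t)=\inf_{\mathbf u\in\mathcal U_{\Omega,U,f,T}(x,t)}\Big\{\int_t^T c(\phi_f(x,s-t,\tau_t\mathbf u),\mathbf u(s),s)\,ds+g(\phi_f(x,T-t,\tau_t\mathbf u))\Big\},$$ with value $\infty$ if $\mathcal U_{\Omega,U,f,T}(x,t)=\emptyset$. In the claim this is used with state constraint set $\mathbb R^n$. **Forward reachable set.** $FR_f(X_0,\Omega,U,S)$ is the set of $y\in\mathbb R^n$ for which there exist $x\in X_0$, $T'\in S$ and $\mathbf u\in\mathcal U_{\Omega,U,f,T'}(x,0)$ with $\phi_f(x,T',\mathbf u)=y$. **Loss.** For a state unconstrained problem, $$L(x_0,\mathbf u):=\int_0^Tc(\phi_f(x_0,s,\mathbf u),\mathbf u(s),s)\,ds+g(\phi_f(x_0,T,\mathbf u))-\inf_{\mathbf v\in\mathcal U_{\mathbb R^n,U,f,T}(x_0,0)}\Big\{\int_0^Tc(\phi_f(x_0,s,\mathbf v),\mathbf v(s),s)\,ds+g(\phi_f(x_0,T,\mathbf v))\Big\}.$$ **Norm.** $\|v\|_{W^{1,\infty}(\Omega\times[0,T],\mathbb R)}=\sum_{|\alpha|\le1}\operatorname{ess\,sup}_{(x,t)\in\Omega\times[0,T]}|D^\alpha v(x,t)|$, the sum running over $v$ itself and its first-order weak partial derivatives in $x_1,\dots,x_n,t$.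
   Formalization: Inputs are taken measurable and the solution map in the Carathéodory sense (absolutely continuous, the differential equation for almost every t); with the equation demanded at every t the claim fails. The relation defining u_J is needed only for almost every t. *)

(* Defs.v *)
From HB Require Import structures.
From mathcomp Require Import all_boot all_order all_algebra.
From mathcomp Require Import all_classical all_reals all_analysis.
From mathcomp Require Import ess_sup_inf.

Set Implicit Arguments.
Unset Strict Implicit.
Unset Printing Implicit Defensive.

Import Order.TTheory GRing.Theory Num.Theory.
Import numFieldNormedType.Exports.

Local Open Scope classical_set_scope.
Local Open Scope ring_scope.

Section PowerMeasure.
Context {d} {T : measurableType d} {R : realType}.
Variable m : {sigma_finite_measure set T -> \bar R}.

Definition tuple_cons n (z : T * n.-tuple T) : n.+1.-tuple T :=
  [the n.+1.-tuple T of z.1 :: z.2].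

Lemma measurable_tuple_cons n : measurable_fun setT (@tuple_cons n).
Proof. exact: measurable_cons. Qed.

Section step.
Context n (mu : {sigma_finite_measure set (n.-tuple T) -> \bar R}).

Definition powerS : set (n.+1.-tuple T) -> \bar R :=
  pushforward (m \x mu)%E (@tuple_cons n).

Let M : {measure set (n.+1.-tuple T) -> \bar R} :=
  measure_function_pushforward__canonical__measure_function_Measure
    (m \x mu)%E (@measurable_tuple_cons n).

HB.instance Definition _ := isMeasure.Build _ _ _ powerS
  (measure0 M) (measure_ge0 M) (@measure_semi_sigma_additive _ _ _ M).

Lemma powerS_sigma_finite : sigma_finite setT powerS.
Proof.
have /sigma_finiteP[F [FT ndF Foo]] := sigma_finiteT m.
have /sigma_finiteP[G [GT ndG Goo]] := sigma_finiteT mu.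
pose uc (t : n.+1.-tuple T) : T * n.-tuple T := (thead t, [tuple of behead t]).
have muc : measurable_fun setT uc.
  apply: measurable_fun_pair; last exact: measurable_behead.
  exact: measurable_tnth.
have ucK z : uc (tuple_cons z) = z.
  by case: z => x t; rewrite /uc /=; congr pair; exact/val_inj.
exists (fun k => uc @^-1` (F k `*` G k)).
  apply/seteqP; split=> // t _.
  have : [set: T] (uc t).1 by [].
  have : [set: n.-tuple T] (uc t).2 by [].
  rewrite FT GT => -[k _ Gk] [l _ Fl]; exists (maxn k l) => //; split => /=.
    by move: Fl; exact/subsetPset/ndF/leq_maxr.
  by move: Gk; exact/subsetPset/ndG/leq_maxl.
move=> k; have [mF Fk] := Foo k; have [mG Gk] := Goo k; split.
  by rewrite -[_ @^-1` _]setTI; apply: muc => //; exact: measurableX.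
rewrite /powerS /pushforward -comp_preimage.
rewrite (_ : uc \o _ = id); last by apply/funext => z; exact: ucK.
by rewrite preimage_id product_measure1E// lte_mul_pinfty// ge0_fin_numE.
Qed.

HB.instance Definition _ :=
  @isSigmaFinite.Build _ _ _ powerS powerS_sigma_finite.
HB.instance Definition _ :=
  @isSFinite.Build _ _ _ powerS (sfinite_measure_sigma_finite powerS_sigma_finite).
End step.

(* n-fold product measure m \x ... \x m on n.-tuple T *)
Fixpoint power_measure n : {sigma_finite_measure set (n.-tuple T) -> \bar R} :=
  match n with
  | 0 => \d_ ([tuple] : 0.-tuple T)
  | n'.+1 => powerS (power_measure n')
  end.

End PowerMeasure.

Section Regularity.
Context {R : realType}.

Definition l2norm p (x : 'rV[R]_p) : R := Num.sqrt (\sum_(i < p) x 0 i ^+ 2).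

Definition loc_lip (V W : normedModType R) (NV : V -> R) (NW : W -> R)
    (Theta : set V) (F : V -> W) : Prop :=
  forall X : set V, compact X -> X `<=` Theta ->
    exists2 K : R, 0 < K &
      forall x y, X x -> X y -> NW (F x - F y) <= K * NV (x - y).

(* On a finite-dimensional space, C^k amounts to: all directional derivatives
   up to order k exist everywhere and are continuous. *)
Fixpoint Ck (V : normedModType R) (k : nat) (F : V -> R) : Prop :=
  match k with
  | 0 => continuous F
  | k'.+1 => continuous F /\
      forall v : V, (forall x, derivable F x v) /\ Ck k' ('D_v F)
  end.

Definition abs_continuous (W : normedModType R) (a b : R) (y : R -> W) : Prop :=
  forall e : R, 0 < e -> exists2 delta : R, 0 < delta &
    forall (N : nat) (l r : 'I_N -> R),
      (forall i, [/\ a <= l i, l i <= r i & r i <= b]) ->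
      (forall i j, i != j -> r i <= l j \/ r j <= l i) ->
      \sum_(i < N) (r i - l i) < delta ->
      \sum_(i < N) `|y (r i) - y (l i)| < e.

End Regularity.

Record optctrl (R : realType) (n m : nat) := OptCtrl {
  oc_c : 'rV[R]_n * 'rV[R]_m * R -> R;
  oc_g : 'rV[R]_n -> R;
  oc_f : 'rV[R]_n * 'rV[R]_m -> 'rV[R]_n;
  oc_Omega : set 'rV[R]_n;
  oc_U : set 'rV[R]_m;
  oc_T : R;
  oc_T_gt0 : 0 < oc_T
}.

Section OptimalControl.
Context {R : realType} {n m : nat}.
Implicit Types (f : 'rV[R]_n * 'rV[R]_m -> 'rV[R]_n) (Omega : set 'rV[R]_n).
Implicit Types (U : set 'rV[R]_m) (u w : R -> 'rV[R]_m) (y : R -> 'rV[R]_n).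
Implicit Types (P : optctrl R n m) (x : 'rV[R]_n) (s t T S : R).

Definition MLip P : Prop :=
  [/\ loc_lip
        (fun z : 'rV[R]_n * 'rV[R]_m * R =>
           Num.sqrt (l2norm z.1.1 ^+ 2 + l2norm z.1.2 ^+ 2 + z.2 ^+ 2))
        (fun r : R => `|r|)
        (oc_Omega P `*` oc_U P `*` `[0, oc_T P]) (oc_c P),
      loc_lip (@l2norm R n) (fun r : R => `|r|) (oc_Omega P) (oc_g P),
      loc_lip
        (fun z : 'rV[R]_n * 'rV[R]_m =>
           Num.sqrt (l2norm z.1 ^+ 2 + l2norm z.2 ^+ 2))
        (@l2norm R n) (oc_Omega P `*` oc_U P) (oc_f P)
    & compact (oc_U P)].

Definition state_unconstrained P : Prop := oc_Omega P = setT.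

Definition shift s u : R -> 'rV[R]_m := fun t => u (s + t).

(* [y] solves y' = f(y, w), y(0) = x0 on [0, S], inside [Omega].  Inputs are
   merely measurable (feedback laws given by an arginf are discontinuous in
   general), so the equation is understood in the sense of Caratheodory:
   y is absolutely continuous and satisfies it almost everywhere. *)
Definition is_solution f Omega S x0 w y : Prop :=
  [/\ y 0 = x0,
      forall s, 0 <= s <= S -> Omega (y s),
      abs_continuous 0 S y
    & {ae lebesgue_measure, forall s : R, 0 <= s <= S ->
        is_derive s 1 y (f (y s, w s))}].

(* The solution map on [0, S], s being the elapsed time and w the shifted
   input; only meaningful for s in [0, S] and when the solution is unique
   there, as guaranteed by [admissible]. *)
Definition phi f Omega S x0 w : R -> 'rV[R]_n :=
  xget (fun=> x0) [set y | is_solution f Omega S x0 w y].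

Definition input U t0 T u : Prop :=
  (forall s, t0 <= s <= T -> U (u s)) /\
  (forall j : 'I_m, measurable_fun `[t0, T] (fun s : R => u s 0 j)).

Definition admissible f Omega U T x0 t0 : set (R -> 'rV[R]_m) :=
  [set u | [/\ input U t0 T u,
    exists y, is_solution f Omega (T - t0) x0 (shift t0 u) y
  & forall y z,
      is_solution f Omega (T - t0) x0 (shift t0 u) y ->
      is_solution f Omega (T - t0) x0 (shift t0 u) z ->
      forall s, 0 <= s <= T - t0 -> y s = z s]].

Definition oc_phi P x t u : R -> 'rV[R]_n :=
  phi (oc_f P) (oc_Omega P) (oc_T P - t) x (shift t u).

Definition oc_admissible P x t : set (R -> 'rV[R]_m) :=
  admissible (oc_f P) (oc_Omega P) (oc_U P) (oc_T P) x t.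

Definition cost P x t u : \bar R :=
  (\int[lebesgue_measure]_(s in `[t, oc_T P])
      (oc_c P (oc_phi P x t u (s - t), u s, s))%:E
   + (oc_g P (oc_phi P x t u (oc_T P - t)))%:E)%E.

Definition is_value_function P (V : 'rV[R]_n * R -> \bar R) : Prop :=
  forall x t, oc_Omega P x -> 0 <= t <= oc_T P ->
    V (x, t) = ereal_inf (cost P x t @` oc_admissible P x t).

Definition FR f (X0 : set 'rV[R]_n) Omega U (S : set R) : set 'rV[R]_n :=
  [set z | exists x T' u, [/\ X0 x, S T', admissible f Omega U T' x 0 u
                            & phi f Omega T' x u T' = z]].

Definition loss P x0 u : \bar R :=
  (cost P x0 0 u - ereal_inf (cost P x0 0 @` oc_admissible P x0 0%R))%E.

Definition dx (i : 'I_n) : 'rV[R]_n * R := (delta_mx 0 i, 0).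
Definition dt : 'rV[R]_n * R := (0, 1).

Definition hamiltonian P (J : 'rV[R]_n * R -> R) x t (v : 'rV[R]_m) : R :=
  oc_c P (x, v, t) + \sum_(i < n) 'D_(dx i) J (x, t) * oc_f P (x, v) 0 i.

Definition is_feedback P (J : 'rV[R]_n * R -> R)
    (k : 'rV[R]_n * R -> 'rV[R]_m) : Prop :=
  forall x t, 0 <= t <= oc_T P ->
    oc_U P (k (x, t)) /\
    forall v, oc_U P v ->
      hamiltonian P J x t (k (x, t)) <= hamiltonian P J x t v.

Definition bound_const f Omega U T : \bar R :=
  (2%:E * maxe 1 (maxe T%:E
     (T%:E * \big[maxe/-oo]_(i < n)
               ereal_sup [set `|f z 0 i|%:E | z in Omega `*` U])))%E.

End OptimalControl.

Section Sobolev.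
Context {R : realType} {n : nat}.
Local Notation XT := ('rV[R]_n * R)%type.

(* (n+1)-dimensional Lebesgue measure; the library's measurable structure for
   R^n lives on tuples, hence the coordinate map [coord]. *)
Definition leb_xt :
    set (n.-tuple (measurableTypeR R) * measurableTypeR R) -> \bar R :=
  (power_measure lebesgue_measure n \x lebesgue_measure)%E.
HB.instance Definition _ := Measure.on leb_xt.

Definition coord (z : n.-tuple (measurableTypeR R) * measurableTypeR R) : XT :=
  (\row_(i < n) tnth z.1 i, z.2).

Definition ess_sup_on (D : set XT) (v : XT -> R) : \bar R :=
  ess_sup leb_xt ((fun z => `|v (coord z)|%:E) \_ (coord @^-1` D)).

Definition loc_integrable (O : set XT) (v : XT -> R) : Prop :=
  forall K, compact K -> K `<=` O ->
    leb_xt.-integrable (coord @^-1` K) (fun z => (v (coord z))%:E).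

Definition test_function (O : set XT) (psi : XT -> R) : Prop :=
  (forall k, Ck k psi) /\
  exists K, [/\ compact K, K `<=` O & forall z, ~ K z -> psi z = 0].

Definition weak_derivative (O : set XT) (e : XT) (v w : XT -> R) : Prop :=
  [/\ loc_integrable O v, loc_integrable O w
    & forall psi, test_function O psi ->
       (\int[leb_xt]_(z in coord @^-1` O) (v (coord z) * 'D_e psi (coord z))%:E
        = - \int[leb_xt]_(z in coord @^-1` O) (w (coord z) * psi (coord z))%:E)%E].

(* W^{1,oo}-norm of (the a.e.-class of) an extended-real function on
   Omega x [0, T].  Weak derivatives are unique a.e., so the set below has at
   most one element; it is empty, and the norm is +oo, when v has no finite
   a.e.-representative with weak first-order derivatives. *)
Definition W1oo_norm (Omega : set 'rV[R]_n) (T : R) (v : XT -> \bar R) : \bar R :=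
  let D := Omega `*` `[0, T] in
  let O := Omega `*` [set t : R | 0 < t < T] in
  ereal_inf [set N | exists (v0 : XT -> R) (vx : 'I_n -> XT -> R) (vt : XT -> R),
    [/\ {ae leb_xt, forall z, D (coord z) -> v (coord z) = (v0 (coord z))%:E},
        forall i, weak_derivative O (dx i) v0 (vx i),
        weak_derivative O dt v0 vt
      & N = (ess_sup_on D v0 + \sum_(i < n) ess_sup_on D (vx i)
             + ess_sup_on D vt)%E]].

End Sobolev.

(* Main.v *)
(* Write v = J - V.  Averaging v against smooth product kernels supported in small boxes just
   after a point, and taking the limsup of the averages, gives a version of v defined everywhere
   on Omega x [0, T), the trace, which inherits from the weak derivatives a Lipschitz bound along
   each coordinate.  Stability of trajectories makes V upper semicontinuous forward in time, so
   V >= J - trace everywhere and not only almost everywhere.  Dynamic programming then bounds the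
   minimized Hamiltonian dJ/dt + min_u (c + grad J . f) by
     rate = sup |dv/dt| + sum_i sup |dv/dx_i| sup |f_i|
   at every point of Omega x [0, T), with no exceptional null set; this matters because the
   feedback trajectory may run inside one.  Hence running cost plus J grows at rate at most rate
   along the feedback trajectory, and the trace changes at rate at most rate along it; as the
   trace tends to J - g at time T, the loss is at most 2 T rate. *)

(* The relation between J - V and its weak derivatives holds only almost everywhere, and continuity
   of V is not established; averages see weak derivatives directly and absorb null sets. A one-sided
   comparison of V with J - trace is enough: dynamic programming needs V bounded below at the end of
   a short trajectory, whose endpoint cannot be steered away from a null set. The kernels are
   products, so a shift along one coordinate changes one factor and tests one weak derivative. Their
   boxes lie strictly after the point, which admits time 0 but excludes time T; the terminal cost is
   therefore recovered in a limit. [Omega] is merely open: the Lipschitz bound of the trace holds in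
   boxes contained in [Omega] and is carried along the whole trajectory by a local slope estimate.
   In the constant, the 2 counts the rate once for the growth of cost plus J and once for the change
   of the trace, and T is the length of the time interval; the sup norm of J - V keeps the averages
   bounded. *)
Require Import Defs.
From mathcomp Require Import all_boot all_order all_algebra.
From mathcomp Require Import all_classical all_reals all_analysis.
From mathcomp Require Import ess_sup_inf measurable_realfun ring lra.

Set Implicit Arguments.
Unset Strict Implicit.
Unset Printing Implicit Defensive.

Import Order.TTheory GRing.Theory Num.Theory.
Import numFieldNormedType.Exports.

Local Open Scope classical_set_scope.
Local Open Scope ring_scope.

(** * Absolutely continuous functions *)

Section almost_everywhere.
Context {d} {T : measurableType d} {R : realType}.
Variable mu : {measure set T -> \bar R}.

Lemma ae_imply1 (P Q : T -> Prop) : (forall x, P x -> Q x) ->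
  {ae mu, forall x, P x} -> {ae mu, forall x, Q x}.
Proof. by move=> PQ; apply: negligibleS => x /= nQ Px; apply: nQ; exact: PQ. Qed.

Lemma ae_imply2 (P P' Q : T -> Prop) : (forall x, P x -> P' x -> Q x) ->
  {ae mu, forall x, P x} -> {ae mu, forall x, P' x} -> {ae mu, forall x, Q x}.
Proof.
move=> PQ h h'; apply: negligibleS (negligibleU h h') => x /= nQ.
by apply: contrapT => /not_orP[/contrapT ? /contrapT ?]; apply: nQ; exact: PQ.
Qed.

End almost_everywhere.

(** * Mean value inequalities with an exceptional null set *)

Section mean_value.
Context {R : realType}.
Implicit Types (a b K : R) (g : R -> R).

(** A bound on the upper Dini derivatives from both sides, relative to [a, b]. It makes sense for
    functions, such as the trace along a trajectory, that need not be differentiable. *)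
Definition slope_le K a b g (s : R) := forall e : R, 0 < e ->
  \forall s' \near s, a <= s' <= b ->
    (s <= s' -> g s' - g s <= (K + e) * (s' - s)) /\
    (s' <= s -> g s - g s' <= (K + e) * (s - s')).

(** The list runs from right to left, so that real induction extends it at the head. *)
Definition chain (U : set R) a b (l : seq (R * R)) :=
  [/\ forall p, p \in l -> [/\ a <= p.1, p.1 <= p.2 & p.2 <= b],
      pairwise (fun p q => q.2 <= p.1) l &
      forall p, p \in l -> [set x | p.1 <= x <= p.2] `<=` U].

Lemma chain_weak U a b c l : b <= c -> chain U a b l -> chain U a c l.
Proof.
move=> bc [h1 h2 h3]; split => // p /h1[? ? pb]; split => //.
exact: le_trans pb bc.
Qed.

Lemma chain_cons U a b c d l : a <= c -> b <= c -> c <= d ->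
  [set x | c <= x <= d] `<=` U -> chain U a b l -> chain U a d ((c, d) :: l).
Proof.
move=> ac bc cd cdU [h1 h2 h3]; split => [p||p].
- rewrite inE => /predU1P[->//|/h1[? ? pb]]; split => //.
  exact: le_trans (le_trans pb bc) cd.
- rewrite /= h2 andbT; apply/allP => p /h1[_ _ pb] /=.
  exact: le_trans pb bc.
- by rewrite inE => /predU1P[->//|/h3].
Qed.

(* Real induction along [a, b]: points outside U advance with slope e, points of the open set U
   by an interval contained in U. *)
Lemma slope_chain (U : set R) a b g (e : R) : a <= b -> 0 < e -> open U ->
  (forall s, a <= s <= b -> ~ U s -> slope_le 0 a b g s) ->
  exists2 l, chain U a b l &
    g b - g a <= e * (b - a) + \sum_(p <- l) (g p.2 - g p.1).
Proof.
move=> ab e0 oU hs.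
pose P s := exists2 l, chain U a s l &
    g s - g a <= e * (s - a) + \sum_(p <- l) (g p.2 - g p.1).
have Pa : P a by exists [::]; [split|rewrite big_nil !subrr mulr0 addr0].
pose A := [set s | a <= s <= b /\ P s].
have Aa : A a by split => //; rewrite lexx.
have ubA : ubound A b by move=> s [/andP[]].
have hsA : has_sup A by split; [exists a|exists b].
set c := sup A.
have ac : a <= c by apply: ub_le_sup => //; exists b.
have cb : c <= b by apply: ge_sup => //; exists a.
have step s t : a <= s -> s <= t -> t <= b -> P s ->
  ([set x | s <= x <= t] `<=` U \/ g t - g s <= e * (t - s)) -> P t.
  move=> as_ st tb [l cl gs] [stU|gst].
    exists ((s, t) :: l); first exact: (@chain_cons _ _ s).
    rewrite big_cons/=; have : 0 <= e * (t - s) by rewrite mulr_ge0 ?(ltW e0)// subr_ge0.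
    lra.
  exists l; first exact: chain_weak cl.
  lra.
(* Around the supremum [c] both kinds of advance are available on either side: from the left to
   reach [c], to the right to go beyond it. *)
have loc : exists2 d : R, 0 < d & forall s, a <= s <= b -> `|s - c| < d ->
   (s <= c -> [set x | s <= x <= c] `<=` U \/ g c - g s <= e * (c - s)) /\
   (c <= s -> [set x | c <= x <= s] `<=` U \/ g s - g c <= e * (s - c)).
  have [Uc|nUc] := pselect (U c).
    have /nbhs_ballP[d /= d0 hd] : nbhs c U by move: oU; rewrite openE => /(_ _ Uc).
    exists d => // s sab sc; split => h; left => x /= /andP[h1 h2]; apply: hd;
      rewrite /ball/=; apply: le_lt_trans sc.
      by rewrite ger0_norm ?subr_ge0// distrC ger0_norm ?subr_ge0// lerB.
    by rewrite distrC ger0_norm ?subr_ge0// ger0_norm ?subr_ge0// lerB.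
  have : a <= c <= b by rewrite ac cb.
  move=> /hs/(_ nUc)/(_ _ e0)/nbhs_ballP[d /= d0 hd].
  exists d => // s sab sc; have := hd s; rewrite /ball/= distrC => /(_ sc sab).
  by rewrite add0r => -[h1 h2]; split => ?; right; [exact: h2|exact: h1].
case: loc => d d0 hd.
have Pc : P c.
  have [s As cs] := sup_adherent d0 hsA.
  have sc : s <= c by apply: ub_le_sup => //; exists b.
  case: As => sab Ps.
  have dd : `|s - c| < d by rewrite distrC ger0_norm ?subr_ge0// ltrBlDl -ltrBlDr.
  have [/(_ sc) h _] := hd _ sab dd.
  by apply: (step s) => //; case/andP: sab.
have [bc|cltb] := leP b c.
  by have -> : b = c by apply/eqP; rewrite eq_le bc cb.
pose t := Num.min b (c + d / 2).
have ct : c < t by rewrite lt_min cltb ltrDl divr_gt0.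
have tb : t <= b by rewrite ge_min lexx.
have tab : a <= t <= b by rewrite tb (le_trans ac (ltW ct)).
have dd : `|t - c| < d.
  rewrite ger0_norm ?subr_ge0 1?ltW// ltrBlDl.
  apply: (@le_lt_trans _ _ (c + d / 2)); first by rewrite ge_min lexx orbT.
  by rewrite ltrD2l; lra.
have [_ /(_ (ltW ct)) h] := hd _ tab dd.
have Pt : P t by apply: (step c) => //; exact: ltW.
have : t <= c by apply: ub_le_sup; [exists b|split].
by rewrite leNgt ct.
Qed.

Lemma chain_measure U a b l : measurable U -> chain U a b l ->
  ((\sum_(p <- l) (p.2 - p.1))%:E <= lebesgue_measure U)%E.
Proof.
(* Only the part of [U] left of [b] is charged, so the head interval ]c, d] is disjoint from what
   the tail has used. *)
move=> mU; suff H : forall b, chain U a b l ->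
    ((\sum_(p <- l) (p.2 - p.1))%:E <= lebesgue_measure (U `&` `]-oo, b]))%E.
  move=> /H/le_trans; apply; apply: le_measure; rewrite ?inE//.
  exact: measurableI.
elim: l => [b' _|[c d] l IH b' [h1 h2 h3]]; first by rewrite big_nil.
rewrite big_cons/= EFinD.
have [/= ac cd db] := h1 (c, d) (mem_head _ _).
have /IH H : chain U a c l.
  split.
  - move=> p pl; have [] := h1 p; first by rewrite inE pl orbT.
    move=> ? ? ?; split => //.
    by move: h2 => /= /andP[/allP/(_ _ pl)].
  - by move: h2 => /= /andP[].
  - by move=> p pl; apply: h3; rewrite inE pl orbT.
apply: (@le_trans _ _ (lebesgue_measure (`]c, d]%classic `|` (U `&` `]-oo, c]%classic) : set R))).
  rewrite measureU//=; last 2 first.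
  - exact: measurableI.
  - apply/seteqP; split => // x [/= ]; rewrite !in_itv/= => /andP[cx _] [_ xc].
    by move: cx; rewrite ltNge xc.
  rewrite leeD//; rewrite lebesgue_measure_itv/=; case: ifPn => //.
  by rewrite lte_fin -leNgt lee_fin subr_le0.
apply: le_measure; rewrite ?inE//; [|exact: measurableI|].
- by apply: measurableU => //; exact: measurableI.
- move=> x [/=|[Ux]/=]; rewrite !in_itv/=.
    move=> /andP[cx xd]; split; last exact: le_trans xd db.
    by apply: (h3 (c, d) (mem_head _ _)) => /=; rewrite (ltW cx) xd.
  by move=> xc; split => //; exact: le_trans (le_trans xc cd) db.
Qed.

Lemma ac_chain a b (g : R -> R) (e : R) : abs_continuous a b g -> 0 < e ->
  exists2 d : R, 0 < d & forall U l, chain U a b l ->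
   \sum_(p <- l) (p.2 - p.1) < d -> \sum_(p <- l) (g p.2 - g p.1) < e.
Proof.
move=> acg e0; have [d d0 hd] := acg _ e0; exists d => // U l [h1 h2 h3] hl.
pose z : R * R := (0, 0).
apply: (@le_lt_trans _ _ (\sum_(i < size l) `|g (nth z l i).2 - g (nth z l i).1|)).
  rewrite (big_nth z) big_mkord; apply: ler_sum => i _; exact: ler_norm.
apply: (hd _ (fun i => (nth z l i).1) (fun i => (nth z l i).2)).
- by move=> i; apply: h1; exact: mem_nth.
- move=> i j; rewrite -val_eqE neq_ltn => /orP[ij|ji].
    right; move/(pairwiseP z) : h2; apply => //; exact: ltn_ord.
  left; move/(pairwiseP z) : h2; apply => //; exact: ltn_ord.
- by move: hl; rewrite (big_nth z) big_mkord.
Qed.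

(* Cover the exceptional null set by an open set of small measure, on which absolute continuity
   makes the total increment of g small. *)
Lemma ac_nonincr a b g : a <= b -> abs_continuous a b g ->
  {ae lebesgue_measure, forall s, a <= s <= b -> slope_le 0 a b g s} ->
  g b <= g a.
Proof.
move=> ab acg [N [mN N0 hN]].
apply/ler_addgt0Pr => e e0.
(* Half of [e] pays for the slopes outside [U], half for the increments over [U]; the [+ 1] keeps
   the denominator positive when a = b. *)
pose e1 := e / 2 / (b - a + 1).
have ba : 0 < b - a + 1 by rewrite ltr_wpDl// subr_ge0.
have e10 : 0 < e1 by rewrite !divr_gt0.
have e20 : 0 < e / 2 by rewrite divr_gt0.
have [d d0 hd] := ac_chain acg e20.
have [|U [oU NU hU]] := @lebesgue_regularity_outer R N d mN _ d0.
  by rewrite [X in (X < _)%E]N0.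
have mU : measurable U by exact: open_measurable.
have mUd : (lebesgue_measure U < d%:E)%E.
  apply: le_lt_trans hU; rewrite -[in leLHS](setDUK NU) measureU//; last 2 first.
  - exact: measurableD.
  - by rewrite setDIK.
  by rewrite [X in (X + _)%E]N0 add0e.
have [|l cl gl] := @slope_chain U a b g e1 ab e10 oU.
  move=> s sab nUs; apply: contrapT => hs; apply: nUs; apply: NU; apply: hN => /=.
  by move=> H; apply: hs; exact: H.
have hl : \sum_(p <- l) (p.2 - p.1) < d.
  rewrite -lte_fin; apply: le_lt_trans mUd; exact: chain_measure cl.
have := hd _ _ cl hl.
have : e1 * (b - a) <= e / 2.
  by rewrite /e1 mulrAC ler_pdivrMr// ler_pM2l// lerDl.
by move: gl; lra.
Qed.

Definition lip_on a b (g : R -> R) := exists2 K : R, 0 <= K &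
  forall s t, a <= s -> s <= t -> t <= b -> `|g t - g s| <= K * (t - s).

Lemma lip_ac a b g : lip_on a b g -> abs_continuous a b g.
Proof.
move=> [K K0 hK] e e0.
have K1 : 0 < K + 1 by rewrite ltr_wpDl.
exists (e / (K + 1)); first by rewrite divr_gt0.
move=> N l r h1 h2 h3.
apply: (@le_lt_trans _ _ (\sum_(i < N) (K + 1) * (r i - l i))).
  apply: ler_sum => i _; have [al lr rb] := h1 i.
  apply: le_trans (hK _ _ al lr rb) _; apply: ler_wpM2r; rewrite ?subr_ge0//.
  by rewrite lerDl.
by rewrite -mulr_sumr mulrC -ltr_pdivlMr.
Qed.

Lemma acB a b (g h : R -> R) : abs_continuous a b g -> abs_continuous a b h ->
  abs_continuous a b (fun s => g s - h s).
Proof.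
move=> ag ah e e0; have e20 : 0 < e / 2 by rewrite divr_gt0.
have [d1 d10 h1] := ag _ e20; have [d2 d20 h2] := ah _ e20.
exists (Num.min d1 d2); first by rewrite lt_min d10.
move=> N l r H1 H2; rewrite lt_min => /andP[H3 H4].
apply: (@le_lt_trans _ _ (\sum_(i < N) (`|g (r i) - g (l i)| + `|h (r i) - h (l i)|))).
  apply: ler_sum => i _; apply: le_trans (ler_normB _ _).
  by rewrite le_eqVlt; apply/orP; left; apply/eqP; congr (`|_|); ring.
rewrite big_split/=; have := h1 _ _ _ H1 H2 H3; have := h2 _ _ _ H1 H2 H4; lra.
Qed.

Lemma is_derive_slope (g : R -> R) (s d K a b : R) :
  is_derive s 1 g d -> d <= K -> slope_le K a b g s.
Proof.
move=> [dg Dg] dK e e0.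
have : h^-1 *: (g (h *: 1 + s) - g s) @[h --> 0^'] --> d.
  by rewrite -Dg; exact: dg.
move=> /cvgrPdist_lt/(_ _ e0); rewrite near_withinE => /nbhs_ballP[r /= r0 hr].
exists r => //= s'; rewrite /ball/= => ss' sab.
have [->|ns] := eqVneq s' s; first by rewrite !subrr !mulr0.
have s's0 : s' - s != 0 by rewrite subr_eq0.
have := hr (s' - s); rewrite /ball/= sub0r normrN distrC => /(_ ss' s's0).
rewrite scaler1 subrK; set q := (_ *: _) => hq.
have qE : g s' - g s = q * (s' - s) by rewrite /q /GRing.scale/= mulrAC mulVf// mul1r.
have {}hq : q <= K + e.
  by move: hq; rewrite ltr_distl => /andP[+ _]; lra.
split => h; first by rewrite qE ler_wpM2r// subr_ge0.
by rewrite -opprB qE -mulrN opprB ler_wpM2r// subr_ge0.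
Qed.

Lemma slope_leB a b K K' g h s : slope_le K a b g s -> slope_le K' a b (fun t => - h t) s ->
  slope_le (K + K') a b (fun s => g s - h s) s.
Proof.
move=> hg hh e e0; have e20 : 0 < e / 2 by rewrite divr_gt0.
apply: filterS2 (hg _ e20) (hh _ e20) => t H1 H2 tab.
have [{}H1 H1'] := H1 tab; have [{}H2 H2'] := H2 tab.
split=> st.
  move: (H1 st) (H2 st); rewrite !mulrDl; lra.
move: (H1' st) (H2' st); rewrite !mulrDl; lra.
Qed.

Lemma slope_le_linear a b K s : slope_le K a b (fun s => K * s) s.
Proof.
move=> e e0; near=> t => _; rewrite -!mulrBr; split => st;
  by rewrite ler_wpM2r// ?subr_ge0// lerDl ltW.
Unshelve. all: by end_near. Qed.

Lemma ac_slope_le a b K g : a <= b -> abs_continuous a b g ->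
  {ae lebesgue_measure, forall s, a <= s <= b -> slope_le K a b g s} ->
  g b - g a <= K * (b - a).
Proof.
move=> ab acg hs.
suff : g b - K * b <= g a - K * a by rewrite mulrBr; lra.
apply: (@ac_nonincr a b (fun s => g s - K * s)) => //.
  apply: acB => //; apply: lip_ac; exists `|K| => // s t as_ st tb.
  by rewrite -mulrBr normrM (ger0_norm (_ : 0 <= t - s))// subr_ge0.
apply: ae_imply1 hs => s h sab; rewrite -(subrr K); apply: slope_leB; first exact: h.
have := @slope_le_linear a b (- K) s.
by congr slope_le; apply/funext => t; rewrite mulNr.
Qed.

End mean_value.

(** * Measurability of uniformly continuous functions of measurable ones *)

Section uniformly_continuous_measurable.
Context {d} {T : measurableType d} {R : realType}.

(* Cutting the range of Z into small cells approximates F uniformly by functions that are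
   constant on the preimages of the cells. *)
Lemma unif_cont_measurable_fun (D : set T) (mD : measurable D) N
    (Z : 'I_N -> T -> R) (F : T -> R) : (forall i, measurable_fun D (Z i)) ->
  (forall e : R, 0 < e -> exists2 r : R, 0 < r & forall s t, D s -> D t ->
     (forall i, `|Z i s - Z i t| < r) -> `|F s - F t| < e) ->
  measurable_fun D F.
Proof.
move=> mZ ucF.
pose e k : R := k.+1%:R^-1.
have e0 k : 0 < e k by rewrite invr_gt0.
pose r k := sval (cid2 (ucF _ (e0 k))).
have r0 k : 0 < r k by rewrite /r; case: cid2.
have rP k s t : D s -> D t -> (forall i, `|Z i s - Z i t| < r k) -> `|F s - F t| < e k.
  by rewrite /r; case: cid2 => /= ? _; exact.
pose cell k s := [ffun i => Num.floor (Z i s / r k)] : {ffun 'I_N -> int}.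
pose rep k c : option T :=
  if pselect (exists s, D s /\ cell k s = c) is left h then Some (sval (cid h)) else None.
(* The default 0 is never taken on [D], where every point witnesses that its own cell is
   inhabited. *)
pose h k c := if rep k c is Some s then F s else 0.
apply: (@measurable_fun_cvg _ _ _ D (fun k s => h k (cell k s))).
  move=> k _ Y mY.
  have mc c : measurable (D `&` [set s | cell k s = c]).
    rewrite (_ : _ `&` _ = D `&` \bigcap_(i in [set: 'I_N]) (D `&` Z i @^-1` `[(c i)%:~R * r k, (c i + 1)%:~R * r k[)).
      apply: measurableI => //; apply: fin_bigcap_measurable.
        by have := @finite_finset 'I_N [set: 'I_N].
      by move=> i _; apply: mZ.
    apply/seteqP; split => s [Ds hs]; split => //.
      move=> i _; split => //=; rewrite in_itv/= -ler_pdivlMr// -ltr_pdivrMr//.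
      by rewrite -hs ffunE floor_itv.
    apply/ffunP => i; rewrite ffunE; apply: floor_def.
    have [_ /=] := hs i Logic.I.
    by rewrite in_itv/= -ler_pdivlMr// -ltr_pdivrMr.
  (* There are countably many cells; enumerating them by [pickle] writes the preimage of any set as
     a countable union of measurable cells. *)
  pose G a := if @unpickle {ffun 'I_N -> int} a is Some c then
     if pselect (Y (h k c)) then D `&` [set s | cell k s = c] else set0 else set0.
  rewrite (_ : _ `&` _ = \bigcup_a G a).
    apply: bigcup_measurable => a _; rewrite /G; case: unpickle => // c.
    case: pselect => ?; [exact: mc|exact: measurable0].
  apply/seteqP; split => s /=.
    move=> [Ds Ys]; exists (pickle (cell k s)) => //; rewrite /G pickleK.
    by case: pselect.
  by move=> [a _]; rewrite /G; case: unpickle => // c; case: pselect => // Yc [Ds cs]; split => //=; rewrite cs.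
move=> s Ds; apply/cvgrPdist_lt => eps eps0.
near=> k.
have : `|F s - h k (cell k s)| < e k.
  rewrite /h /rep; case: pselect => [p|]; last by case; exists s.
  case: cid => t /= [Dt ct]; apply: rP => // i.
  have := congr1 (fun f : {ffun _ -> _} => f i) ct; rewrite !ffunE => hi.
  have h1 := floor_itv (Z i s / r k); have h2 := floor_itv (Z i t / r k).
  have : `|Z i s / r k - Z i t / r k| < 1.
    move: h1 h2; rewrite hi intrD; set w := (_%:~R); move=> /andP[? ?] /andP[? ?].
    rewrite ltr_norml; apply/andP; split; lra.
  by rewrite -mulrBl normrM (gtr0_norm (_ : 0 < (r k)^-1)) ?invr_gt0// ltr_pdivrMr// mul1r.
move/lt_trans; apply; near: k.
exact: near_infty_natSinv_lt (PosNum eps0).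
Unshelve. all: by end_near. Qed.

End uniformly_continuous_measurable.

(** * Primitives of bounded measurable functions *)

Section primitive.
Context {R : realType}.
Local Notation mu := (@lebesgue_measure R).
Implicit Types (a b s t M : R) (h : R -> R).

Definition prim a h s : R := \int[mu]_(t in `[a, s]) h t.

Lemma bounded_integrable a b M h : measurable_fun `[a, b] h ->
  (forall s, a <= s <= b -> `|h s| <= M) -> mu.-integrable `[a, b] (EFin \o h).
Proof.
move=> mh hM; apply: measurable_bounded_integrable => //.
  by rewrite /= lebesgue_measure_itv/=; case: ifPn; rewrite ?ltry// -EFinD ltry.
exists M; split; first exact: num_real.
by move=> x Mx s /=; rewrite in_itv/= => /hM /le_trans; apply; exact: ltW.
Qed.

Lemma integrable_sub a b s t h : mu.-integrable `[a, b] (EFin \o h) ->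
  a <= s -> t <= b -> mu.-integrable `[s, t] (EFin \o h).
Proof.
move=> ih as_ tb; apply: integrableS ih => // x /=; rewrite !in_itv/= => /andP[sx xt].
by rewrite (le_trans as_)// (le_trans xt).
Qed.

Lemma prim_split a s t h : a <= s -> s <= t ->
  mu.-integrable `[a, t] (EFin \o h) -> prim a h t = prim a h s + prim s h t.
Proof.
move=> as_ st ih.
have := @Rintegral_itvB R h (BLeft a) (BRight t) s ih.
rewrite !bnd_simp => /(_ as_ st).
rewrite Rintegral_itv_obnd_cbnd; last first.
  apply: integrableS ih => // x /=; rewrite !in_itv/= => /andP[sx xt].
  by rewrite xt (le_trans as_ (ltW sx)).
by rewrite -/(prim a h t) -/(prim a h s) -/(prim s h t) => <-; rewrite addrCA subrr addr0.
Qed.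

Lemma prim_point a h : prim a h a = 0.
Proof. by rewrite /prim set_itv1 Rintegral_set1. Qed.

Lemma prim_norm_le a b M h : a <= b -> measurable_fun `[a, b] h ->
  (forall s, a <= s <= b -> `|h s| <= M) -> `|prim a h b| <= M * (b - a).
Proof.
move=> ab mh hM; have ih := bounded_integrable mh hM.
apply: le_trans (le_normr_Rintegral _ ih) _ => //.
have ic : mu.-integrable `[a, b] (EFin \o cst M).
  apply: (@bounded_integrable _ _ `|M|) => // s _; exact: lexx.
have H : \int[mu]_(x in `[a, b]) `|h x| <= \int[mu]_(x in `[a, b]) M.
  apply: (le_Rintegral _ (integrable_norm ih) ic) => // x; exact: hM.
apply: le_trans H _.
rewrite Rintegral_cst// [X in fine X](_ : _ = (b - a)%:E)//.
rewrite /= lebesgue_measure_itv/= lte_fin; case: ltP => // ba.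
by congr EFin; apply/eqP; rewrite eq_sym subr_eq0 eq_le ab ba.
Qed.

Lemma prim_lip a b M h s t : measurable_fun `[a, b] h ->
  (forall s, a <= s <= b -> `|h s| <= M) -> a <= s -> s <= t -> t <= b ->
  `|prim a h t - prim a h s| <= M * (t - s).
Proof.
move=> mh hM as_ st tb; have ih := bounded_integrable mh hM.
rewrite (@prim_split _ s)//; last exact: integrable_sub ih _ tb.
rewrite addrAC subrr add0r; apply: prim_norm_le => //.
  apply: measurable_funS mh => // x /=; rewrite !in_itv/= => /andP[sx xt].
  by rewrite (le_trans as_)// (le_trans xt).
by move=> x /andP[sx xt]; apply: hM; rewrite (le_trans as_)// (le_trans xt).
Qed.

Lemma prim_derive a b M h : measurable_fun `[a, b] h ->
  (forall s, a <= s <= b -> `|h s| <= M) ->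
  {ae mu, forall s, a <= s <= b -> is_derive s 1 (prim a h) (h s)}.
Proof.
move=> mh hM; have ih := bounded_integrable mh hM.
have := lebesgue_differentiation (integrable_locally (measurable_itv _) ih).
(* The derivative is two-sided and may fail at the endpoints, which are discarded as a null set. *)
have nab : {ae mu, forall s, s != a /\ s != b}.
  have := @negligibleU _ _ _ mu [set a] [set b].
  rewrite /= => H; apply: negligibleS (H _ _).
  - move=> s /= /not_andP[]/negP; rewrite negbK => /eqP ->; [by left|by right].
  - by apply/negligibleP => //; rewrite /= lebesgue_measure_set1.
  - by apply/negligibleP => //; rewrite /= lebesgue_measure_set1.
apply: ae_imply2 nab => s; set f := _ \_ _ => -[sa sb] lf /andP[as_ s_b].
have {}as_ : a < s by rewrite lt_neqAle eq_sym sa.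
have {}s_b : s < b by rewrite lt_neqAle sb.
have fi : mu.-integrable [set` Interval (BLeft a) (BRight b)] (EFin \o f).
  by rewrite /f -restrict_EFin; apply/integrable_restrict => //=; rewrite setIid.
have := @FTC1_lebesgue_pt R f (BLeft a) s b s_b fi.
have as' : (ereal_of_itv_bound (BLeft a) < ereal_of_itv_bound (BRight s))%E by rewrite /= lte_fin.
move=> /(_ as' lf)[dF DF].
have eqF : {near s, (fun y => \int[mu]_(t in `[a, y]) f t) =1 prim a h}.
  have : \forall y \near s, y < b by apply: lt_nbhsl.
  apply: filterS => y yb; rewrite /prim; apply: eq_Rintegral => x.
  rewrite inE/= in_itv/= => /andP[ax xy].
  by rewrite /f patchE mem_set//= in_itv/= ax (le_trans xy (ltW yb)).
apply: (near_eq_is_derive eqF).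
rewrite (_ : h s = f s); last first.
  by rewrite /f patchE mem_set//= in_itv/= !ltW.
by split => //; rewrite -DF derive1E.
Qed.

End primitive.

(** * Sup norm and Euclidean norm on row vectors *)

Section row_vectors.
Context {R : realType}.

Lemma rV_norm_coord n (v : 'rV[R]_n) i : `|v 0 i| <= `|v|.
Proof. by rewrite [leRHS]/Num.norm/= mx_normrE; apply: (le_bigmax _ _ (0, i)). Qed.

Lemma rV_norm_coordB n (v w : 'rV[R]_n) i : `|v 0 i - w 0 i| <= `|v - w|.
Proof. by have := rV_norm_coord (v - w) i; rewrite !mxE. Qed.

Lemma rV_norm_le n (v : 'rV[R]_n) (e : R) : 0 <= e -> (forall i, `|v 0 i| <= e) -> `|v| <= e.
Proof.
move=> e0 h; rewrite [leLHS]/Num.norm/= mx_normrE; apply: bigmax_le => // -[i j] _ /=.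
by rewrite ord1.
Qed.

Lemma is_derive_rV n (Y : R -> 'rV[R]_n) (s : R) (d : 'rV[R]_n) :
  is_derive s 1 Y d <-> forall i, is_derive s 1 (fun r => Y r 0 i) (d 0 i).
Proof.
split => [[dY DY] i|h].
  split; first by move/derivable_mxP : dY; exact.
  by rewrite -DY derive_mx// mxE.
have dY : derivable Y s 1.
  by apply/derivable_mxP => i j; rewrite ord1; case: (h j).
split => //; rewrite derive_mx//; apply/rowP => i; rewrite mxE.
by case: (h i).
Qed.

Lemma l2norm_ge n (v : 'rV[R]_n) : `|v| <= l2norm v.
Proof.
apply: rV_norm_le => [|i]; first exact: sqrtr_ge0.
rewrite -sqrtr_sqr ler_wsqrtr// (bigD1 i)//= lerDl.
by apply: sumr_ge0 => j _; exact: sqr_ge0.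
Qed.

(** The sum of absolute values lies in between. The crude factor n is harmless, since it only enters
    Lipschitz constants. *)
Lemma l2norm_le n (v : 'rV[R]_n) : l2norm v <= n%:R * `|v|.
Proof.
apply: (@le_trans _ _ (\sum_(i < n) `|v 0 i|)); last first.
  apply: (@le_trans _ _ (\sum_(i < n) `|v|)).
    by apply: ler_sum => i _; exact: rV_norm_coord.
  by rewrite sumr_const card_ord mulr_natl.
rewrite -[leRHS]ger0_norm; last exact: sumr_ge0.
rewrite -sqrtr_sqr ler_wsqrtr//.
suff [] : 0 <= \sum_(i < n) `|v 0 i| /\ \sum_(i < n) v 0 i ^+ 2 <= (\sum_(i < n) `|v 0 i|) ^+ 2 by [].
elim/big_ind2 : _ => [|x1 x2 y1 y2 [h1 h2] [h3 h4]|i _]; first by rewrite expr0n.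
  split; first exact: addr_ge0.
  by rewrite sqrrD; have := mulr_ge0 h1 h3; lra.
by rewrite real_normK ?num_real.
Qed.

End row_vectors.

(** * Sequences controlled by powers of 1/2 *)

Section halving.
Context {R : realType}.

Lemma half_pow_le (D : R) : 0 <= D -> forall e, 0 < e -> exists k, D * (2^-1) ^+ k < e.
Proof.
move=> D0 e e0.
have D1 : 0 < D + 1 by rewrite ltr_wpDl.
have : (2^-1 : R) ^+ k @[k --> \oo] --> 0.
  by apply: cvg_expr; rewrite ger0_norm// invf_lt1// ltr1n.
move=> /cvgrPdist_lt/(_ (e / (D + 1))); rewrite divr_gt0// => /(_ isT)[k _ /(_ k (leqnn _))].
rewrite /= sub0r normrN ger0_norm; last by rewrite exprn_ge0.
rewrite ltr_pdivlMr// => h; exists k; apply: le_lt_trans h.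
by rewrite mulrC ler_wpM2l ?exprn_ge0// lerDl.
Qed.

Lemma half_pow_eq (D a b : R) : 0 <= D ->
  (forall k, `|a - b| <= D * (2^-1) ^+ k) -> a = b.
Proof.
move=> D0 h; apply/eqP; rewrite -subr_eq0 -normr_le0 leNgt; apply/negP => p.
by have [k hk] := half_pow_le D0 p; have := h k; rewrite leNgt hk.
Qed.

(** The steps from k on add up to at most [2 * e k], so the intervals of that radius about [a k] are
    nested; the limit is the supremum of their left ends. *)
Lemma half_pow_cvg (D : R) (a : nat -> R) : 0 <= D ->
  (forall k, `|a k.+1 - a k| <= D * (2^-1) ^+ k) ->
  exists l, forall k, `|a k - l| <= 2 * D * (2^-1) ^+ k.
Proof.
move=> D0 h; pose e k : R := D * (2^-1) ^+ k.
have e0 k : 0 <= e k by rewrite mulr_ge0// exprn_ge0.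
have eS k : e k = 2 * e k.+1 by rewrite /e exprS; field.
have lo k : a k - 2 * e k <= a k.+1 - 2 * e k.+1.
  by have := h k; rewrite -/(e k) ler_norml => /andP[+ _]; have := eS k; lra.
have hi k : a k.+1 + 2 * e k.+1 <= a k + 2 * e k.
  by have := h k; rewrite -/(e k) ler_norml => /andP[_]; have := eS k; lra.
have lo' : {homo (fun k => a k - 2 * e k) : m n / (m <= n)%N >-> m <= n}.
  exact: homo_leq (@lexx _ _) (@le_trans _ _) lo.
have hi' : {homo (fun k => a k + 2 * e k) : m n / (m <= n)%N >-> n <= m}.
  apply: (@homo_leq _ _ (fun x y => y <= x)) => [//|x y z xy yz|k].
    exact: le_trans yz xy.
  exact: hi.
have lohi m k : a m - 2 * e m <= a k + 2 * e k.
  apply: le_trans (lo' _ _ (leq_maxl m k)) _; apply: le_trans (hi' _ _ (leq_maxr m k)).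
  by have := e0 (maxn m k); lra.
pose A := range (fun k => a k - 2 * e k).
exists (sup A) => k; rewrite -mulrA -/(e k).
have h1 : a k - 2 * e k <= sup A.
  by apply: ub_le_sup; [exists (a 0 + 2 * e 0) => _ [m _ <-]; exact: lohi|exists k].
have h2 : sup A <= a k + 2 * e k.
  by apply: ge_sup; [exists (a 0 - 2 * e 0); exists 0|move=> _ [m _ <-]; exact: lohi].
by rewrite ler_distl; apply/andP; split; lra.
Qed.

End halving.

(** * Comparison estimates for absolutely continuous functions *)

Section comparison.
Context {R : realType}.
Local Notation mu := (@lebesgue_measure R).
Implicit Types (a b L A : R).

Lemma ac_sub (W : normedModType R) a b c d (g : R -> W) : a <= c -> d <= b ->
  abs_continuous a b g -> abs_continuous c d g.
Proof.
move=> ac db h e e0; have [r r0 hr] := h e e0; exists r => // N l r' h1; apply: hr => i.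
have [? ? ?] := h1 i; split => //; [exact: le_trans ac _|exact: le_trans db].
Qed.

Lemma ac_coord n a b (Y : R -> 'rV[R]_n) i :
  abs_continuous a b Y -> abs_continuous a b (fun s => Y s 0 i).
Proof.
move=> h e e0; have [r r0 hr] := h e e0; exists r => // N l r' h1 h2 h3.
apply: le_lt_trans (hr _ _ _ h1 h2 h3); apply: ler_sum => j _.
by have := rV_norm_coord (Y (r' j) - Y (l j)) i; rewrite !mxE.
Qed.

Lemma acN a b (g : R -> R) : abs_continuous a b g -> abs_continuous a b (fun s => - g s).
Proof.
move=> h e e0; have [r r0 hr] := h e e0; exists r => // N l r' h1 h2 h3.
apply: le_lt_trans (hr _ _ _ h1 h2 h3); apply: ler_sum => j _.
by rewrite -opprD normrN.
Qed.

Lemma ac_norm_le a b K (Z z : R -> R) : a <= b -> abs_continuous a b Z ->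
  {ae mu, forall s, a <= s <= b -> is_derive s 1 Z (z s) /\ `|z s| <= K} ->
  `|Z b - Z a| <= K * (b - a).
Proof.
move=> ab acZ h; rewrite ler_norml; apply/andP; split; last first.
  apply: ac_slope_le => //; apply: ae_imply1 h => s h sab; have [d] := h sab.
  by rewrite ler_norml => /andP[_ zK]; exact: is_derive_slope d zK.
suff : - Z b - - Z a <= K * (b - a) by lra.
apply: (@ac_slope_le _ a b K (fun s => - Z s)) => //; first exact: acN.
apply: ae_imply1 h => s h sab; have [d] := h sab.
rewrite ler_norml => /andP[zK _].
have dN : is_derive s 1 (fun s => - Z s) (- z s) by exact: is_deriveN.
apply: (is_derive_slope _ _ dN); lra.
Qed.

Lemma lip_exp a b L A : 0 <= L -> 0 <= A -> lip_on a b (fun s => A * expR (L * (s - a))).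
Proof.
move=> L0 A0; exists (A * (expR (L * (b - a)) * L)).
  by rewrite mulr_ge0// mulr_ge0// expR_ge0.
move=> s t as_ st tb; rewrite -mulrBr normrM ger0_norm// -!mulrA ler_wpM2l//.
have -> : L * (t - a) = L * (s - a) + L * (t - s) by ring.
rewrite expRD ger0_norm; last first.
  by rewrite subr_ge0 ler_pMr ?expR_gt0// -expR0 ler_expR mulr_ge0// subr_ge0.
(* The inequality 1 - x <= exp (- x), multiplied by exp x, becomes exp x - 1 <= x exp x. *)
have h : 1 - L * (t - s) <= expR (- (L * (t - s))) by exact: expR_ge1Dx.
have h2 : expR (L * (t - s)) - 1 <= expR (L * (t - s)) * (L * (t - s)).
  have := ler_wpM2l (expR_ge0 (L * (t - s))) h; rewrite -expRD subrr expR0; lra.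
have h3 : expR (L * (s - a)) * expR (L * (t - s)) <= expR (L * (b - a)).
  by rewrite -expRD ler_expR -mulrDr ler_wpM2l//; lra.
have := ler_wpM2l (expR_ge0 (L * (s - a))) h2.
rewrite mulrBr mulr1 mulrA => /le_trans; apply.
rewrite -[X in _ * X]mulrA [leLHS]mulrA; apply: ler_wpM2r => //.
by rewrite mulr_ge0// subr_ge0.
Qed.

Lemma is_derive_exp a L A (s : R) :
  is_derive s 1 (fun s => A * expR (L * (s - a))) (A * (L * expR (L * (s - a)))).
Proof.
have h1 : is_derive s 1 (fun s : R => L * (s - a)) L.
  have -> : (fun s : R => L * (s - a)) = L *: (id - cst a) by [].
  by apply: is_derive_eq; rewrite subr0 /GRing.scale/= mulr1.
have h2 : is_derive s 1 (expR \o (fun s : R => L * (s - a))) (L * expR (L * (s - a))).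
  rewrite mulrC; exact: (@is_derive1_comp _ expR (fun s : R => L * (s - a)) s _ _ (is_derive_expR (L * (s - a))) h1).
exact: (is_deriveZ A h2).
Qed.

(* The exponential weight turns Picard's iteration into a contraction of ratio 1/2 on the whole interval. *)
Lemma ac_exp_comparison a b L A (Z z : R -> R) : a <= b -> 0 <= L -> 0 <= A ->
  abs_continuous a b Z ->
  {ae mu, forall s, a <= s <= b -> is_derive s 1 Z (z s) /\
     `|z s| <= L * (A * expR (2 * L * (s - a)))} ->
  `|Z b - Z a| <= A / 2 * expR (2 * L * (b - a)).
Proof.
move=> ab L0 A0 acZ h.
(* A primitive of the bound allowed for [z]: integrating exp (2 L s) divides by 2 L, and the
   prefactor L leaves the ratio 1/2. *)
pose E (s : R) := A / 2 * expR (2 * L * (s - a)).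
have A20 : 0 <= A / 2 by rewrite divr_ge0.
have L20 : 0 <= 2 * L by rewrite mulr_ge0.
have acE : abs_continuous a b E by apply: lip_ac; exact: lip_exp.
have dE (s : R) : is_derive s 1 E (L * (A * expR (2 * L * (s - a)))).
  rewrite (_ : L * _ = A / 2 * (2 * L * expR (2 * L * (s - a)))); last by field.
  exact: is_derive_exp.
have E0 : 0 <= E a by rewrite mulr_ge0// expR_ge0.
have main (g g' : R -> R) : abs_continuous a b g -> {ae mu, forall s, a <= s <= b ->
    is_derive s 1 g (g' s) /\ `|g' s| <= L * (A * expR (2 * L * (s - a)))} ->
    g b - g a <= E b - E a.
  move=> acg hg.
  suff : g b - E b <= g a - E a by lra.
  apply: (@ac_nonincr _ a b (fun s => g s - E s)) => //; first exact: acB.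
  apply: ae_imply1 hg => s hg sab; have [d gs] := hg sab.
  have := is_deriveB d (dE s).
  move/is_derive_slope; apply.
  by rewrite subr_le0 (le_trans (ler_norm _)).
rewrite -/(E b) ler_norml; apply/andP; split; last by have := main Z z acZ h; lra.
suff : - Z b - - Z a <= E b - E a by lra.
apply: (main (fun s => - Z s) (fun s => - z s)); first exact: acN.
apply: ae_imply1 h => s hs sab; have [d zs] := hs sab; split; last by rewrite normrN.
exact: is_deriveN.
Qed.

Lemma ae_forall_ord n (P : 'I_n -> R -> Prop) :
  (forall i, {ae mu, forall s, P i s}) -> {ae mu, forall s, forall i, P i s}.
Proof.
move=> h.
have := @negligible_bigcup _ _ _ mu (fun k => [set s | exists2 i : 'I_n, val i = k & ~ P i s]).
have [n0|n0] := posnP n.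
  by move=> _; apply: aeW => s i; have := ltn_ord i; rewrite [X in (_ < X)%N]n0.
move=> H; apply: negligibleS (H _) => [s /= /existsNP[i Pi]|k].
  by exists (val i) => //; exists i.
have [kn|nk] := ltnP k n.
  apply: negligibleS (h (Ordinal kn)) => s /= [i ik].
  by rewrite (_ : Ordinal kn = i)//; exact: val_inj.
rewrite (_ : [set _ | _] = set0); first exact: negligible_set0.
by apply/seteqP; split => s //= -[i ik]; have := ltn_ord i; rewrite ik ltnNge nk.
Qed.

End comparison.

(** * Caratheodory solutions *)

Section picard.
Context {R : realType} {n : nat}.
Local Notation mu := (@lebesgue_measure R).
Implicit Types (a b s t M L : R) (X Y : R -> 'rV[R]_n).

Definition lip_rV M a b Y := forall s t, a <= s -> s <= t -> t <= b ->
  `|Y t - Y s| <= M * (t - s).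

Lemma lip_rV_coord M a b Y i : 0 <= M -> lip_rV M a b Y -> lip_on a b (fun s => Y s 0 i).
Proof.
move=> M0 h; exists M => // s t as_ st tb; apply: le_trans (h _ _ as_ st tb).
by have := rV_norm_coord (Y t - Y s) i; rewrite !mxE.
Qed.

Lemma lip_rV_ac M a b Y : 0 <= M -> lip_rV M a b Y -> abs_continuous a b Y.
Proof.
move=> M0 hK e e0.
have K1 : 0 < M + 1 by rewrite ltr_wpDl.
exists (e / (M + 1)); first by rewrite divr_gt0.
move=> N l r h1 h2 h3.
apply: (@le_lt_trans _ _ (\sum_(i < N) (M + 1) * (r i - l i))).
  apply: ler_sum => i _; have [al lr rb] := h1 i.
  apply: le_trans (hK _ _ al lr rb) _; apply: ler_wpM2r; rewrite ?subr_ge0//.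
  by rewrite lerDl.
by rewrite -mulr_sumr mulrC -ltr_pdivlMr.
Qed.

Variables (a b L M : R) (F : R -> 'rV[R]_n -> 'rV[R]_n) (x0 : 'rV[R]_n).
Hypotheses (ab : a <= b) (L0 : 0 <= L) (M0 : 0 <= M).
Hypothesis Fmeas : forall Y, lip_rV M a b Y ->
  forall i, measurable_fun `[a, b] (fun s => F s (Y s) 0 i).
Hypothesis Flip : forall s x y, a <= s <= b -> `|F s x - F s y| <= L * `|x - y|.
Hypothesis FM : forall s x, a <= s <= b -> `|F s x| <= M.

Definition picard_step Y (s : R) : 'rV[R]_n :=
  x0 + \row_i prim a (fun r => F r (Y r) 0 i) s.

Lemma picard_stepE Y s i :
  picard_step Y s 0 i = x0 0 i + prim a (fun r => F r (Y r) 0 i) s.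
Proof. by rewrite !mxE. Qed.

Let FMi s x i : a <= s <= b -> `|F s x 0 i| <= M.
Proof. by move=> sab; exact: le_trans (rV_norm_coord _ _) (FM _ sab). Qed.

(** The bound [M] on [F] keeps the iteration among [M]-Lipschitz curves, the class along which [F]
    is assumed measurable. *)
Lemma picard_step_lip Y : lip_rV M a b Y -> lip_rV M a b (picard_step Y).
Proof.
move=> lY s t as_ st tb; apply: rV_norm_le => [|i].
  by rewrite mulr_ge0// subr_ge0.
have -> : (picard_step Y t - picard_step Y s) 0 i =
   prim a (fun r => F r (Y r) 0 i) t - prim a (fun r => F r (Y r) 0 i) s.
  by rewrite !mxE; ring.
apply: (@prim_lip _ a b M) => //; first exact: Fmeas.
by move=> r; exact: FMi.
Qed.

Lemma picard_step_derive Y : lip_rV M a b Y ->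
  {ae mu, forall s, a <= s <= b -> is_derive s 1 (picard_step Y) (F s (Y s))}.
Proof.
move=> lY.
have : {ae mu, forall s, forall i, a <= s <= b ->
    is_derive s 1 (prim a (fun r => F r (Y r) 0 i)) (F s (Y s) 0 i)}.
  apply: ae_forall_ord => i; apply: prim_derive; first exact: Fmeas.
  by move=> r; exact: FMi.
apply: ae_imply1 => s h sab; apply/is_derive_rV => i.
have := is_deriveD (is_derive_cst (x0 0 i) s 1) (h i sab).
rewrite add0r; congr (is_derive _ _ _ _).
by apply/funext => r; rewrite picard_stepE.
Qed.

Definition solves_ae (G : R -> 'rV[R]_n) Y :=
  lip_rV M a b Y /\ {ae mu, forall s, a <= s <= b -> is_derive s 1 Y (G s)}.

(** One contraction step: [ac_exp_comparison] in each coordinate halves the weighted distance.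
    Initial values are subtracted, so the curves may start apart. *)
Lemma solves_ae_dist (G G' : R -> 'rV[R]_n) Y Y' A : 0 <= A ->
  solves_ae G Y -> solves_ae G' Y' ->
  (forall s, a <= s <= b -> `|G s - G' s| <= L * (A * expR (2 * L * (s - a)))) ->
  forall s, a <= s <= b ->
    `|(Y s - Y' s) - (Y a - Y' a)| <= A / 2 * expR (2 * L * (s - a)).
Proof.
move=> A0 [lY dY] [lY' dY'] hG s /andP[as_ sb]; apply: rV_norm_le => [|i].
  by rewrite mulr_ge0 ?expR_ge0// divr_ge0.
have -> : (Y s - Y' s - (Y a - Y' a)) 0 i =
   (Y s 0 i - Y' s 0 i) - (Y a 0 i - Y' a 0 i) by rewrite !mxE.
apply: (@ac_exp_comparison _ a s L A (fun r => Y r 0 i - Y' r 0 i)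
  (fun r => G r 0 i - G' r 0 i)) => //.
  apply: (ac_sub (lexx a) sb); apply: acB; apply: lip_ac.
    exact: lip_rV_coord M0 lY.
  exact: lip_rV_coord M0 lY'.
apply: ae_imply2 dY dY' => r d d' /andP[ar rs].
have rab : a <= r <= b by rewrite ar (le_trans rs).
split.
  have /is_derive_rV/(_ i) h := d rab; have /is_derive_rV/(_ i) h' := d' rab.
  exact: is_deriveB.
apply: le_trans (hG _ rab).
by have := rV_norm_coord (G r - G' r) i; rewrite !mxE.
Qed.

(** The iteration starts from a solution with another initial value, so that existence and
    continuous dependence come together: the first step has size [|x0 - X a|] and each later one is
    half the previous bound. *)
Lemma picard X : solves_ae (fun s => F s (X s)) X ->
  exists Y, [/\ Y a = x0, solves_ae (fun s => F s (Y s)) Y &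
    forall s, a <= s <= b ->
      `|Y s - X s| <= 2 * (`|x0 - X a| * expR (2 * L * (s - a)))].
Proof.
move=> sX; pose Y k := iter k picard_step X.
have lY k : lip_rV M a b (Y k).
  by elim: k => [|k IH]; [case: sX|exact: picard_step_lip].
have sY k : solves_ae (fun s => F s (Y k s)) (Y k.+1).
  by split; [exact: lY|exact: picard_step_derive].
have aab : a <= a <= b by rewrite lexx.
have Ya k : Y k.+1 a = x0.
  by apply/rowP => i; rewrite /= picard_stepE prim_point addr0.
set A := `|x0 - X a|.
pose E s := A * expR (2 * L * (s - a)).
have E0 s : 0 <= E s by apply: mulr_ge0; [exact: normr_ge0|exact: expR_ge0].
have dY k s : a <= s <= b -> `|Y k.+1 s - Y k s| <= E s * (2^-1) ^+ k.
  elim: k s => [|k IH] s sab.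
    rewrite expr0 mulr1.
    (* [Y 1] and [X] have the same right-hand side, hence differ by the constant x0 - X a. *)
    have := @solves_ae_dist _ _ (Y 1%N) X 0 (lexx 0) (sY 0%N) sX.
    have h r : a <= r <= b -> `|F r (Y 0%N r) - F r (X r)| <= L * (0 * expR (2 * L * (r - a))).
      by move=> _; rewrite /= subrr normr0 mul0r mulr0.
    move=> /(_ h _ sab); rewrite !mul0r normr_le0 subr_eq0 => /eqP ->.
    rewrite Ya -/A /E ler_peMr ?normr_ge0// -expR0 ler_expR mulr_ge0 ?mulr_ge0//.
    by rewrite subr_ge0; case/andP: sab.
  have A0 : 0 <= A * (2^-1) ^+ k by rewrite mulr_ge0 ?normr_ge0// exprn_ge0.
  have := @solves_ae_dist _ _ (Y k.+2) (Y k.+1) _ A0 (sY k.+1) (sY k).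
  have h r : a <= r <= b ->
      `|F r (Y k.+1 r) - F r (Y k r)| <= L * (A * (2^-1) ^+ k * expR (2 * L * (r - a))).
    move=> rab; apply: le_trans (Flip _ _ rab) _; rewrite ler_wpM2l//.
    by apply: le_trans (IH _ rab) _; rewrite /E mulrAC.
  move=> /(_ h _ sab); rewrite !Ya subrr subr0 => /le_trans; apply.
  by rewrite /E exprS le_eqVlt; apply/orP; left; apply/eqP; ring.
pose P s i l := forall k, `|Y k s 0 i - l| <= 2 * E s * (2^-1) ^+ k.
have exl s i : a <= s <= b -> exists l, P s i l.
  move=> sab; apply: half_pow_cvg => // k.
  apply: le_trans (dY k s sab).
  by have := rV_norm_coord (Y k.+1 s - Y k s) i; rewrite !mxE.
pose Z s : 'rV[R]_n := \row_i xget 0 (P s i).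
have ZP s : a <= s <= b -> forall k, `|Y k s - Z s| <= 2 * E s * (2^-1) ^+ k.
  move=> sab k; apply: rV_norm_le => [|i].
    by rewrite mulr_ge0 ?exprn_ge0// mulr_ge0.
  by rewrite !mxE; have := xgetPex 0 (exl s i sab); exact.
have lZ : lip_rV M a b Z.
  move=> s t as_ st tb.
  have sab : a <= s <= b by rewrite as_ (le_trans st).
  have tab : a <= t <= b by rewrite tb (le_trans as_).
  apply/ler_addgt0Pr => e e0.
  have D0 : 0 <= 2 * E s + 2 * E t by rewrite addr_ge0// mulr_ge0.
  have [k hk] := half_pow_le D0 e0.
  have -> : Z t - Z s = (Y k t - Y k s) + ((Y k s - Z s) - (Y k t - Z t)).
    by apply/rowP => i; rewrite !mxE; ring.
  apply: le_trans (ler_normD _ _) _; apply: lerD; first exact: lY.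
  apply: le_trans (ler_normB _ _) _; apply: le_trans (ltW hk).
  by rewrite mulrDl; apply: lerD; exact: ZP.
have ZE s : a <= s <= b -> Z s = picard_step Z s.
  move=> sab; apply/rowP => i.
  (* The summand 1 pays for the distance from [Y k.+1] to its limit, the summand L (b - a) for the
     distance from [Y k.+1] to the Picard step of the limit, by integrating the Lipschitz bound on
     [F]. *)
  pose D := 2 * E b * (L * (b - a) + 1).
  have asE : a <= s by case/andP: sab.
  have sb : s <= b by case/andP: sab.
  have Eb r : a <= r <= b -> E r <= E b.
    move=> /andP[ar rb]; rewrite /E ler_wpM2l ?normr_ge0// ler_expR ler_wpM2l ?mulr_ge0//.
    lra.
  have D0 : 0 <= D.
    apply: mulr_ge0; first exact: mulr_ge0.
    by rewrite addr_ge0// mulr_ge0// subr_ge0.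
  apply: (half_pow_eq D0) => k.
  have h1 : `|Y k.+1 s 0 i - Z s 0 i| <= 2 * E b * (2^-1) ^+ k.
    apply: le_trans (rV_norm_coordB _ _ _) _; apply: le_trans (ZP _ sab _) _.
    apply: ler_pM; [exact: mulr_ge0|exact: exprn_ge0| |].
      by apply: ler_wpM2l => //; exact: Eb.
    by rewrite exprS ler_piMl ?exprn_ge0// invf_le1// ler1n.
  have h2 : `|Y k.+1 s 0 i - picard_step Z s 0 i| <= L * (2 * E b * (2^-1) ^+ k) * (b - a).
    rewrite /= !picard_stepE.
    set p := prim a _ s; set q := prim a _ s.
    have -> : x0 0 i + p - (x0 0 i + q) = p - q by ring.
    rewrite /p /q /prim -RintegralB//=; last 2 first.
    - apply: (integrable_sub (bounded_integrable (Fmeas (lY k) i) _) (lexx a) sb).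
      by move=> r; exact: FMi.
    - apply: (integrable_sub (bounded_integrable (Fmeas lZ i) _) (lexx a) sb).
      by move=> r; exact: FMi.
    set K := L * _.
    have K0 : 0 <= K by apply: mulr_ge0 => //; apply: mulr_ge0; [exact: mulr_ge0|exact: exprn_ge0].
    apply: (@le_trans _ _ (K * (s - a))); last by rewrite ler_wpM2l//; lra.
    apply: prim_norm_le => //.
      apply: measurable_funB.
        apply: measurable_funS (Fmeas (lY k) i) => // r /=; rewrite !in_itv/=.
        by move=> /andP[-> /le_trans ->].
      apply: measurable_funS (Fmeas lZ i) => // r /=; rewrite !in_itv/=.
      by move=> /andP[-> /le_trans ->].
    move=> r /andP[ar rs]; have rab : a <= r <= b by rewrite ar (le_trans rs).
    apply: le_trans (rV_norm_coordB _ _ _) _; apply: le_trans (Flip _ _ rab) _; rewrite ler_wpM2l//.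
    apply: le_trans (ZP _ rab _) _; rewrite ler_wpM2r ?exprn_ge0// ler_wpM2l//.
    exact: Eb.
  have -> : Z s 0 i - picard_step Z s 0 i =
     (Y k.+1 s 0 i - picard_step Z s 0 i) - (Y k.+1 s 0 i - Z s 0 i) by ring.
  apply: le_trans (ler_normB _ _) _; apply: le_trans (lerD h2 h1) _.
  by rewrite /D le_eqVlt; apply/orP; left; apply/eqP; ring.
have Za : Z a = x0.
  by rewrite ZE//; apply/rowP => i; rewrite picard_stepE prim_point addr0.
(* The limit agrees with its Picard step on [a, b] only; returning the step makes
   [picard_step_derive] apply as it stands. *)
pose Z' s := picard_step Z s.
exists Z'; split.
- by rewrite /Z' -ZE.
- split; first exact: picard_step_lip.
  by apply: ae_imply1 (picard_step_derive lZ) => s h sab; rewrite /Z' -ZE//; exact: h.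
- move=> s sab; rewrite /Z' -ZE// distrC; have := ZP s sab 0%N.
  by rewrite expr0 mulr1.
Qed.

End picard.

(** * Trajectories of a controlled system: bounds, uniqueness, stability *)

Section trajectories.
Context {R : realType} {n m : nat}.
Local Notation mu := (@lebesgue_measure R).
Implicit Types (a b s t T r : R) (x y : 'rV[R]_n) (X Y : R -> 'rV[R]_n)
  (u : R -> 'rV[R]_m).

(** [h] depends uniformly continuously on time and on the coordinates of [u], which are measurable.
    In [Z], index [ord0] stands for time and the lifted indices for the control. *)
Lemma ctrl_lip_measurable a b K u (h : R -> R) : 0 <= K ->
  (forall j, measurable_fun `[a, b] (fun s : R => u s 0 j)) ->
  (forall s t, a <= s <= b -> a <= t <= b ->
     `|h s - h t| <= K * (`|s - t| + `|u s - u t|)) ->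
  measurable_fun `[a, b] h.
Proof.
move=> K0 mu_ hK.
pose Z (i : 'I_m.+1) (s : R) : R := oapp (fun j => u s 0 j) s (unlift ord0 i).
apply: (@unif_cont_measurable_fun _ _ _ _ _ _ Z) => //.
  move=> i; rewrite /Z; case: unliftP => [j _|_] /=; first exact: mu_.
  exact: measurable_id.
move=> e e0; exists (e / (2 * (K + 1))); first by rewrite divr_gt0// mulr_gt0// ltr_wpDl.
move=> s t /= sab tab hZ.
move: sab tab; rewrite !in_itv/= => sab tab.
apply: le_lt_trans (hK _ _ sab tab) _.
set d := e / _ in hZ.
have d0 : 0 < d by rewrite divr_gt0// mulr_gt0// ltr_wpDl.
have h1 : `|s - t| <= d by apply: ltW; have := hZ ord0; rewrite /Z unlift_none.
have h2 : `|u s - u t| <= d.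
  apply: rV_norm_le => [|j]; first exact: ltW.
  apply: ltW; have := hZ (lift ord0 j); rewrite /Z liftK/=.
  by rewrite !mxE.
apply: (@le_lt_trans _ _ (K * (d + d))); first by rewrite ler_wpM2l// lerD.
have -> : K * (d + d) = e * (K / (K + 1)).
  by rewrite /d; field; rewrite gt_eqF// ltr_wpDl.
by rewrite gtr_pMr// ltr_pdivrMr ?ltr_wpDl// mul1r ltrDl.
Qed.

Variables (f : 'rV[R]_n * 'rV[R]_m -> 'rV[R]_n) (U : set 'rV[R]_m).

Definition box_lip := forall r, exists2 K : R, 0 <= K & forall x y v w,
  `|x| <= r -> `|y| <= r -> U v -> U w ->
  `|f (x, v) - f (y, w)| <= K * (`|x - y| + `|v - w|).
Definition box_bounded := forall r, exists2 M : R, 0 <= M & forall x v,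
  `|x| <= r -> U v -> `|f (x, v)| <= M.

Hypotheses (flip : box_lip) (fbnd : box_bounded).

(* Trajectories are indexed by absolute time, unlike [is_solution], which uses the time elapsed
   since the start. *)
Definition traj t T x u X := [/\ X t = x, abs_continuous t T X &
  {ae mu, forall s, t <= s <= T -> is_derive s 1 X (f (X s, u s))}].

Lemma traj_sub t T x u X t' T' : t <= t' -> T' <= T ->
  traj t T x u X -> traj t' T' (X t') u X.
Proof.
move=> tt TT [h1 h2 h3]; split => //; first exact: ac_sub h2.
apply: ae_imply1 h3 => s h /andP[s1 s2]; apply: h.
by rewrite (le_trans tt)// (le_trans s2).
Qed.

(** Absolute continuity with tolerance 1 limits the motion to 1 over any time shorter than [d];
    finitely many steps of length d / 2 cover the interval. *)
Lemma ac_bounded t T X : abs_continuous t T X ->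
  exists2 r, 0 <= r & forall s, t <= s <= T -> `|X s| <= r.
Proof.
move=> acX; have [d d0 hd] := acX _ (ltr01 : (0 : R) < 1).
have step s s' : t <= s -> s <= s' -> s' <= T -> s' - s < d -> `|X s' - X s| < 1.
  move=> ts ss sT dd.
  have := hd 1%N (fun=> s) (fun=> s'); rewrite !big_ord1; apply => //.
  by move=> i j; rewrite !ord1.
have main k s : t <= s <= T -> s - t <= k%:R * (d / 2) -> `|X s| <= `|X t| + k%:R.
  elim: k s => [|k IH] s /andP[ts sT].
    rewrite mul0r subr_le0 addr0 => st.
    by have -> : s = t by apply/eqP; rewrite eq_le st ts.
  move=> h; have [h'|h'] := leP (s - t) (k%:R * (d / 2)).
    apply: le_trans (IH _ _ h') _; first by rewrite ts sT.
    by rewrite lerD2l ler_nat.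
  pose s' := t + k%:R * (d / 2).
  have ts' : t <= s' by rewrite lerDl mulr_ge0// divr_ge0// ltW.
  have s's : s' <= s by rewrite /s'; lra.
  have := IH s'; rewrite ts' (le_trans s's sT) => /(_ isT).
  have -> : s' - t = k%:R * (d / 2) by rewrite /s'; ring.
  move=> /(_ (lexx _)) h1.
  have : `|X s - X s'| < 1.
    apply: step => //; move: h; rewrite -natr1 mulrDl mul1r /s'; lra.
  have := ler_normD (X s - X s') (X s'); rewrite subrK -natr1; lra.
have [tT|Tt] := leP t T; last first.
  by exists 0 => // s /andP[s1 s2]; have := le_lt_trans s2 Tt; rewrite ltNge s1.
pose k := (Num.truncn ((T - t) / (d / 2))).+1.
have hk : T - t <= k%:R * (d / 2).
  rewrite -ler_pdivrMr ?divr_gt0//; apply: ltW; exact: truncnS_gt.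
exists (`|X t| + k%:R); first by rewrite addr_ge0.
move=> s sT; apply: main => //; case/andP: sT => ts sT; lra.
Qed.

Lemma ac_derive_lip t T X (G : R -> 'rV[R]_n) M : 0 <= M -> abs_continuous t T X ->
  {ae mu, forall s, t <= s <= T -> is_derive s 1 X (G s) /\ `|G s| <= M} ->
  lip_rV M t T X.
Proof.
move=> M0 acX h s s' ts ss sT; apply: rV_norm_le => [|i].
  by rewrite mulr_ge0// subr_ge0.
have -> : (X s' - X s) 0 i = X s' 0 i - X s 0 i by rewrite !mxE.
apply: (@ac_norm_le _ s s' M (fun r => X r 0 i) (fun r => G r 0 i)) => //.
  apply: ac_coord; exact: ac_sub acX.
apply: ae_imply1 h => r h /andP[sr rs]; have [|d GM] := h.
  by rewrite (le_trans ts)// (le_trans rs).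
split; first by move/is_derive_rV : d.
exact: le_trans (rV_norm_coord _ _) GM.
Qed.

Lemma traj_bounded_lip t T x u X : (forall s, t <= s <= T -> U (u s)) ->
  traj t T x u X -> exists r M, [/\ 0 <= r, 0 <= M,
    forall s, t <= s <= T -> `|X s| <= r & lip_rV M t T X].
Proof.
move=> Uu [_ acX dX]; have [r' r'0 hr] := ac_bounded acX.
have [M M0 hM] := fbnd r'; exists r', M; split => //.
apply: (ac_derive_lip M0 acX); apply: ae_imply1 dX => s h sT; split; first exact: h.
by apply: hM; [exact: hr|exact: Uu].
Qed.

Lemma solves_ae_traj t T x u X M : 0 <= M -> X t = x ->
  solves_ae t T M (fun s => f (X s, u s)) X -> traj t T x u X.
Proof. by move=> M0 Xt [lX dX]; split => //; exact: lip_rV_ac lX. Qed.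

(** The Picard contraction applied to the pair: the crude bound [2 * r] on the distance is halved
    again and again in the exponentially weighted norm. *)
Lemma traj_unique t T x u X Y : (forall s, t <= s <= T -> U (u s)) ->
  traj t T x u X -> traj t T x u Y -> forall s, t <= s <= T -> X s = Y s.
Proof.
move=> Uu tX tY s stT.
have [r1 [M1 [r10 M10 hr1 lX]]] := traj_bounded_lip Uu tX.
have [r2 [M2 [r20 M20 hr2 lY]]] := traj_bounded_lip Uu tY.
pose r := r1 + r2; pose M := M1 + M2.
have M0 : 0 <= M by rewrite addr_ge0.
have [L L0 hL] := flip r.
have tT : t <= T by case/andP: stT => /le_trans; apply.
have hrX q : t <= q <= T -> `|X q| <= r by move=> /hr1 h; rewrite /r; lra.
have hrY q : t <= q <= T -> `|Y q| <= r by move=> /hr2 h; rewrite /r; lra.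
have sX : solves_ae t T M (fun s => f (X s, u s)) X.
  split; last by case: tX.
  move=> p q tp pq qT; apply: le_trans (lX _ _ tp pq qT) _.
  by rewrite ler_wpM2r ?subr_ge0// lerDl.
have sY : solves_ae t T M (fun s => f (Y s, u s)) Y.
  split; last by case: tY.
  move=> p q tp pq qT; apply: le_trans (lY _ _ tp pq qT) _.
  by rewrite ler_wpM2r ?subr_ge0// lerDr.
have Xt : X t = x by case: tX.
have Yt : Y t = x by case: tY.
pose A := 2 * r; have A0 : 0 <= A by rewrite mulr_ge0// addr_ge0.
have hk k q : t <= q <= T -> `|X q - Y q| <= A * (2^-1) ^+ k * expR (2 * L * (q - t)).
  elim: k q => [|k IH] q qtT.
    rewrite expr0 mulr1; apply: (@le_trans _ _ A).
      apply: le_trans (ler_normB _ _) _; have := hrX _ qtT; have := hrY _ qtT.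
      rewrite /A; lra.
    rewrite ler_peMr// -expR0 ler_expR !mulr_ge0// subr_ge0.
    by case/andP: qtT.
  have Ak0 : 0 <= A * (2^-1) ^+ k by apply: mulr_ge0 => //; exact: exprn_ge0.
  have h p : t <= p <= T -> `|f (X p, u p) - f (Y p, u p)| <=
     L * (A * (2^-1) ^+ k * expR (2 * L * (p - t))).
    move=> ptT; have := hL (X p) (Y p) (u p) (u p) (hrX _ ptT) (hrY _ ptT) (Uu _ ptT) (Uu _ ptT).
    rewrite subrr normr0 addr0 => /le_trans; apply; rewrite ler_wpM2l//; exact: IH.
  have := solves_ae_dist L0 M0 Ak0 sX sY h qtT.
  rewrite Xt Yt subrr subr0 => /le_trans; apply.
  by rewrite exprS le_eqVlt; apply/orP; left; apply/eqP; ring.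
apply/rowP => i; apply: (@half_pow_eq _ (A * expR (2 * L * (s - t)))).
  by rewrite mulr_ge0// expR_ge0.
move=> k; apply: le_trans (rV_norm_coordB _ _ _) _; rewrite mulrAC; exact: hk.
Qed.

(* Clipping the displacement from a given trajectory makes the vector field globally Lipschitz,
   so that Picard iteration converges; solutions starting close enough stay in the unit tube,
   where clipping is the identity. *)
Definition clip (v : 'rV[R]_n) : 'rV[R]_n := \row_i Num.max (-1) (Num.min 1 (v 0 i)).

Lemma clip_norm v : `|clip v| <= 1.
Proof.
apply: rV_norm_le => // i; rewrite mxE ler_norml le_max lexx/= ge_max.
by rewrite ge_min lexx/= andbT; lra.
Qed.

Lemma clip_lip v w : `|clip v - clip w| <= `|v - w|.
Proof.
apply: rV_norm_le => // i; apply: le_trans (rV_norm_coordB v w i).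
rewrite !mxE; set p := v 0 i; set q := w 0 i.
have hmax (a b c : R) : `|Num.max a b - Num.max a c| <= `|b - c|.
  by case: (leP a b) => ab; case: (leP a c) => ac; rewrite ?subrr ?normr0//;
    rewrite ler_norml; apply/andP; split;
    have := ler_norm (b - c); have := ler_normr (b - c) (b - c); rewrite lexx/= => _;
    have := lerNnormlW (lexx `|b - c|); lra.
have hmin (a b c : R) : `|Num.min a b - Num.min a c| <= `|b - c|.
  by case: (leP a b) => ab; case: (leP a c) => ac; rewrite ?subrr ?normr0//;
    rewrite ler_norml; apply/andP; split;
    have := ler_norm (b - c); have := lerNnormlW (lexx `|b - c|); lra.
exact: le_trans (hmax _ _ _) (hmin _ _ _).
Qed.

Lemma clip_id v : `|v| <= 1 -> clip v = v.
Proof.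
move=> v1; apply/rowP => i; rewrite mxE.
have := le_trans (rV_norm_coord v i) v1; rewrite ler_norml => /andP[h1 h2].
by rewrite (min_idPr h2) (max_idPr h1).
Qed.

(** [C] is uniform in the restart time and position, as needed to compare with all points of a small
    box at once. The condition [C * |x' - X t'| <= 1] keeps the restarted trajectory in the unit
    tube around [X]. *)
Lemma traj_near t T x u X : t <= T -> (forall s, t <= s <= T -> U (u s)) ->
  (forall j, measurable_fun `[t, T] (fun s : R => u s 0 j)) ->
  traj t T x u X -> exists C, 0 <= C /\ forall t' x', t <= t' <= T ->
    C * `|x' - X t'| <= 1 ->
    exists2 Y, traj t' T x' u Y &
      forall s, t' <= s <= T -> `|Y s - X s| <= C * `|x' - X t'|.
Proof.
move=> tT Uu mu_ tX.
have [r [M1 [r0 M10 hr lX]]] := traj_bounded_lip Uu tX.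
have [L L0 hL] := flip (r + 1).
have [M M0 hM] := fbnd (r + 1).
exists (2 * expR (2 * L * (T - t))); split; first by rewrite mulr_ge0// expR_ge0.
move=> t' x' /andP[tt' t'T] hx'.
pose F (s : R) (z : 'rV[R]_n) := f (X s + clip (z - X s), u s).
have sub s : t' <= s <= T -> t <= s <= T by move=> /andP[h ->]; rewrite (le_trans tt').
have hz s (z : 'rV[R]_n) : t' <= s <= T -> `|X s + clip (z - X s)| <= r + 1.
  by move=> sT; apply: le_trans (ler_normD _ _) _; apply: lerD; [exact/hr/sub|exact: clip_norm].
have FM s z : t' <= s <= T -> `|F s z| <= M.
  by move=> sT; apply: hM; [exact: hz|exact/Uu/sub].
(* One estimate with two uses: s = q gives the Lipschitz bound in the state, and distinct times give
   measurability along Lipschitz curves. *)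
have Fdist s q (z w : 'rV[R]_n) : t' <= s <= T -> t' <= q <= T ->
   `|F s z - F q w| <= L * (`|z - w| + 2 * `|X s - X q| + `|u s - u q|).
  move=> sT qT; apply: le_trans (hL _ _ _ _ (hz _ z sT) (hz _ w qT) (Uu _ (sub _ sT)) (Uu _ (sub _ qT))) _.
  rewrite ler_wpM2l// lerD2r.
  have -> : X s + clip (z - X s) - (X q + clip (w - X q)) =
     (X s - X q) + (clip (z - X s) - clip (w - X q)) by apply/rowP => i; rewrite !mxE; ring.
  apply: le_trans (ler_normD _ _) _.
  have h1 := clip_lip (z - X s) (w - X q).
  have h2 : `|(z - X s) - (w - X q)| <= `|z - w| + `|X s - X q|.
    have -> : z - X s - (w - X q) = (z - w) - (X s - X q) by apply/rowP => i; rewrite !mxE; ring.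
    exact: ler_normB.
  lra.
have Flip s z w : t' <= s <= T -> `|F s z - F s w| <= L * `|z - w|.
  move=> sT; have := Fdist s s z w sT sT; rewrite !subrr !normr0.
  by rewrite mulr0 !addr0.
have absl (M' : R) Y s q : lip_rV M' t' T Y -> t' <= s <= T -> t' <= q <= T ->
   `|Y s - Y q| <= M' * `|s - q|.
  move=> lY /andP[s1 s2] /andP[q1 q2]; have [sq|qs] := leP s q.
    by rewrite distrC (distrC s) (ger0_norm (_ : 0 <= q - s)) ?subr_ge0//; exact: lY.
  by rewrite (ger0_norm (_ : 0 <= s - q)) ?subr_ge0 ?(ltW qs)//; apply: lY => //; exact: ltW.
have lX' : lip_rV M1 t' T X by move=> s q ts; apply: lX; exact: le_trans ts.
have Fmeas Y : lip_rV M t' T Y -> forall i, measurable_fun `[t', T] (fun s => F s (Y s) 0 i).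
  move=> lY i; apply: (@ctrl_lip_measurable _ _ (L * (M + 2 * M1 + 1)) u).
  - by rewrite mulr_ge0// !addr_ge0// mulr_ge0.
  - move=> j; apply: measurable_funS (mu_ j) => // s /=; rewrite !in_itv/=; exact: sub.
  - move=> s q sT qT; apply: le_trans (rV_norm_coordB _ _ _) _.
    apply: le_trans (Fdist _ _ _ _ sT qT) _; rewrite -mulrA ler_wpM2l//.
    have h1 := absl _ _ _ _ lY sT qT; have h2 := absl _ _ _ _ lX' sT qT.
    have h3 := normr_ge0 (u s - u q); have h4 := normr_ge0 (s - q).
    have h5 : 0 <= (M + 2 * M1) * `|u s - u q| by rewrite mulr_ge0// addr_ge0// mulr_ge0.
    have -> : (M + 2 * M1 + 1) * (`|s - q| + `|u s - u q|) = M * `|s - q| +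
      2 * (M1 * `|s - q|) + `|s - q| + ((M + 2 * M1) * `|u s - u q|) + `|u s - u q| by ring.
    lra.
have FX s : F s (X s) = f (X s, u s).
  rewrite /F subrr (_ : clip 0 = 0) ?addr0//; apply: clip_id; rewrite normr0//.
have sX : solves_ae t' T M (fun s => F s (X s)) X.
  have dX : {ae mu, forall s, t' <= s <= T -> is_derive s 1 X (F s (X s))}.
    case: tX => _ _; apply: ae_imply1 => s h /sub sT; rewrite FX; exact: h.
  split => //; apply: (@ac_derive_lip _ _ _ (fun s => F s (X s))) => //.
    by case: tX => _ + _; exact: ac_sub.
  by apply: ae_imply1 dX => s h sT; split; [exact: h|exact: FM].
have [Y [Yt' sY hY]] := @picard _ _ t' T L M F x' t'T L0 M0 Fmeas Flip FM X sX.
have hYX s : t' <= s <= T -> `|Y s - X s| <= 2 * expR (2 * L * (T - t)) * `|x' - X t'|.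
  move=> sT; apply: le_trans (hY _ sT) _.
  rewrite mulrCA mulrC; apply: ler_wpM2r; first exact: normr_ge0.
  apply: ler_wpM2l => //; rewrite ler_expR; apply: ler_wpM2l; first exact: mulr_ge0.
  by case/andP: sT; lra.
exists Y => //; apply: (@solves_ae_traj _ _ _ _ _ M) => //.
case: sY => lY dY; split => //; apply: ae_imply1 dY => s h sT.
have := h sT; rewrite /F clip_id; first by rewrite addrC subrK.
exact: le_trans (hYX _ sT) hx'.
Qed.

End trajectories.

(** * Consequences of the Lipschitz hypotheses *)

Section local_lipschitz.
Context {R : realType} {n m : nat}.
Implicit Types (x y : 'rV[R]_n) (v w : 'rV[R]_m) (r s t T : R).

Definition box p r := [set x : 'rV[R]_p | forall i, `[- r, r]%classic (x ord0 i)].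

Lemma box_compact p r : compact (@box p r).
Proof.
apply: (@rV_compact _ _ (fun=> `[- r, r]%classic)) => _; exact: segment_compact.
Qed.

Lemma norm_box p (x : 'rV[R]_p) r : `|x| <= r -> box r x.
Proof.
move=> xr i /=; rewrite in_itv/= -ler_norml; exact: le_trans (rV_norm_coord _ _) xr.
Qed.

Lemma compact_norm_le p (U : set 'rV[R]_p) : compact U ->
  exists2 r, 0 <= r & forall z, U z -> `|z| <= r.
Proof.
move=> /compact_bounded[r [_ hr]]; exists (`|r| + 1); first exact: addr_ge0.
by move=> z Uz; apply: hr => //; apply: le_lt_trans (ler_norm r) _; rewrite ltrDl.
Qed.

Lemma sqrt_sum2_le (a b : R) : 0 <= a -> 0 <= b -> Num.sqrt (a ^+ 2 + b ^+ 2) <= a + b.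
Proof.
move=> a0 b0; rewrite -[leRHS]ger0_norm ?addr_ge0// -sqrtr_sqr ler_wsqrtr//.
by rewrite sqrrD; have := mulr_ge0 a0 b0; lra.
Qed.

Lemma sqrt_sum3_le (a b c : R) : 0 <= a -> 0 <= b ->
  Num.sqrt (a ^+ 2 + b ^+ 2 + c ^+ 2) <= a + b + `|c|.
Proof.
move=> a0 b0; have := sqrt_sum2_le (sqrtr_ge0 (a ^+ 2 + b ^+ 2)) (normr_ge0 c).
rewrite sqr_sqrtr ?addr_ge0 ?sqr_ge0// real_normK ?num_real// => /le_trans; apply.
by rewrite lerD2r; exact: sqrt_sum2_le.
Qed.

Lemma l2norm_ge0 p (z : 'rV[R]_p) : 0 <= l2norm z.
Proof. exact: sqrtr_ge0. Qed.

(** A box times the compact [U] is compact, so the local hypothesis gives one constant for all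
    controls; comparing norms contributes the dimensions. *)
Lemma loc_lip_f (f : 'rV[R]_n * 'rV[R]_m -> 'rV[R]_n) (U : set 'rV[R]_m) :
  compact U ->
  loc_lip (fun z : 'rV[R]_n * 'rV[R]_m => Num.sqrt (l2norm z.1 ^+ 2 + l2norm z.2 ^+ 2))
    (@l2norm R n) (setT `*` U) f -> box_lip f U.
Proof.
move=> cU lf r; have [|K K0 hK] := lf _ (compact_setX (@box_compact n r) cU).
  by move=> z [].
exists (K * (n%:R + m%:R)); first by rewrite mulr_ge0 ?addr_ge0// ltW.
move=> x y v w xr yr Uv Uw.
have := hK (x, v) (y, w); rewrite /setX/=.
move=> /(_ (conj (norm_box xr) Uv) (conj (norm_box yr) Uw)).
move=> /(le_trans (l2norm_ge _))/le_trans; apply; rewrite -mulrA ler_wpM2l ?(ltW K0)//.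
apply: le_trans (sqrt_sum2_le (l2norm_ge0 _) (l2norm_ge0 _)) _.
have h1 := l2norm_le (x - y); have h2 := l2norm_le (v - w).
have h3 : 0 <= m%:R * `|x - y| by rewrite mulr_ge0.
have h4 : 0 <= n%:R * `|v - w| by rewrite mulr_ge0.
by rewrite mulrDl !mulrDr; lra.
Qed.

Definition cost_lip (c : 'rV[R]_n * 'rV[R]_m * R -> R) (U : set 'rV[R]_m) T :=
  forall r, exists2 K : R, 0 <= K & forall x y v w s t,
  `|x| <= r -> `|y| <= r -> U v -> U w -> 0 <= s <= T -> 0 <= t <= T ->
  `|c (x, v, s) - c (y, w, t)| <= K * (`|x - y| + `|v - w| + `|s - t|).

Lemma loc_lip_c (c : 'rV[R]_n * 'rV[R]_m * R -> R) (U : set 'rV[R]_m) T :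
  compact U ->
  loc_lip (fun z : 'rV[R]_n * 'rV[R]_m * R =>
     Num.sqrt (l2norm z.1.1 ^+ 2 + l2norm z.1.2 ^+ 2 + z.2 ^+ 2))
    (fun r : R => `|r|) (setT `*` U `*` `[0, T]) c -> cost_lip c U T.
Proof.
move=> cU lf r.
have cK : compact (box r `*` U `*` `[0, T] : set ('rV[R]_n * 'rV[R]_m * R)).
  apply: compact_setX; last exact: segment_compact.
  by apply: compact_setX => //; exact: box_compact.
have [|K K0 hK] := lf _ cK.
  by move=> z [[? ?] ?].
exists (K * (n%:R + m%:R + 1)); first by rewrite mulr_ge0 ?addr_ge0// ltW.
move=> x y v w s t xr yr Uv Uw sT tT.
have h1 : (box r `*` U `*` `[0, T]%classic) (x, v, s).
  by split => /=; [split => //; exact: norm_box|rewrite in_itv].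
have h2 : (box r `*` U `*` `[0, T]%classic) (y, w, t).
  by split => /=; [split => //; exact: norm_box|rewrite in_itv].
have := hK _ _ h1 h2 => /=.
move=> /le_trans; apply; rewrite -mulrA ler_wpM2l ?(ltW K0)//.
apply: le_trans (sqrt_sum3_le _ (l2norm_ge0 _) (l2norm_ge0 _)) _.
have {}h1 := l2norm_le (x - y); have {}h2 := l2norm_le (v - w).
have h3 : 0 <= (m%:R + 1) * `|x - y| by rewrite mulr_ge0// addr_ge0.
have h4 : 0 <= (n%:R + 1) * `|v - w| by rewrite mulr_ge0// addr_ge0.
have h5 : 0 <= (n%:R + m%:R) * `|s - t| by rewrite mulr_ge0// addr_ge0.
have -> : (n%:R + m%:R + 1) * (`|x - y| + `|v - w| + `|s - t|) =
  n%:R * `|x - y| + (m%:R + 1) * `|x - y| + (m%:R * `|v - w| + (n%:R + 1) * `|v - w|)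
   + (`|s - t| + (n%:R + m%:R) * `|s - t|) by ring.
lra.
Qed.

Lemma loc_lip_g (g : 'rV[R]_n -> R) :
  loc_lip (@l2norm R n) (fun r : R => `|r|) setT g ->
  forall r, exists2 K : R, 0 <= K & forall x y, `|x| <= r -> `|y| <= r ->
    `|g x - g y| <= K * `|x - y|.
Proof.
move=> lg r; have [//|K K0 hK] := lg _ (@box_compact n r).
exists (K * n%:R); first by rewrite mulr_ge0// ltW.
move=> x y xr yr; apply: le_trans (hK _ _ (norm_box xr) (norm_box yr)) _.
by rewrite -mulrA ler_wpM2l ?(ltW K0)//; exact: l2norm_le.
Qed.

Lemma box_lip_bounded (f : 'rV[R]_n * 'rV[R]_m -> 'rV[R]_n) (U : set 'rV[R]_m) :
  compact U -> box_lip f U -> box_bounded f U.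
Proof.
move=> /compact_norm_le[q q0 hq] lf r.
have [K K0 hK] := lf r.
have [r0|r0] := leP 0 r; last first.
  by exists 0 => // x v xr; have := le_lt_trans (le_trans (normr_ge0 _) xr) r0; rewrite ltxx.
have [[v0 Uv0]|nU] := pselect (exists v, U v); last first.
  by exists 0 => // x v _ Uv; exfalso; apply: nU; exists v.
exists (`|f (0, v0)| + K * (r + (q + q))).
  by rewrite addr_ge0// mulr_ge0// !addr_ge0.
move=> x v xr Uv; have n0 : `|0 : 'rV[R]_n| <= r by rewrite normr0.
have := hK x 0 v v0 xr n0 Uv Uv0; rewrite subr0 => h.
have h1 := ler_normB v v0; have h2 := hq _ Uv; have h3 := hq _ Uv0.
have h4 : K * (`|x| + `|v - v0|) <= K * (r + (q + q)) by rewrite ler_wpM2l//; lra.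
have := ler_normD (f (x, v) - f (0, v0)) (f (0, v0)); rewrite subrK; lra.
Qed.

Lemma cost_lip_bounded (c : 'rV[R]_n * 'rV[R]_m * R -> R) (U : set 'rV[R]_m) T :
  0 <= T -> compact U -> cost_lip c U T -> forall r, exists2 M : R, 0 <= M &
  forall x v s, `|x| <= r -> U v -> 0 <= s <= T -> `|c (x, v, s)| <= M.
Proof.
move=> T0 /compact_norm_le[q q0 hq] lf r.
have [K K0 hK] := lf r.
have [r0|r0] := leP 0 r; last first.
  by exists 0 => // x v s xr; have := le_lt_trans (le_trans (normr_ge0 _) xr) r0; rewrite ltxx.
have [[v0 Uv0]|nU] := pselect (exists v, U v); last first.
  by exists 0 => // x v s _ Uv; exfalso; apply: nU; exists v.
exists (`|c (0, v0, 0)| + K * (r + (q + q) + T)).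
  by rewrite addr_ge0// mulr_ge0// !addr_ge0.
move=> x v s xr Uv sT; have n0 : `|0 : 'rV[R]_n| <= r by rewrite normr0.
have T00 : 0 <= (0 : R) <= T by rewrite lexx.
have := hK x 0 v v0 s 0 xr n0 Uv Uv0 sT T00; rewrite !subr0 => h.
have h1 := ler_normB v v0; have h2 := hq _ Uv; have h3 := hq _ Uv0.
have h4 : K * (`|x| + `|v - v0| + `|s|) <= K * (r + (q + q) + T).
  rewrite ler_wpM2l//; case/andP: sT => s0 sT; rewrite (ger0_norm s0); lra.
have := ler_normD (c (x, v, s) - c (0, v0, 0)) (c (0, v0, 0)); rewrite subrK; lra.
Qed.

End local_lipschitz.

(** * Elapsed time versus absolute time *)

Section shift.
Context {R : realType} {n m : nat}.
Local Notation mu := (@lebesgue_measure R).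
Implicit Types (x : 'rV[R]_n) (u : R -> 'rV[R]_m) (X y : R -> 'rV[R]_n) (s t T : R).

(** The pushforward under the translation agrees with Lebesgue measure on half-open intervals, and
    these determine the measure. *)
Lemma lebesgue_measureD (c : R) (A : set R) : measurable A ->
  mu ((fun s => s + c) @^-1` A) = mu A.
Proof.
move=> mA.
have mf : measurable_fun [set: R] (fun s : R => s + c) by apply: measurable_funD.
have mf' : measurable_fun [set: measurableTypeR R]
  (fun s : measurableTypeR R => (s + c : measurableTypeR R)) by exact: mf.
have mi : forall B : set R, measurable B -> measurable ((fun s => s + c) @^-1` B).
  by move=> B mB; rewrite -[X in measurable X]setTI; exact: mf.
pose nu := pushforward mu (fun s : measurableTypeR R => (s + c : measurableTypeR R)).
pose NU : {measure set (measurableTypeR R) -> \bar R} :=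
  measure_function_pushforward__canonical__measure_function_Measure mu mf'.
have H : forall B : set R, ocitv B -> lebesgue_measure B = NU B; last first.
  by have := lebesgue_measure_unique H mA => /= ->.
move=> _ [[a b]] _ <- /=; rewrite /pushforward.
rewrite (_ : _ @^-1` _ = `]a - c, b - c]%classic); last first.
  by apply/seteqP; split => s /=; rewrite !in_itv/= ltrBlDr lerBrDr.
rewrite !lebesgue_measure_itv/= !lte_fin ltrD2r.
by case: ifPn => // _; rewrite -!EFinB; congr EFin; ring.
Qed.

Lemma ae_shift (c : R) (Q : R -> Prop) :
  {ae mu, forall s, Q s} -> {ae mu, forall s, Q (s + c)}.
Proof.
move=> [N [mN N0 hN]]; exists ((fun s => s + c) @^-1` N); split.
- have mf : measurable_fun [set: R] (fun s : R => s + c) by apply: measurable_funD.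
  by rewrite -[X in measurable X]setTI; exact: mf.
- by rewrite lebesgue_measureD.
- by move=> s hs; exact: hN.
Qed.

Lemma is_derive_shift_rV X s (c : R) (d : 'rV[R]_n) :
  is_derive (s + c) 1 X d -> is_derive s 1 (fun r => X (r + c)) d.
Proof.
move=> /is_derive_rV h; apply/is_derive_rV => i.
have hs : is_derive s 1 (fun r : R => r + c) 1.
  by have := @is_derive_shift R s 1 c.
have := @is_derive1_comp _ (fun r => X r 0 i) (fun r : R => r + c) s _ _ (h i) hs; rewrite mulr1; exact.
Qed.

Lemma ac_shift a b (c : R) X : abs_continuous a b X ->
  abs_continuous (a - c) (b - c) (fun r => X (r + c)).
Proof.
move=> h e e0; have [d d0 hd] := h e e0; exists d => // N l r h1 h2 h3.
apply: (hd _ (fun i => l i + c) (fun i => r i + c)).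
- by move=> i; have [? ? ?] := h1 i; split; [rewrite -lerBlDr|rewrite lerD2r|rewrite -lerBrDr].
- by move=> i j ij; have [?|?] := h2 i j ij; [left|right]; rewrite lerD2r.
- apply: le_lt_trans h3; apply: ler_sum => i _.
  by rewrite le_eqVlt; apply/orP; left; apply/eqP; ring.
Qed.

Variables (f : 'rV[R]_n * 'rV[R]_m -> 'rV[R]_n).

Lemma is_solution_traj t T x u y :
  is_solution f setT (T - t) x (Defs.shift t u) y -> traj f t T x u (fun s => y (s - t)).
Proof.
move=> [h1 _ h2 h3]; split; first by rewrite subrr.
  by have := ac_shift (- t) h2; rewrite opprK add0r subrK.
have := ae_shift (- t) h3; apply: ae_imply1 => s /= h /andP[ts sT].
have := h; rewrite subr_ge0 lerD2r ts sT => /(_ isT).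
by rewrite /Defs.shift addrCA subrr addr0; exact: is_derive_shift_rV.
Qed.

Lemma traj_is_solution t T x u X :
  traj f t T x u X -> is_solution f setT (T - t) x (Defs.shift t u) (fun s => X (s + t)).
Proof.
move=> [h1 h2 h3]; split => //; first by rewrite add0r.
  by have := ac_shift t h2; rewrite subrr.
have := ae_shift t h3; apply: ae_imply1 => s /= h /andP[s0 sT].
have := h; rewrite lerDr s0 -lerBrDr sT => /(_ isT).
by rewrite /Defs.shift (addrC t); exact: is_derive_shift_rV.
Qed.

Variable (U : set 'rV[R]_m).
Hypotheses (flip : box_lip f U) (fbnd : box_bounded f U).

(** [phi] selects some solution; uniqueness identifies it with the given trajectory. *)
Lemma phi_traj t T x u X : input U t T u -> traj f t T x u X ->
  forall s, t <= s <= T -> phi f setT (T - t) x (Defs.shift t u) (s - t) = X s.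
Proof.
move=> [Uu _] tX s sT; rewrite /phi.
have ex : exists y, is_solution f setT (T - t) x (Defs.shift t u) y.
  by exists (fun s => X (s + t)); exact: traj_is_solution.
have /is_solution_traj tY := xgetPex (fun=> x) ex.
exact: (traj_unique flip fbnd Uu tY tX sT).
Qed.

(** The uniqueness clause of [admissible] is supplied by [traj_unique], so exhibiting one trajectory
    is enough. *)
Lemma admissible_traj t T x u : admissible f setT U T x t u <->
  input U t T u /\ exists X, traj f t T x u X.
Proof.
split=> [[h1 [y hy] _]|[h1 [X tX]]].
  by split => //; exists (fun s => y (s - t)); exact: is_solution_traj.
split => //; first by exists (fun s => X (s + t)); exact: traj_is_solution.
move=> y z hy hz s /andP[s0 sT].
have [Uu _] := h1.
have st : t <= s + t <= T by rewrite lerDr s0 -lerBrDr.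
have := traj_unique flip fbnd Uu (is_solution_traj hy) (is_solution_traj hz) st.
by rewrite addrK.
Qed.

Lemma input_sub t T t' T' u : t <= t' -> T' <= T -> input U t T u -> input U t' T' u.
Proof.
move=> tt TT [h1 h2]; split.
  by move=> s /andP[s1 s2]; apply: h1; rewrite (le_trans tt)// (le_trans s2).
move=> j; apply: measurable_funS (h2 j) => // s /=; rewrite !in_itv/= => /andP[s1 s2].
by rewrite (le_trans tt)// (le_trans s2).
Qed.

End shift.

(** * Continuously differentiable functions along curves *)

Section c1_increment.
Context {R : realType} {n : nat}.
Local Notation XT := ('rV[R]_n * R)%type.
Implicit Types (x y : 'rV[R]_n) (s t a b r : R) (X : R -> 'rV[R]_n).
Variable J : XT -> R.
Hypothesis Jd : forall (v z : XT), derivable J z v.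
Hypothesis Jc : forall v : XT, continuous ('D_v J).

Lemma is_derive_line (z e : XT) r :
  is_derive r 1 (fun q => J (z + q *: e)) ('D_e J (z + r *: e)).
Proof.
have E : (fun h : R => h^-1 *: (((fun q => J (z + q *: e)) \o shift r) (h *: 1) - J (z + r *: e))) =
         (fun h : R => h^-1 *: ((J \o shift (z + r *: e)) (h *: e) - J (z + r *: e))).
  apply/funext => h /=; congr (_ *: (J _ - _)).
  by rewrite (_ : h *: (1 : R) = h) ?scalerDl 1?addrCA//; exact: mulr1.
split; first by rewrite /derivable E; exact: Jd.
by rewrite /derive E.
Qed.

(** The mean value theorem for [J] along the line minus the linear function of slope [alpha]. For d
    < 0 the interval is traversed backwards. *)
Lemma line_increment (z e : XT) (d alpha eps : R) :
  (forall r, 0 <= r <= 1 -> `|'D_e J (z + (r * d) *: e) - alpha| <= eps) ->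
  `|J (z + d *: e) - J z - alpha * d| <= eps * `|d|.
Proof.
move=> h; pose phi (q : R) := J (z + q *: e) - alpha * q.
have dphi (q : R) : is_derive q 1 phi ('D_e J (z + q *: e) - alpha).
  apply: is_deriveB; first exact: is_derive_line.
  have := is_deriveZ alpha (is_derive_id q (1 : R)).
  by rewrite /GRing.scale/= mulr1.
have cphi (q : R) : {for q, continuous phi}.
  by apply: differentiable_continuous; apply/derivable1_diffP; case: (dphi q).
have key p q : p <= q -> (forall r, p <= r <= q -> `|'D_e J (z + r *: e) - alpha| <= eps) ->
    `|phi q - phi p| <= eps * `|q - p|.
  move=> pq hr; have [|c cpq ->] := @MVT_segment R phi _ p q pq (fun r _ => dphi r).
    by apply: continuous_subspaceT => r; exact: cphi.
  rewrite normrM ler_wpM2r//; apply: hr; by move: cpq; rewrite in_itv.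
have -> : J (z + d *: e) - J z - alpha * d = phi d - phi 0.
  by rewrite /phi scale0r addr0 mulr0 subr0; ring.
have [d0|d0] := leP 0 d.
  rewrite -[X in eps * `|X|]subr0; apply: key => // r /andP[r0 rd].
  have [d00|d1] := eqVneq d 0.
    by have -> : r = 0 * d; [apply/eqP; rewrite mul0r eq_le r0 -d00 rd|apply: h; rewrite lexx ler01].
  have dp : 0 < d by rewrite lt_neqAle eq_sym d1.
  have -> : r = (r / d) * d by rewrite divfK.
  by apply: h; rewrite divr_ge0 //= ler_pdivrMr// mul1r.
rewrite distrC -(normrN d) -(sub0r d); apply: key => [|r /andP[rd r0]]; first exact: ltW.
have -> : r = (r / d) * d by rewrite divfK// lt_eqF.
apply: h; apply/andP; split; last by rewrite ler_ndivrMr// mul1r.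
by rewrite -mulrNN -invrN divr_ge0// oppr_ge0// ltW.
Qed.

Definition in_box (c : XT) (rho : R) (z : XT) :=
  (forall i, `|z.1 0 i - c.1 0 i| <= rho) /\ `|z.2 - c.2| <= rho.

Lemma seg_box (a b c rho r : R) : `|a - c| <= rho -> `|b - c| <= rho -> 0 <= r <= 1 ->
  `|a + r * (b - a) - c| <= rho.
Proof.
move=> h1 h2 /andP[r0 r1].
have -> : a + r * (b - a) - c = (1 - r) * (a - c) + r * (b - c) by ring.
apply: le_trans (ler_normD _ _) _; rewrite !normrM (ger0_norm r0) ger0_norm ?subr_ge0//.
have := ler_wpM2l r0 h2; have : (1 - r) * `|a - c| <= (1 - r) * rho.
  by rewrite ler_wpM2l// subr_ge0.
lra.
Qed.

(** [Ck] provides directional derivatives and no total differential, so the way from (x, s) to (y,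
    t) changes one coordinate at a time, time last. The way stays in the box because a box is a
    product. *)
Lemma c1_increment (c : XT) (rho eps : R) (al : 'I_n -> R) (at_ : R) x y s t :
  (forall z, in_box c rho z -> (forall i, `|'D_(dx i) J z - al i| <= eps) /\
     `|'D_dt J z - at_| <= eps) ->
  in_box c rho (x, s) -> in_box c rho (y, t) ->
  `|J (y, t) - J (x, s) - (\sum_(i < n) al i * (y 0 i - x 0 i) + at_ * (t - s))|
    <= eps * (\sum_(i < n) `|y 0 i - x 0 i| + `|t - s|).
Proof.
move=> hD [/= hx hs] [/= hy ht].
pose w k : 'rV[R]_n := \row_i (if (i < k)%N then y 0 i else x 0 i).
have hw k i : `|w k 0 i - c.1 0 i| <= rho by rewrite mxE; case: ifP.
have main k : (k <= n)%N ->
  `|J (w k, s) - J (x, s) - \sum_(i < n | (i < k)%N) al i * (y 0 i - x 0 i)|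
    <= eps * \sum_(i < n | (i < k)%N) `|y 0 i - x 0 i|.
  elim: k => [_|k IH kn].
    rewrite !big_pred0// mulr0 subr0 (_ : w 0%N = x) ?subrr ?normr0//.
    by apply/rowP => i; rewrite mxE.
  have {}IH := IH (ltnW kn).
  pose j := Ordinal kn.
  have E (G : 'I_n -> R) : \sum_(i < n | (i < k.+1)%N) G i = G j + \sum_(i < n | (i < k)%N) G i.
    rewrite (bigD1 j)//=; congr (_ + _); apply: eq_bigl => i.
    by rewrite ltnS -(inj_eq val_inj)/= ltn_neqAle andbC.
  rewrite !E.
  have step : (w k.+1, s) = (w k, s) + (y 0 j - x 0 j) *: dx j.
    congr pair => /=; last by rewrite scaler0 addr0.
    apply/rowP => i; rewrite !mxE/= ltnS leq_eqVlt.
    have [ik|ik] := eqVneq i j.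
      by rewrite ik /= eqxx ltnn/= mulr1 addrC subrK.
    rewrite (_ : (i == k :> nat) = false)/= ?mulr0 ?addr0//.
    by apply/negbTE; apply: contra ik => /eqP ik; apply/eqP/val_inj.
  have := @line_increment (w k, s) (dx j) (y 0 j - x 0 j) (al j) eps.
  rewrite -step => H.
  have {}H : `|J (w k.+1, s) - J (w k, s) - al j * (y 0 j - x 0 j)| <= eps * `|y 0 j - x 0 j|.
    apply: H => r r01; apply: (hD _ _).1.
    split => [i|/=]; last by rewrite scaler0 addr0.
    rewrite !mxE/=; have [ik|ik] := eqVneq i j.
      rewrite ik ltnn/= mulr1; exact: seg_box.
    rewrite mulr0 addr0; by case: ifP.
  rewrite [leRHS]mulrDr; apply: le_trans (lerD H IH).
  apply: le_trans (ler_normD _ _).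
  by rewrite le_eqVlt; apply/orP; left; apply/eqP; congr `|_|; ring.
have wn : w n = y by apply/rowP => i; rewrite mxE ltn_ord.
have := main n (leqnn _); rewrite wn.
have E (G : 'I_n -> R) : \sum_(i < n | (i < n)%N) G i = \sum_(i < n) G i.
  by apply: eq_bigl => i; rewrite ltn_ord.
rewrite !E => H1.
have step : (y, t) = (y, s) + (t - s) *: dt.
  congr pair => /=; first by rewrite scaler0 addr0.
  by rewrite /GRing.scale/= mulr1 addrC subrK.
have := @line_increment (y, s) dt (t - s) at_ eps; rewrite -step => H2.
have {}H2 : `|J (y, t) - J (y, s) - at_ * (t - s)| <= eps * `|t - s|.
  apply: H2 => r r01; apply: (hD _ _).2; split => [i|/=].
    by rewrite /= scaler0 addr0.
  by rewrite /GRing.scale/= mulr1; exact: seg_box.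
rewrite [leRHS]mulrDr; apply: le_trans (lerD H1 H2); apply: le_trans (ler_normD _ _).
by rewrite le_eqVlt; apply/orP; left; apply/eqP; congr `|_|; ring.
Qed.

Lemma in_box_norm c rho z : 0 <= rho -> in_box c rho z -> `|c - z| <= rho.
Proof.
move=> r0 [h1 h2]; rewrite prod_normE ge_max; apply/andP; split => /=; last by rewrite distrC.
by rewrite distrC; apply: rV_norm_le => // i; rewrite !mxE.
Qed.

Lemma c1_near (c : XT) (eps : R) : 0 < eps -> exists2 rho : R, 0 < rho & forall z,
  in_box c rho z -> (forall i, `|'D_(dx i) J z - 'D_(dx i) J c| <= eps) /\
     `|'D_dt J z - 'D_dt J c| <= eps.
Proof.
move=> e0.
have h1 : \forall z \near c, forall i, `|'D_(dx i) J z - 'D_(dx i) J c| <= eps.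
  apply: (@filter_forall _ _ (fun (i : 'I_n) (z : XT) => `|'D_(dx i) J z - 'D_(dx i) J c| <= eps)
    (nbhs c) (nbhs_filter c)) => i.
  have /cvgrPdist_le/(_ _ e0) := @Jc (dx i) c.
  by apply: filterS => z; rewrite distrC.
have h2 : \forall z \near c, `|'D_dt J z - 'D_dt J c| <= eps.
  have /cvgrPdist_le/(_ _ e0) := @Jc dt c.
  by apply: filterS => z; rewrite distrC.
have h3 : nbhs c (fun z => (forall i, `|'D_(dx i) J z - 'D_(dx i) J c| <= eps) /\
   `|'D_dt J z - 'D_dt J c| <= eps) by apply: filterS2 h1 h2.
move/nbhs_ballP : h3 => [d /= d0]; rewrite -ball_normE => hd.
exists (d / 2); first by rewrite divr_gt0.
move=> z hz; apply: hd => /=.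
apply: le_lt_trans (in_box_norm _ hz) _; first by rewrite divr_ge0// ltW.
by rewrite ltr_pdivrMr// ltr_pMr// ltr1n.
Qed.

Lemma continuous_bounded_box (g : XT -> R) (r : R) : continuous g ->
  exists2 M, 0 <= M & forall z, in_box 0 r z -> `|g z| <= M.
Proof.
move=> cg.
pose K : set XT := [set x : 'rV[R]_n | forall i, `[- r, r]%classic (x ord0 i)] `*` `[- r, r].
have cK : compact K.
  apply: compact_setX; last exact: segment_compact.
  apply: (@rV_compact _ _ (fun=> `[- r, r]%classic)) => _; exact: segment_compact.
have := @continuous_compact _ _ g K.
have cgK : {within K, continuous g} by exact: continuous_subspaceT.
move=> /(_ cgK cK) /compact_bounded[M [_ hM]].
exists (`|M| + 1); first exact: addr_ge0.
move=> z [h1 h2]; apply: (hM (`|M| + 1)); first by apply: le_lt_trans (ler_norm M) _; rewrite ltrDl.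
exists z => //; split => [i|] /=; rewrite in_itv/= -ler_norml.
  by have := h1 i; rewrite mxE subr0.
by move: h2; rewrite subr0.
Qed.

Lemma c1_bounded (r : R) : exists2 M, 0 <= M & forall z, in_box 0 r z ->
  (forall i, `|'D_(dx i) J z| <= M) /\ `|'D_dt J z| <= M.
Proof.
pose Mi i := sval (cid2 (continuous_bounded_box r (@Jc (dx i)))).
have [Mt Mt0 hMt] := continuous_bounded_box r (@Jc dt).
have Mi0 i : 0 <= Mi i by rewrite /Mi; case: cid2.
exists (Mt + \sum_i Mi i); first by rewrite addr_ge0// sumr_ge0.
move=> z hz; split; last by apply: le_trans (hMt _ hz) _; rewrite lerDl sumr_ge0.
move=> i; apply: (@le_trans _ _ (Mi i)); first by rewrite /Mi; case: cid2 => /= ? _; exact.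
rewrite (bigD1 i)//= addrCA lerDl addr_ge0//; apply: sumr_ge0 => j _; exact: Mi0.
Qed.

Lemma curve_lip M a b X : 0 <= M -> lip_rV M a b X -> lip_on a b (fun s => J (X s, s)).
Proof.
move=> M0 lX.
have [r r0 hr] := ac_bounded (lip_rV_ac M0 lX).
pose q := r + `|a| + `|b|.
have [D D0 hD] := c1_bounded q.
exists (D * (n%:R * M + 1)); first by rewrite mulr_ge0// addr_ge0// mulr_ge0.
have inb s : a <= s -> s <= b -> in_box 0 q (X s, s).
  move=> as_ sb; split => [i|] /=.
    rewrite mxE subr0; apply: le_trans (rV_norm_coord _ _) _.
    have := hr s; rewrite as_ sb => /(_ isT) h.
    by rewrite /q -addrA; apply: le_trans h _; rewrite lerDl addr_ge0.
  rewrite subr0 /q ler_norml; apply/andP; split.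
    have := ler_norm (- a); rewrite normrN; have := normr_ge0 b; lra.
  have := ler_norm b; have := normr_ge0 a; lra.
move=> s t as_ st tb.
have sb := le_trans st tb; have at_ := le_trans as_ st.
(* With zero linear part, the tolerance [D] is just a bound on the derivatives. *)
have := @c1_increment 0 q D (fun=> 0) 0 (X s) (X t) s t _ (inb s as_ sb) (inb t at_ tb).
rewrite big1 => [|i _]; last by rewrite mul0r.
rewrite mul0r addr0 subr0 => H.
apply: le_trans (H _) _ => [z hz|].
  by have [h1 h2] := hD z hz; split => [i|]; rewrite subr0.
rewrite -mulrA ler_wpM2l// mulrDl mul1r ger0_norm ?subr_ge0// lerD2r.
apply: (@le_trans _ _ (\sum_(i < n) M * (t - s))).
  apply: ler_sum => i _; apply: le_trans (rV_norm_coordB _ _ _) _; exact: lX.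
by rewrite sumr_const card_ord -mulrA mulr_natl.
Qed.

(** The chain rule in slope form. J along X is its linearization at (X s, s), which is
    differentiable at [s], minus an error whose increments are o(r - s), because [X] is Lipschitz
    and the derivatives of [J] are continuous. *)
Lemma curve_slope M a b X s (d : 'rV[R]_n) (kappa : R) : 0 <= M -> lip_rV M a b X ->
  a <= s <= b -> is_derive s 1 X d ->
  slope_le (kappa * ('D_dt J (X s, s) + \sum_(i < n) 'D_(dx i) J (X s, s) * d 0 i)) a b
    (fun r => kappa * J (X r, r)) s.
Proof.
move=> M0 lX sab dX.
set Dt := 'D_dt J (X s, s); pose Di i := 'D_(dx i) J (X s, s).
pose lin (r : R) := Dt * r + \sum_(i < n) Di i * X r 0 i.
have dlin : is_derive s 1 lin (Dt + \sum_(i < n) Di i * d 0 i).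
  apply: is_deriveD.
    have := is_deriveZ Dt (is_derive_id s (1 : R)).
    by rewrite /GRing.scale/= mulr1.
  rewrite (_ : (fun r : R => _) = \sum_(i < n) (fun r => Di i * X r 0 i)); last first.
    by apply/funext => r; rewrite fct_sumE.
  apply: is_derive_sum => i.
  by move/is_derive_rV : dX => /(_ i) h; exact: (is_deriveZ (Di i) h).
have dlin' : is_derive s 1 (fun r => kappa * lin r) (kappa * (Dt + \sum_(i < n) Di i * d 0 i)).
  exact: (is_deriveZ kappa dlin).
pose err (r : R) := kappa * (lin r - J (X r, r)).
rewrite (_ : (fun r => kappa * J (X r, r)) = (fun r => kappa * lin r - err r)); last first.
  by apply/funext => r; rewrite /err; ring.
rewrite -[X in slope_le X]addr0; apply: slope_leB; first exact: is_derive_slope dlin' (lexx _).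
move=> e e0; rewrite add0r.
(* The increment of [err] carries the factor [|kappa| * (n%:R * M + 1)]; dividing [e] by [C] absorbs
   it, and the last 1 keeps [C] positive. *)
pose C := `|kappa| * (n%:R * M + 1) + 1.
have C0 : 0 < C by rewrite ltr_wpDl// mulr_ge0// addr_ge0// mulr_ge0.
have eC0 : 0 < e / C by rewrite divr_gt0.
have [rho rho0 hrho] := c1_near (X s, s) eC0.
have inb0 : in_box (X s, s) rho (X s, s).
  by split => [i|] /=; rewrite subrr normr0 ltW.
have lX' r : a <= r <= b -> `|X r - X s| <= M * `|r - s|.
  move=> /andP[ar rb]; case/andP: sab => as_ sb.
  have [sr|/ltW rs] := leP s r.
    by rewrite (ger0_norm (_ : 0 <= r - s)) ?subr_ge0//; exact: lX.
  by rewrite distrC (distrC r) (ger0_norm (_ : 0 <= s - r)) ?subr_ge0//; exact: lX.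
have Herr r : a <= r <= b -> `|r - s| <= rho / (M + 1) -> `|err r - err s| <= e * `|r - s|.
  move=> rab rrho.
  have M1 : 0 < M + 1 by rewrite ltr_wpDl.
  have rs2 : (M + 1) * `|r - s| <= rho by rewrite mulrC -ler_pdivlMr.
  have rs3 := normr_ge0 (r - s).
  have rs4 : 0 <= M * `|r - s| by rewrite mulr_ge0.
  rewrite mulrDl mul1r in rs2.
  have inb : in_box (X s, s) rho (X r, r).
    split => [i|] /=; last lra.
    apply: le_trans (rV_norm_coordB _ _ _) _; apply: le_trans (lX' _ rab) _; lra.
  have := c1_increment hrho inb0 inb.
  set S := \sum_(i < n) _; set S' := \sum_(i < n) _ => H.
  have -> : err r - err s = - kappa * (J (X r, r) - J (X s, s) - (S + Dt * (r - s))).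
    rewrite /err /lin.
    have -> : S = \sum_(i < n) Di i * X r 0 i - \sum_(i < n) Di i * X s 0 i.
      by rewrite -sumrB; apply: eq_bigr => i _; rewrite mulrBr.
    ring.
  rewrite normrM normrN.
  have hS' : S' <= n%:R * M * `|r - s|.
    apply: (@le_trans _ _ (\sum_(i < n) M * `|r - s|)).
      apply: ler_sum => i _; apply: le_trans (rV_norm_coordB _ _ _) _; exact: lX'.
    by rewrite sumr_const card_ord -mulrA mulr_natl.
  apply: (@le_trans _ _ (`|kappa| * (e / C * ((n%:R * M + 1) * `|r - s|)))).
    rewrite ler_wpM2l//; apply: le_trans H _; rewrite ler_wpM2l ?(ltW eC0)//.
    by rewrite mulrDl mul1r lerD2r.
  have -> : `|kappa| * (e / C * ((n%:R * M + 1) * `|r - s|)) =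
     e * `|r - s| * ((`|kappa| * (n%:R * M + 1)) / C) by ring.
  rewrite ler_piMr//; first by rewrite mulr_ge0// ltW.
  by rewrite ler_pdivrMr// mul1r /C lerDl.
have nr : \forall r \near s, `|r - s| <= rho / (M + 1).
  have : 0 < rho / (M + 1) by rewrite divr_gt0// ltr_wpDl.
  move=> p; apply/nbhs_ballP; exists (rho / (M + 1)) => //= r.
  by rewrite /ball/= distrC => /ltW.
apply: filterS nr => r hr rab.
have := Herr r rab hr; rewrite ler_norml => /andP[h1 h2].
split => sr.
  by move: h1 h2; rewrite ger0_norm ?subr_ge0//; lra.
by move: h1 h2; rewrite ler0_norm ?subr_le0//; lra.
Qed.

(** Running integral plus J along X is absolutely continuous, and the chain rule bounds its slope by
    [kappa] almost everywhere, which suffices for [ac_slope_le]. *)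
Lemma curve_growth_le M a b X (G : R -> 'rV[R]_n) (h : R -> R) (N kappa : R) :
  a <= b -> 0 <= M -> lip_rV M a b X ->
  {ae lebesgue_measure, forall s, a <= s <= b -> is_derive s 1 X (G s)} ->
  0 <= N -> measurable_fun `[a, b] h -> (forall s, a <= s <= b -> `|h s| <= N) ->
  {ae lebesgue_measure, forall s, a <= s <= b ->
    h s + 'D_dt J (X s, s) + \sum_(i < n) 'D_(dx i) J (X s, s) * G s 0 i <= kappa} ->
  prim a h b + J (X b, b) - J (X a, a) <= kappa * (b - a).
Proof.
move=> ab M0 lX dX N0 mh hN hk.
pose g (s : R) := 1 * J (X s, s) - - prim a h s.
have lg : lip_on a b (fun s => prim a h s).
  by exists N => // s t as_ st tb; exact: (prim_lip mh hN).
have acg : abs_continuous a b g.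
  apply: acB; last by apply: acN; exact: lip_ac.
  have := lip_ac (curve_lip M0 lX).
  by under [X in abs_continuous _ _ X -> _]eq_fun do rewrite -[J _]mul1r.
have := @ac_slope_le _ a b kappa g ab acg.
rewrite /g prim_point !mul1r !opprK addr0 [_ + prim _ _ _]addrC; apply.
have dp : {ae lebesgue_measure, forall s, a <= s <= b ->
    is_derive s 1 X (G s) /\ is_derive s 1 (prim a h) (h s)}.
  by apply: ae_imply2 dX (prim_derive mh hN) => s h1 h2 sab; split; [exact: h1|exact: h2].
apply: ae_imply2 hk dp => s {}hk h12 sab; have [h1 h2] := h12 sab.
have H1 := @curve_slope M a b X s (G s) 1 M0 lX sab h1.
have H2 : slope_le (h s) a b (fun r => - - prim a h r) s.
  under [X in slope_le _ _ _ X]eq_fun do rewrite opprK.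
  exact: is_derive_slope h2 (lexx _).
have H := slope_leB H1 H2 => e e0.
have := H e e0; apply: filterS => r + rab => /(_ rab)[h3 h4].
have := hk sab; set u := \sum_(i < n) _ => hk'.
split => sr.
  apply: le_trans (h3 sr) _; rewrite ler_wpM2r ?subr_ge0// lerD2r; rewrite -/u; lra.
apply: le_trans (h4 sr) _; rewrite ler_wpM2r ?subr_ge0// lerD2r; rewrite -/u; lra.
Qed.

End c1_increment.

(** * Smooth kernels *)

Section Ck_closure.
Context {R : realType}.
Implicit Types V : normedModType R.

Lemma Ck_continuous V k (F : V -> R) : Ck k F -> continuous F.
Proof. by case: k => [//|k] []. Qed.

Lemma CkW V k (F : V -> R) : Ck k.+1 F -> Ck k F.
Proof.
elim: k F => [|k IH] F; first by case.
by move=> [cF h]; split => // v; have [dF ckF] := h v; split => //; exact: IH.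
Qed.

Lemma Ck_cst V k (c : R) : Ck k (fun _ : V => c).
Proof.
elim: k c => [|k IH] c /=; first by move=> x; exact: cvg_cst.
split; first by move=> x; exact: cvg_cst.
move=> v; split => [x|]; first exact: derivable_cst.
rewrite (_ : 'D_v _ = fun _ : V => 0); first exact: IH.
by apply/funext => x; rewrite derive_cst.
Qed.

Lemma CkD V k (F G : V -> R) : Ck k F -> Ck k G -> Ck k (fun x => F x + G x).
Proof.
elim: k F G => [|k IH] F G /=.
  by move=> cF cG x; apply: cvgD; [exact: cF|exact: cG].
move=> [cF hF] [cG hG]; split; first by move=> x; apply: cvgD; [exact: cF|exact: cG].
move=> v; have [dF ckF] := hF v; have [dG ckG] := hG v; split.
  by move=> x; apply: derivableD.
rewrite (_ : 'D_v _ = fun x => 'D_v F x + 'D_v G x); first exact: IH.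
by apply/funext => x; rewrite deriveD.
Qed.

Lemma CkM V k (F G : V -> R) : Ck k F -> Ck k G -> Ck k (fun x => F x * G x).
Proof.
elim: k F G => [|k IH] F G.
  by move=> cF cG x; apply: cvgM; [exact: cF|exact: cG].
move=> ckF ckG; have [cF hF] := ckF; have [cG hG] := ckG.
split; first by move=> x; apply: cvgM; [exact: cF|exact: cG].
move=> v; have [dF ckDF] := hF v; have [dG ckDG] := hG v; split.
  by move=> x; apply: derivableM.
rewrite (_ : 'D_v _ = fun x => F x * 'D_v G x + G x * 'D_v F x).
  by apply: CkD; apply: IH => //; exact: CkW.
by apply/funext => x; rewrite deriveM.
Qed.

Lemma CkV V k (F : V -> R) : (forall x, F x != 0) -> Ck k F -> Ck k (fun x => (F x)^-1).
Proof.
move=> F0; elim: k => [|k IH].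
  by move=> cF x; apply: cvgV => //; exact: cF.
move=> ckF; have [cF hF] := ckF; have ckV := IH (CkW ckF).
split; first by move=> x; apply: cvgV => //; exact: cF.
move=> v; have [dF ckDF] := hF v; split.
  by move=> x; apply: derivableV.
rewrite (_ : 'D_v _ = fun x => -1 * (((F x)^-1 * (F x)^-1) * 'D_v F x)).
  by apply: CkM; [exact: Ck_cst|apply: CkM => //; exact: CkM].
apply/funext => x; rewrite deriveV// mulN1r scaleNr; congr (- _).
by rewrite /GRing.scale/= -expr2 exprVn.
Qed.

(** With [l'] the linear part of [l], the difference quotient of the composite along v is exactly
    that of [phi] along [l' v]. The derivative is again a composite with [l], and the induction
    needs no chain rule. *)
Lemma Ck_comp_affine V k (phi : R -> R) (l l' : V -> R) : continuous l ->
  (forall (h : R) v x, l (h *: v + x) = h * l' v + l x) ->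
  Ck k phi -> Ck k (fun x => phi (l x)).
Proof.
move=> cl hl; elim: k phi => [|k IH] phi.
  by move=> cphi x; apply: continuous_comp; [exact: cl|exact: cphi].
move=> [cphi h]; split.
  by move=> x; apply: continuous_comp; [exact: cl|exact: cphi].
move=> v; have [dphi ckD] := h (l' v).
have E x : (fun h : R => h^-1 *: (((fun x => phi (l x)) \o shift x) (h *: v) - phi (l x))) =
  (fun h : R => h^-1 *: ((phi \o shift (l x)) (h *: l' v) - phi (l x))).
  by apply/funext => r /=; rewrite hl.
split.
  by move=> x; rewrite /derivable E; exact: dphi.
rewrite (_ : 'D_v _ = fun x => 'D_(l' v) phi (l x)); first exact: (IH ('D_(l' v) phi)).
by apply/funext => x; rewrite /derive E.
Qed.

Lemma Ck_prod V (I : Type) (r : seq I) (F : I -> V -> R) k :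
  (forall i, Ck k (F i)) -> Ck k (fun x => \prod_(i <- r) F i x).
Proof.
move=> h; elim: r => [|i r IH].
  rewrite (_ : (fun x => _) = fun=> 1); first exact: Ck_cst.
  by apply/funext => x; rewrite big_nil.
rewrite (_ : (fun x => _) = fun x => F i x * \prod_(i <- r) F i x).
  exact: CkM.
by apply/funext => x; rewrite big_cons.
Qed.

End Ck_closure.

(** * A smooth step function and its derivative *)

Section smooth_step.
Context {R : realType}.
Implicit Types (p : {poly R}) (x y h : R).

(* The functions p(1/x) exp(-1/x), extended by 0, are closed under differentiation. *)
Definition flat p x : R := if 0 < x then p.[x^-1] * expR (- x^-1) else 0.

(** With y = 1/x one has dy/dx = - y^2, so p(y) exp(- y) has derivative y^2 (p(y) - p'(y)) exp(-
    y). *)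
Definition flat_deriv p : {poly R} := 'X^2 * (p - p^`()).

Lemma horner_bound p : exists2 C : R, 0 <= C &
  forall y, 1 <= y -> `|p.[y]| <= C * y ^+ (size p).
Proof.
exists (\sum_(i < size p) `|p`_i|); first exact: sumr_ge0.
move=> y y1; have y0 : 0 <= y by exact: le_trans y1.
rewrite horner_coef; apply: le_trans (ler_norm_sum _ _ _) _.
rewrite mulr_suml; apply: ler_sum => i _; rewrite normrM ler_wpM2l//.
by rewrite ger0_norm ?exprn_ge0// ler_weXn2l// ltnW.
Qed.

(** For y = 1/x and N the size of [p], the value p(y) is O(y^N), while exp y dominates y^(N+1) /
    (N+1)!. The spare power of y is the factor [|x|]. *)
Lemma flat_bound p : exists2 C : R, 0 <= C & forall x, `|x| <= 1 -> `|flat p x| <= C * `|x|.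
Proof.
have [C C0 hC] := horner_bound p.
pose N := size p.
exists (C * N.+1`!%:R); first by rewrite mulr_ge0.
move=> x x1; rewrite /flat; case: ifPn => [x0|_]; last first.
  by rewrite normr0 !mulr_ge0.
rewrite (gtr0_norm x0); rewrite (gtr0_norm x0) in x1.
pose y := x^-1; have y1 : 1 <= y by rewrite /y invf_ge1.
have y0 : 0 < y by exact: lt_le_trans y1.
have e0 : y ^+ N.+1 / N.+1`!%:R <= expR y.
  by apply: le_trans (expR_ge1Dxn N (ltW y0)); rewrite lerDr.
have f0 : 0 < N.+1`!%:R :> R by rewrite ltr0n fact_gt0.
rewrite normrM (gtr0_norm (expR_gt0 _)) -/y expRN.
rewrite ler_pdivrMr ?expR_gt0//; apply: le_trans (hC _ y1) _; rewrite -/N -!mulrA ler_wpM2l//.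
have -> : y ^+ N = x * y ^+ N.+1.
  by rewrite exprS mulrA /y divff ?mul1r// gt_eqF.
rewrite mulrCA ler_wpM2l ?(ltW x0)// mulrC -ler_pdivrMr//.
Qed.

Lemma flat_is_derive p x : is_derive x 1 (flat p) (flat (flat_deriv p) x).
Proof.
have [x0|x0|->] := ltgtP x 0.
- have nx : \near x, flat 0 x = flat p x.
    near=> y; have y0 : y < 0 by near: y; exact: lt_nbhsl.
    by rewrite /flat ltNge (ltW y0).
  rewrite [flat (flat_deriv p) x]/flat ltNge (ltW x0)/=.
  apply: (near_eq_is_derive nx).
  rewrite (_ : flat 0 = cst 0); first exact: is_derive_cst.
  by apply/funext => y; rewrite /flat horner0 mul0r if_same.
- have nx : \near x, (fun y => p.[y^-1] * expR (- y^-1)) x = flat p x.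
    near=> y; have y0 : 0 < y by near: y; exact: lt_nbhsr.
    by rewrite /flat y0.
  apply: (near_eq_is_derive nx).
  have xn0 : x != 0 by rewrite gt_eqF.
  have dV : is_derive x 1 (fun y : R => y^-1) (- x ^- 2).
    have := @is_deriveV R id x 1 1 xn0 (is_derive_id x 1).
    by rewrite /GRing.scale/= mulr1.
  have dpoly : is_derive x^-1 1 (horner p) (p^`().[x^-1]).
    split; first exact: derivable_horner.
    by rewrite -derive1E -derivE.
  have dp : is_derive x 1 (fun y => p.[y^-1]) (p^`().[x^-1] * - x ^- 2).
    exact: (@is_derive1_comp _ (horner p) (fun y => y^-1) x _ _ dpoly dV).
  have dN : is_derive x 1 (fun y : R => - y^-1) (x ^- 2).
    by have := is_deriveN dV; rewrite opprK.
  have de : is_derive x 1 (fun y => expR (- y^-1)) (expR (- x^-1) * x ^- 2).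
    exact: (@is_derive1_comp _ expR (fun y => - y^-1) x _ _ (is_derive_expR _) dN).
  have := is_deriveM dp de.
  rewrite /flat x0 /flat_deriv !hornerE/= /GRing.scale/= => H.
  apply: is_derive_eq H _; rewrite exprVn; ring.
- rewrite [flat _ 0]/flat ltxx.
  have H : (fun h => h^-1 *: ((flat p \o shift 0) (h *: (1 : R)) - flat p 0)) @ 0^' --> (0 : R).
    (* At 0, dividing by h is multiplying by 1/h: the difference quotient of [flat p] is
       [flat ('X * p)], which tends to 0. *)
    have [C C0 hC] := flat_bound ('X * p).
    apply/cvgrPdist_lt => e e0; rewrite near_withinE.
    have C1 : 0 < C + 1 by rewrite ltr_wpDl.
    have d0 : 0 < Num.min 1 (e / (C + 1)) by rewrite lt_min ltr01 divr_gt0.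
    apply/nbhs_ballP; exists (Num.min 1 (e / (C + 1))) => //= h.
    rewrite /ball/= sub0r normrN lt_min => /andP[h1 h2] hn0.
    rewrite sub0r normrN addr0 [h *: _]mulr1 [flat p 0]/flat ltxx subr0.
    have -> : h^-1 *: flat p h = flat ('X * p) h.
      rewrite /flat; case: ifP => _; last by rewrite scaler0.
      by rewrite hornerM hornerX /GRing.scale/= mulrA.
    apply: le_lt_trans (hC _ (ltW h1)) _.
    apply: (@le_lt_trans _ _ ((C + 1) * `|h|)); first by rewrite ler_wpM2r// lerDl.
    by rewrite mulrC -ltr_pdivlMr.
  split; first by apply/cvg_ex; exists 0.
  exact/cvg_lim.
Unshelve. all: by end_near. Qed.

Lemma flat_derive p x v : derivable (flat p) x v /\ 'D_v (flat p) x = v * flat (flat_deriv p) x.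
Proof.
have [d D] := flat_is_derive p x.
have df : differentiable (flat p) x by apply/derivable1_diffP.
split; first exact: diff_derivable.
rewrite deriveE// diff1E// derive1E D /=.
by [].
Qed.

Lemma flat_Ck k p : Ck k (flat p).
Proof.
have cf q : continuous (flat q).
  move=> x; apply: differentiable_continuous; apply/derivable1_diffP.
  by case: (flat_is_derive q x).
elim: k p => [|k IH] p; first exact: cf.
split => // v; split => [x|]; first by case: (flat_derive p x v).
rewrite (_ : 'D_v _ = fun x => v * flat (flat_deriv p) x).
  by apply: CkM; [exact: Ck_cst|exact: IH].
by apply/funext => x; case: (flat_derive p x v).
Qed.

Let E := flat 1.

Let E_ge0 x : 0 <= E x.
Proof. by rewrite /E /flat; case: ifP => // _; rewrite hornerC mul1r expR_ge0. Qed.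

Let E_gt0 x : 0 < x -> 0 < E x.
Proof. by move=> x0; rewrite /E /flat x0 hornerC mul1r expR_gt0. Qed.

Let E_le0 x : x <= 0 -> E x = 0.
Proof. by move=> x0; rewrite /E /flat ltNge x0. Qed.

Let E_mono x y : x <= y -> E x <= E y.
Proof.
move=> xy; have [x0|x0] := leP x 0; first by rewrite (E_le0 x0).
have y0 := lt_le_trans x0 xy.
rewrite /E /flat x0 y0 !hornerC !mul1r ler_expR lerN2 lef_pV2//.
Qed.

Let den x := E x + E (1 - x).

Let den_gt0 x : 0 < den x.
Proof.
rewrite /den; have [x0|x0] := leP x 0.
  by rewrite E_le0// add0r E_gt0//; lra.
by rewrite ltr_pwDl// E_gt0.
Qed.

(** The standard smooth transition from 0 to 1 over [0, 1]. Taking the kernel [bump] as its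
    derivative gives total mass 1 and an explicit primitive, from which [avg_shift] builds its test
    function. *)
Definition step x : R := E x * (den x)^-1.
Definition bump x : R := 'D_1 step x.

Lemma step_Ck k : Ck k step.
Proof.
apply: CkM; first exact: flat_Ck.
apply: CkV; first by move=> x; rewrite gt_eqF.
apply: CkD; first exact: flat_Ck.
apply: (@Ck_comp_affine _ _ _ E (fun x : R => 1 - x) (fun v : R => - v)).
- by move=> x; apply: cvgB; [exact: cvg_cst|exact: cvg_id].
- by move=> h v x; rewrite /GRing.scale/=; ring.
- exact: flat_Ck.
Qed.

Lemma bump_Ck k : Ck k bump.
Proof. by have [_ /(_ 1)[]] := step_Ck k.+1. Qed.

Lemma step_is_derive x : is_derive x 1 step (bump x).
Proof. by have [_ /(_ 1)[d _]] := step_Ck 1; split. Qed.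

Lemma step_le0 x : x <= 0 -> step x = 0.
Proof. by move=> x0; rewrite /step E_le0// mul0r. Qed.

Lemma step_ge1 x : 1 <= x -> step x = 1.
Proof.
move=> x1; rewrite /step /den (@E_le0 (1 - x)) ?addr0 ?divff//; last lra.
by rewrite gt_eqF// E_gt0//; lra.
Qed.

Lemma step_mono x y : x <= y -> step x <= step y.
Proof.
move=> xy; rewrite /step ler_pdivrMr// mulrAC ler_pdivlMr// /den !mulrDr.
rewrite [E x * E y]mulrC lerD2l; apply: ler_pM => //; apply: E_mono => //; lra.
Qed.

Lemma step_ge0 x : 0 <= step x.
Proof. by rewrite /step mulr_ge0// invr_ge0 ltW. Qed.

Lemma step_le1 x : step x <= 1.
Proof. by rewrite /step ler_pdivrMr// mul1r lerDl. Qed.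

Lemma bump_ge0 x : 0 <= bump x.
Proof.
have [d _] := step_is_derive x.
apply: limr_ge; first exact: d.
rewrite near_withinE; near=> h => hn0 /=.
rewrite [h *: _]mulr1 /GRing.scale/=.
have [h0|h0] := leP 0 h.
  by rewrite mulr_ge0 ?invr_ge0// subr_ge0 step_mono// lerDr.
apply: mulr_le0; first by rewrite invr_le0 ltW.
by rewrite subr_le0 step_mono// gerDr ltW.
Unshelve. all: by end_near. Qed.

Lemma bump_out x : x < 0 \/ 1 < x -> bump x = 0.
Proof.
move=> hx; suff [c nc] : exists c, \near x, cst c x = step x.
  by rewrite /bump -(near_eq_derive _ nc) derive_cst.
case: hx => hx.
  exists 0; near=> y; rewrite step_le0//; apply: ltW; near: y; exact: lt_nbhsl.
exists 1; near=> y; rewrite step_ge1//; apply: ltW; near: y; exact: lt_nbhsr.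
Unshelve. all: by end_near. Qed.

End smooth_step.

(** * Integrals of products over product measures *)

Section product_integral.
Context {R : realType}.

Lemma integral_prodM d1 d2 (T1 : measurableType d1) (T2 : measurableType d2)
    (m1 : {sigma_finite_measure set T1 -> \bar R})
    (m2 : {sigma_finite_measure set T2 -> \bar R}) (f : T1 -> R) (g : T2 -> R) :
  measurable_fun setT f -> measurable_fun setT g ->
  (forall x, 0 <= f x) -> (forall y, 0 <= g y) ->
  (\int[m1 \x m2]_z (f z.1 * g z.2)%:E = \int[m1]_x (f x)%:E * \int[m2]_y (g y)%:E)%E.
Proof.
move=> mf mg f0 g0.
have mfg : measurable_fun setT (fun z : T1 * T2 => (f z.1 * g z.2)%:E).
  apply/measurable_EFinP; apply: measurable_funM.
    exact: (measurableT_comp mf measurable_fst).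
  exact: (measurableT_comp mg measurable_snd).
rewrite fubini_tonelli1//; last by move=> z; rewrite lee_fin mulr_ge0.
rewrite /fubini_F /=.
under eq_integral => x _.
  under eq_integral do rewrite EFinM.
  rewrite ge0_integralZl//; last 3 first.
  - exact/measurable_EFinP.
  - by move=> y _; rewrite lee_fin.
  - by rewrite lee_fin.
  over.
rewrite ge0_integralZr//.
- exact/measurable_EFinP.
- by move=> x _; rewrite lee_fin.
- by apply: integral_ge0 => y _; rewrite lee_fin.
Qed.

Local Notation lam := (@lebesgue_measure R).
Local Notation mT := (measurableTypeR R).

Lemma measurable_prod_tnth n (F : 'I_n -> R -> R) : (forall i, measurable_fun setT (F i)) ->
  measurable_fun setT (fun w : n.-tuple mT => \prod_(i < n) F i (tnth w i)).
Proof.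
move=> mF; elim: (index_enum _) => [|i s IH].
  rewrite (_ : (fun w => _) = cst 1); first exact: measurable_cst.
  by apply/funext => w; rewrite big_nil.
under eq_fun do rewrite big_cons.
apply: measurable_funM => //.
exact: (measurableT_comp (mF i) (measurable_tnth i)).
Qed.

Lemma integral_power_measure n (F : 'I_n -> R -> R) (I : 'I_n -> R) :
  (forall i, measurable_fun setT (F i)) -> (forall i x, 0 <= F i x) ->
  (forall i, (\int[lam]_x (F i x)%:E = (I i)%:E)%E) ->
  (\int[power_measure lam n]_w (\prod_(i < n) F i (tnth w i))%:E = (\prod_(i < n) I i)%:E)%E.
Proof.
elim: n F I => [|n IH] F I mF F0 hI.
  rewrite /= integral_dirac//; first by rewrite !big_ord0 diracT mul1e.
  rewrite (_ : (fun w => _) = cst 1%E); first exact: measurable_cst.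
  by apply/funext => w; rewrite big_ord0.
rewrite /= /powerS.
rewrite ge0_integral_pushforward//; last 3 first.
- exact: measurable_tuple_cons.
- apply/measurable_EFinP; exact: measurable_prod_tnth.
- by move=> w _; rewrite lee_fin prodr_ge0.
rewrite preimage_setT.
transitivity (\int[lam \x power_measure lam n]_z
   (F ord0 z.1 * \prod_(i < n) F (lift ord0 i) (tnth z.2 i))%:E)%E.
  apply: eq_integral => z _ /=; rewrite big_ord_recl; congr (_ * _)%:E.
  by apply: eq_bigr => i _; rewrite tnthS.
rewrite (@integral_prodM _ _ _ _ lam (power_measure lam n) (F ord0)
  (fun w : n.-tuple mT => \prod_(i < n) F (lift ord0 i) (tnth w i)))//; last 2 first.
- by apply: (@measurable_prod_tnth n (fun i => F (lift ord0 i))) => i.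
- by move=> w; rewrite prodr_ge0.
rewrite hI (IH (fun i => F (lift ord0 i)) (fun i => I (lift ord0 i)))//.
  by rewrite -EFinM big_ord_recl.
exact: (mF ord0).
Qed.

End product_integral.

(** * Product kernels on space-time *)

Section kernels.
Context {R : realType} {n : nat}.
Local Notation XT := ('rV[R]_n * R)%type.
Local Notation lam := (@lebesgue_measure R).
Implicit Types (j : option 'I_n) (z q : XT) (e h r : R) (phi : option 'I_n -> R -> R).

(** [option 'I_n] indexes the n + 1 coordinates of space-time, [None] being time, so that space and
    time directions are treated together. *)
Definition crd j z : R := if j is Some i then z.1 0 i else z.2.
Definition dir j : XT := if j is Some i then dx i else dt.
Definition prodk phi z : R := \prod_(j : option 'I_n) phi j (crd j z).

Lemma crd_lin j h v z : crd j (h *: v + z) = h * crd j v + crd j z.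
Proof. by case: j => [i|] /=; rewrite ?mxE. Qed.

Lemma crd_dir j (k : option 'I_n) : crd j (dir k) = (j == k)%:R.
Proof.
case: j k => [i|] [l|] //=; last by rewrite mxE.
rewrite mxE/= -(inj_eq (@Some_inj _)).
by congr (_%:R); congr (nat_of_bool _); apply/eqP/eqP => [[->]|[->]].
Qed.

Lemma crd_continuous j : continuous (crd j).
Proof.
move=> z; case: j => [i|] /=; last exact: cvg_snd.
apply: (@continuous_comp _ _ _ fst (fun x : 'rV[R]_n => x 0 i)); first exact: cvg_fst.
exact: coord_continuous.
Qed.

Lemma prodk_Ck phi : (forall j k, Ck k (phi j)) -> forall k, Ck k (prodk phi).
Proof.
move=> h k; apply: Ck_prod => j.
apply: (@Ck_comp_affine _ _ _ (phi j) (crd j) (crd j)) => //; first exact: crd_continuous.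
by move=> a v x; exact: crd_lin.
Qed.

(** Along [dir j] the other factors are constant, so the product has the difference quotient of its
    j-th factor times a constant. *)
Lemma prodk_derive phi j z : derivable (phi j) (crd j z) 1 ->
  'D_(dir j) (prodk phi) z = prodk (fun k => if k == j then 'D_1 (phi j) else phi k) z.
Proof.
move=> dphi.
pose c := \prod_(k | k != j) phi k (crd k z).
have E : (fun h : R => h^-1 *: ((prodk phi \o shift z) (h *: dir j) - prodk phi z)) =
  (fun h : R => h^-1 *: (((fun r => c * phi j r) \o shift (crd j z)) (h *: (1 : R)) - c * phi j (crd j z))).
  apply/funext => h /=; congr (_ *: (_ - _)).
    rewrite /prodk (bigD1 j)//= crd_lin crd_dir eqxx mulrC; congr (_ * _).
    apply: eq_bigr => k kj; rewrite crd_lin crd_dir (negbTE kj) mulr0 add0r.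
    by [].
  by rewrite /prodk (bigD1 j)//= mulrC.
rewrite /derive E -/(derive (fun r => c * phi j r) (crd j z) 1).
have -> : 'D_1 (fun r => c * phi j r) (crd j z) = c * 'D_1 (phi j) (crd j z).
  exact: (deriveZ c dphi).
rewrite /prodk (bigD1 j)//= eqxx mulrC; congr (_ * _).
by apply: eq_bigr => k /negbTE ->.
Qed.

Lemma prodkE phi z : prodk phi z = \prod_(i < n) phi (Some i) (z.1 0 i) * phi None z.2.
Proof.
rewrite /prodk (bigD1 None)//= mulrC; congr (_ * _).
rewrite (reindex_omap Some id)/=; last by case.
by apply: eq_bigl => i; rewrite eqxx.
Qed.

Lemma measurable_prodk phi : (forall j, measurable_fun setT (phi j)) ->
  measurable_fun setT (prodk phi \o @Defs.coord R n).
Proof.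
move=> mphi.
rewrite (_ : _ \o _ = fun w => \prod_(i < n) phi (Some i) (tnth w.1 i) * phi None w.2); last first.
  apply/funext => w /=; rewrite prodkE; congr (_ * _).
  by apply: eq_bigr => i _; rewrite /= mxE.
apply: measurable_funM.
  have mp := @measurable_prod_tnth R n (fun i => phi (Some i)) (fun i => mphi (Some i)).
  exact: (measurableT_comp mp measurable_fst).
exact: (measurableT_comp (mphi None) measurable_snd).
Qed.

Lemma integral_prodk phi (I : option 'I_n -> R) :
  (forall j, measurable_fun setT (phi j)) -> (forall j r, 0 <= phi j r) ->
  (forall j, (\int[lam]_r (phi j r)%:E = (I j)%:E)%E) ->
  (\int[@leb_xt R n]_w (prodk phi (Defs.coord w))%:E = (\prod_j I j)%:E)%E.
Proof.
move=> mphi phi0 hI.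
transitivity (\int[@leb_xt R n]_w (\prod_(i < n) phi (Some i) (tnth w.1 i) * phi None w.2)%:E)%E.
  apply: eq_integral => w _; rewrite prodkE; congr (_ * _)%:E.
  by apply: eq_bigr => i _; rewrite /= mxE.
rewrite (@integral_prodM _ _ _ _ _ (power_measure lam n) lam
  (fun w : n.-tuple (measurableTypeR R) => \prod_(i < n) phi (Some i) (tnth w i)) (phi None))//.
- have H : (\int[power_measure lam n]_w (\prod_(i < n) phi (Some i) (tnth w i))%:E =
      (\prod_(i < n) I (Some i))%:E)%E.
    exact: (@integral_power_measure R n (fun i => phi (Some i)) (fun i => I (Some i))
      (fun i => mphi (Some i)) (fun i => phi0 (Some i)) (fun i => hI (Some i))).
  rewrite [X in (X * _)%E]H hI -EFinM; congr EFin.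
  rewrite [RHS](bigD1 None)//= mulrC; congr (_ * _).
  rewrite [RHS](reindex_omap Some id)/=; last by case.
  by apply: eq_bigl => i; rewrite eqxx.
- exact: (@measurable_prod_tnth R n (fun i => phi (Some i)) (fun i => mphi (Some i))).
- exact: (mphi None).
- by move=> w; rewrite prodr_ge0.
Qed.

Definition cube (a b : option 'I_n -> R) : set XT := [set z | forall j, a j <= crd j z <= b j].

Lemma cube_compact a b : compact (cube a b).
Proof.
rewrite (_ : cube a b = [set x : 'rV[R]_n | forall i, `[a (Some i), b (Some i)]%classic (x ord0 i)] `*`
    `[a None, b None]).
  apply: compact_setX; last exact: segment_compact.
  apply: (@rV_compact _ _ (fun i => `[a (Some i), b (Some i)]%classic)) => i.
  exact: segment_compact.
apply/seteqP; split => [z h|z [h1 h2]].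
  by split => [i|] /=; rewrite in_itv/=; [exact: (h (Some i))|exact: (h None)].
case => [i|] /=; first by have := h1 i; rewrite /= in_itv.
by move: h2; rewrite /= in_itv.
Qed.

Lemma measurable_cube a b : measurable (@Defs.coord R n @^-1` cube a b).
Proof.
rewrite (_ : _ @^-1` _ = (fst @^-1` (\bigcap_(i in [set: 'I_n])
    ((@tnth _ (measurableTypeR R) ^~ i) @^-1` `[a (Some i), b (Some i)]%classic)))
    `&` (snd @^-1` `[a None, b None]%classic)).
  apply: measurableI.
    rewrite -[X in measurable X]setTI; apply: measurable_fst => //.
    apply: fin_bigcap_measurable; first by have := @finite_finset 'I_n [set: 'I_n].
    move=> i _; rewrite -[X in measurable X]setTI; apply: measurable_tnth => //.
  rewrite -[X in measurable X]setTI.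
  exact: (@measurable_snd _ _ (n.-tuple (measurableTypeR R)) (measurableTypeR R) measurableT _
    (measurable_itv `[a None, b None])).
apply/seteqP; split => [w h|w [h1 h2]].
  split; last by rewrite /= in_itv/=; exact: (h None).
  by move=> i _; rewrite /= in_itv/=; have := h (Some i); rewrite /= mxE.
case => [i|] /=; first by have := h1 i Logic.I; rewrite /= in_itv/= mxE.
by move: h2; rewrite /= in_itv.
Qed.

(** The support is [c, c + e], on one side of [c]: averages look forward in every coordinate, in
    particular in time. *)
Definition kern1 e (c r : R) : R := e^-1 * bump (e^-1 * (r - c)).
Definition step1 e (c r : R) : R := step (e^-1 * (r - c)).

Let affine_Ck e (c : R) (g : R -> R) : (forall k, Ck k g) -> forall k, Ck k (fun r => g (e^-1 * (r - c))).
Proof.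
move=> hg k; apply: (@Ck_comp_affine _ _ _ g (fun r => e^-1 * (r - c)) (fun v : R => e^-1 * v)) => //.
  move=> r; apply: cvgM; first exact: cvg_cst.
  by apply: cvgB; [exact: cvg_id|exact: cvg_cst].
by move=> a v x; rewrite /GRing.scale/=; ring.
Qed.

Lemma kern1_Ck e c k : Ck k (kern1 e c).
Proof. by apply: CkM; [exact: Ck_cst|apply: affine_Ck; exact: bump_Ck]. Qed.

Lemma step1_Ck e c k : Ck k (step1 e c).
Proof. by apply: affine_Ck; exact: step_Ck. Qed.

Lemma step1_is_derive e (c r : R) : is_derive r 1 (step1 e c) (kern1 e c r).
Proof.
have h1 : is_derive r 1 (fun r : R => e^-1 * (r - c)) e^-1.
  have -> : (fun r : R => e^-1 * (r - c)) = e^-1 *: (id - cst c) by [].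
  by apply: is_derive_eq; rewrite subr0 /GRing.scale/= mulr1.
rewrite /kern1 mulrC.
exact: (@is_derive1_comp _ step (fun r => e^-1 * (r - c)) r _ _ (step_is_derive _) h1).
Qed.

Lemma kern1_ge0 e (c r : R) : 0 < e -> 0 <= kern1 e c r.
Proof. by move=> e0; rewrite mulr_ge0 ?bump_ge0// invr_ge0 ltW. Qed.

Lemma kern1_out e (c r : R) : 0 < e -> r < c \/ c + e < r -> kern1 e c r = 0.
Proof.
move=> e0 h; rewrite /kern1 bump_out ?mulr0//; case: h => h; [left|right].
  by rewrite pmulr_rlt0 ?invr_gt0// subr_lt0.
by rewrite mulrC ltr_pdivlMr// mul1r; lra.
Qed.

Lemma continuous_measurableR (g : R -> R) : continuous g -> measurable_fun setT g.
Proof. exact: continuous_measurable_fun. Qed.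

Lemma integral_kern1 e (c : R) : 0 < e -> (\int[lam]_r (kern1 e c r)%:E = 1%:E)%E.
Proof.
move=> e0.
have -> : (\int[lam]_r (kern1 e c r)%:E = \int[lam]_(r in `[c, (c + e)%R]) (kern1 e c r)%:E)%E.
  rewrite [RHS]integral_mkcond; apply: eq_integral => r _.
  rewrite patchE; case: ifPn => // /negP; rewrite inE/= in_itv/= => /negP.
  by rewrite negb_and -!ltNge => /orP h; rewrite kern1_out.
have cc : c < c + e by rewrite ltrDl.
have ck : {within `[c, c + e], continuous (kern1 e c)}.
  by apply: continuous_subspaceT => r; exact: (Ck_continuous (kern1_Ck e c 0)).
have cs : continuous (step1 e c) := Ck_continuous (step1_Ck e c 0).
have ds : derivable_oo_LRcontinuous (step1 e c) c (c + e).
  split => [x _| |].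
  - by case: (step1_is_derive e c x).
  - by apply: cvg_at_right_filter; exact: cs.
  - by apply: cvg_at_left_filter; exact: cs.
have eqd : {in `]c, (c + e)[, derive1 (step1 e c) =1 kern1 e c}.
  by move=> x _; rewrite derive1E; case: (step1_is_derive e c x).
have h1 : step1 e c c = 0 by rewrite /step1 step_le0// subrr mulr0.
have h2 : step1 e c (c + e) = 1.
  by rewrite /step1 step_ge1// addrAC subrr add0r mulVf// gt_eqF.
by rewrite (continuous_FTC2 cc ck ds eqd) h1 h2 sube0.
Qed.

Lemma step1_diff_ge0 e (c h r : R) : 0 < e -> 0 <= h -> 0 <= step1 e c r - step1 e (c + h) r.
Proof.
move=> e0 h0; rewrite subr_ge0; apply: step_mono; rewrite ler_wpM2l ?invr_ge0 ?(ltW e0)//; lra.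
Qed.

Lemma step1_diff_out e (c h r : R) : 0 < e -> 0 <= h -> r < c \/ c + h + e < r ->
  step1 e c r - step1 e (c + h) r = 0.
Proof.
move=> e0 h0 [rc|rc].
  by rewrite /step1 !step_le0 ?subrr// pmulr_rle0 ?invr_gt0//; lra.
rewrite /step1 !step_ge1 ?subrr// mulrC ler_pdivlMr// mul1r; lra.
Qed.

(** The difference lies between 0 and 1 and vanishes outside an interval of length h + e. The excess
    [e] over the shift disappears in the limit that defines the trace. *)
Lemma integral_step1_diff e (c h : R) : 0 < e -> 0 <= h -> exists2 I, 0 <= I <= h + e &
  (\int[lam]_r (step1 e c r - step1 e (c + h) r)%:E = I%:E)%E.
Proof.
move=> e0 h0; set g := fun r => step1 e c r - step1 e (c + h) r.
have mg : measurable_fun setT g.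
  apply: continuous_measurableR => r; apply: cvgB; exact: (Ck_continuous (step1_Ck _ _ 0)).
have le : (\int[lam]_r (g r)%:E <= (h + e)%:E)%E.
  apply: (@le_trans _ _ (\int[lam]_(r in `[c, (c + h + e)%R]) 1%:E)%E).
    rewrite [leRHS]integral_mkcond; apply: ge0_le_integral => //.
    - by move=> r _; rewrite lee_fin step1_diff_ge0.
    - exact/measurable_EFinP.
    - by apply/(measurable_restrictT _ _).1 => //; exact: measurable_cst.
    move=> r _; rewrite patchE; case: ifPn => [_|].
      rewrite lee_fin /g; have := @step_le1 R (e^-1 * (r - c)).
      by have := @step_ge0 R (e^-1 * (r - (c + h))); rewrite /step1; lra.
    move=> /negP; rewrite inE/= in_itv/= => /negP.
    by rewrite negb_and -!ltNge => /orP hr; rewrite /g step1_diff_out.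
  rewrite integral_cst//= mul1e lebesgue_measure_itv/= lte_fin.
  case: ifPn => _; last by rewrite lee_fin addr_ge0// ltW.
  by rewrite -EFinB lee_fin; lra.
have ge : (0 <= \int[lam]_r (g r)%:E)%E.
  by apply: integral_ge0 => r _; rewrite lee_fin step1_diff_ge0.
exists (fine (\int[lam]_r (g r)%:E)%E).
  apply/andP; split; first exact: fine_ge0.
  by rewrite -lee_fin fineK// ge0_fin_numE// (le_lt_trans le)// ltry.
by rewrite fineK// ge0_fin_numE// (le_lt_trans le)// ltry.
Qed.

End kernels.

(** * Integration against test functions supported in a cube *)

Section test_integrals.
Context {R : realType} {n : nat}.
Local Notation XT := ('rV[R]_n * R)%type.
Local Notation mu := (@leb_xt R n).
Local Notation coord := (@Defs.coord R n).
Implicit Types (g psi : XT -> R) (O : set XT) (a b : option 'I_n -> R).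

Definition cube_integrable g a b :=
  mu.-integrable (coord @^-1` cube a b) (fun w => (g (coord w))%:E).

Definition supported (C : set XT) psi := forall z, ~ C z -> psi z = 0.

Lemma integrable_cube g psi a b : cube_integrable g a b ->
  continuous psi -> measurable_fun setT (psi \o coord) ->
  mu.-integrable (coord @^-1` cube a b) (fun w => (g (coord w) * psi (coord w))%:E).
Proof.
move=> ig cpsi mpsi.
have mC : measurable (coord @^-1` cube a b) := @measurable_cube _ _ a b.
have := @integrableMl _ _ _ mu _ mC _ (psi \o coord) ig.
have mpsi' : measurable_fun (coord @^-1` cube a b) (psi \o coord).
  exact: measurable_funS mpsi.
move=> /(_ mpsi') H; apply: H.
have cC : {within cube a b, continuous psi} by exact: continuous_subspaceT.
have /compact_bounded[M [Mr hM]] := continuous_compact cC (@cube_compact _ _ a b).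
exists M; split => // x Mx w Cw; apply: (hM x Mx); by exists (coord w).
Qed.

Lemma integral_cube O g psi a b : cube a b `<=` O -> supported (cube a b) psi ->
  (\int[mu]_(w in coord @^-1` O) (g (coord w) * psi (coord w))%:E =
   \int[mu]_(w in coord @^-1` cube a b) (g (coord w) * psi (coord w))%:E)%E.
Proof.
move=> CO sp; rewrite [LHS]integral_mkcond [RHS]integral_mkcond.
apply: eq_integral => w _; rewrite !patchE.
have [hC|hC] := pselect (cube a b (coord w)).
  by rewrite !mem_set//=; exact: CO.
rewrite (sp _ hC) mulr0 [X in _ = if X then _ else _](_ : _ = false) ?if_same//.
by apply/negbTE/negP; rewrite inE.
Qed.

(** The right-hand side is the integral of the constant [phi] against [psi]; the null set where the
    bound on [g] fails is removed from both integrals before they are compared. *)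
Lemma integral_test_le O g psi a b (phi I : R) : cube_integrable g a b -> cube a b `<=` O ->
  continuous psi -> measurable_fun setT (psi \o coord) -> supported (cube a b) psi ->
  (forall z, 0 <= psi z) -> (\int[mu]_w (psi (coord w))%:E = I%:E)%E ->
  {ae mu, forall w, cube a b (coord w) -> g (coord w) <= phi} ->
  (\int[mu]_(w in coord @^-1` O) (g (coord w) * psi (coord w))%:E <= (phi * I)%:E)%E.
Proof.
move=> lg CO cpsi mpsi sp psi0 hI [N [mN N0 hN]].
rewrite (integral_cube _ CO sp).
have mC : measurable (coord @^-1` cube a b) := @measurable_cube _ _ a b.
have ig := integrable_cube lg cpsi mpsi.
have i1 : mu.-integrable setT (fun w => (psi (coord w))%:E).
  apply/integrableP; split; first exact/measurable_EFinP.
  rewrite (_ : (\int[mu]_w _)%E = I%:E) ?ltry// -hI.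
  by apply: eq_integral => w _; rewrite gee0_abs// lee_fin.
have ip : mu.-integrable (coord @^-1` cube a b) (fun w => (phi%:E * (psi (coord w))%:E)%E).
  by apply: integrableZl => //; apply: integrableS i1.
have E : (phi * I)%:E = (\int[mu]_(w in coord @^-1` cube a b) (phi%:E * (psi (coord w))%:E))%E.
  rewrite integralZl//; last by apply: integrableS i1.
  rewrite EFinM -hI; congr (_ * _)%E.
  rewrite [RHS]integral_mkcond; apply: eq_integral => w _; rewrite patchE.
  case: ifPn => // /negP; rewrite inE/= => h.
  by rewrite sp.
rewrite E (negligible_integral mN mC ig N0) (negligible_integral mN mC ip N0).
apply: le_integral.
- exact: measurableD.
- by apply: (integrableS mC (measurableD mC mN) _ ig); exact: subDsetl.
- by apply: (integrableS mC (measurableD mC mN) _ ip); exact: subDsetl.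
move=> w; rewrite inE => -[Cw nNw]; rewrite -EFinM lee_fin ler_wpM2r//.
by apply: contrapT => h; apply: nNw; apply: hN => /= /(_ Cw).
Qed.

Lemma cube_integrableN g a b : cube_integrable g a b -> cube_integrable (fun z => - g z) a b.
Proof. by move=> lg; exact: (integrableN lg). Qed.

Lemma loc_integrable_cube O g a b : loc_integrable O g -> cube a b `<=` O -> cube_integrable g a b.
Proof. by move=> lg; apply: lg; exact: cube_compact. Qed.

Lemma integral_testN O g psi a b : cube_integrable g a b -> cube a b `<=` O ->
  continuous psi -> measurable_fun setT (psi \o coord) -> supported (cube a b) psi ->
  (\int[mu]_(w in coord @^-1` O) (- g (coord w) * psi (coord w))%:E =
   - \int[mu]_(w in coord @^-1` O) (g (coord w) * psi (coord w))%:E)%E.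
Proof.
move=> lg CO cpsi mpsi sp.
rewrite (integral_cube (fun z => - g z) CO sp) (integral_cube g CO sp).
have ig := integrable_cube lg cpsi mpsi.
have mC : measurable (coord @^-1` cube a b) := @measurable_cube _ _ a b.
have := @integralZl _ _ _ mu _ mC _ ig (-1).
rewrite mulN1e => <-; apply: eq_integral => w _.
by rewrite -EFinM mulN1r mulNr.
Qed.

Lemma integral_test_ge O g psi a b (phi I : R) : cube_integrable g a b -> cube a b `<=` O ->
  continuous psi -> measurable_fun setT (psi \o coord) -> supported (cube a b) psi ->
  (forall z, 0 <= psi z) -> (\int[mu]_w (psi (coord w))%:E = I%:E)%E ->
  {ae mu, forall w, cube a b (coord w) -> phi <= g (coord w)} ->
  ((phi * I)%:E <= \int[mu]_(w in coord @^-1` O) (g (coord w) * psi (coord w))%:E)%E.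
Proof.
move=> lg CO cpsi mpsi sp psi0 hI hphi.
have H := @integral_test_le O (fun z => - g z) psi a b (- phi) I (cube_integrableN lg) CO cpsi
  mpsi sp psi0 hI.
have {}H : (\int[mu]_(w in coord @^-1` O) (- g (coord w) * psi (coord w))%:E <= (- phi * I)%:E)%E.
  by apply: H; apply: ae_imply1 hphi => w h Cw; rewrite lerN2; exact: h.
by move: H; rewrite (integral_testN lg CO)// mulNr EFinN leeN2.
Qed.

End test_integrals.

(** * Averages of weakly differentiable functions *)

Section averages.
Context {R : realType} {n : nat}.
Local Notation XT := ('rV[R]_n * R)%type.
Local Notation mu := (@leb_xt R n).
Local Notation coord := (@Defs.coord R n).
Implicit Types (q z : XT) (e h : R) (j : option 'I_n).
Variables (O : set XT) (v0 : XT -> R) (w : option 'I_n -> XT -> R) (N : option 'I_n -> R).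
Hypothesis hw : forall j, weak_derivative O (dir j) v0 (w j).
Hypothesis N_ge0 : forall j, 0 <= N j.
Hypothesis hN : forall j, {ae mu, forall s, O (coord s) -> `|w j (coord s)| <= N j}.

Definition kern e q := prodk (fun j => kern1 e (crd j q)).
Definition avg e q : R := fine (\int[mu]_(s in coord @^-1` O) (v0 (coord s) * kern e q (coord s))%:E)%E.
Definition cell e q : set XT := cube (fun j => crd j q) (fun j => crd j q + e).

Let lv0 : loc_integrable O v0. Proof. by case: (hw None). Qed.

Lemma kern_ge0 e q z : 0 < e -> 0 <= kern e q z.
Proof. by move=> e0; rewrite /kern /prodk prodr_ge0// => j _; exact: kern1_ge0. Qed.

Lemma prodk_supported (phi : option 'I_n -> R -> R) a b :
  (forall j r, r < a j \/ b j < r -> phi j r = 0) -> supported (cube a b) (prodk phi).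
Proof.
move=> h z /existsNP[j /negP]; rewrite negb_and -!ltNge => /orP hj.
by rewrite /prodk (bigD1 j)//= h// mul0r.
Qed.

Lemma kern_supported e q : 0 < e -> supported (cell e q) (kern e q).
Proof. by move=> e0; apply: prodk_supported => j r; exact: kern1_out. Qed.

Lemma kern_continuous e q : continuous (kern e q).
Proof.
apply: (@Ck_continuous _ _ 0%N); apply: prodk_Ck => j k; exact: kern1_Ck.
Qed.

Lemma measurable_kern1 e (c : R) : measurable_fun setT (kern1 e c).
Proof. apply: continuous_measurableR; exact: (Ck_continuous (kern1_Ck _ _ 0)). Qed.

Lemma measurable_kern e q : measurable_fun setT (kern e q \o coord).
Proof. by apply: measurable_prodk => j; exact: measurable_kern1. Qed.

Lemma integral_kern e q : 0 < e -> (\int[mu]_s (kern e q (coord s))%:E = 1%:E)%E.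
Proof.
move=> e0; rewrite (@integral_prodk _ _ _ (fun=> 1)) ?big1//.
- by move=> j; exact: measurable_kern1.
- by move=> j r; exact: kern1_ge0.
- by move=> j; exact: integral_kern1.
Qed.

Lemma avgE e q : cell e q `<=` O -> 0 < e ->
  (\int[mu]_(s in coord @^-1` O) (v0 (coord s) * kern e q (coord s))%:E = (avg e q)%:E)%E.
Proof.
move=> CO e0; rewrite /avg fineK// (integral_cube _ CO (kern_supported e0)).
have := integrable_cube (loc_integrable_cube lv0 CO) (@kern_continuous e q) (@measurable_kern e q).
by move=> /integrable_fin_num; apply; exact: measurable_cube.
Qed.

Lemma avg_le e q phi : cell e q `<=` O -> 0 < e ->
  {ae mu, forall s, cell e q (coord s) -> v0 (coord s) <= phi} -> avg e q <= phi.
Proof.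
move=> CO e0 h; rewrite -lee_fin -avgE// -[phi]mulr1.
apply: (integral_test_le (loc_integrable_cube lv0 CO) CO) => //.
- exact: kern_continuous.
- exact: measurable_kern.
- exact: kern_supported.
- by move=> z; exact: kern_ge0.
- exact: integral_kern.
Qed.

Lemma avg_ge e q phi : cell e q `<=` O -> 0 < e ->
  {ae mu, forall s, cell e q (coord s) -> phi <= v0 (coord s)} -> phi <= avg e q.
Proof.
move=> CO e0 h; rewrite -lee_fin -avgE// -[phi]mulr1.
apply: (integral_test_ge (loc_integrable_cube lv0 CO) CO) => //.
- exact: kern_continuous.
- exact: measurable_kern.
- exact: kern_supported.
- by move=> z; exact: kern_ge0.
- exact: integral_kern.
Qed.

(* The kernel and its shift by h in direction j differ by the j-derivative of a compactly
   supported test function whose integral is at most h + e. *)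
Lemma avg_shift e q h j : 0 < e -> 0 <= h ->
  cube (fun k => crd k q) (fun k => crd k q + (if k == j then h + e else e)) `<=` O ->
  `|avg e (h *: dir j + q) - avg e q| <= N j * (h + e).
Proof.
move=> e0 h0 CO.
set C := cube _ _ in CO.
pose q' : XT := h *: dir j + q.
have crdq' k : crd k q' = if k == j then crd k q + h else crd k q.
  rewrite crd_lin crd_dir; case: eqP => _; first by rewrite mulr1 addrC.
  by rewrite mulr0 add0r.
pose phi k := if k == j then (fun r => step1 e (crd j q) r - step1 e (crd j q + h) r)
              else kern1 e (crd k q).
pose psi := prodk phi.
have C1 : cell e q `<=` O.
  move=> z hz; apply: CO => k; have := hz k => /andP[-> /le_trans]; apply.
  by rewrite lerD2l; case: eqP => // _; rewrite lerDr.
have C2 : cell e q' `<=` O.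
  move=> z hz; apply: CO => k; have := hz k; rewrite crdq'; case: eqP => // _ /andP[h1 h2].
  by rewrite (le_trans _ h1) ?lerDl// addrA.
have Dstep r : 'D_1 (fun r => step1 e (crd j q) r - step1 e (crd j q + h) r) r =
   kern1 e (crd j q) r - kern1 e (crd j q + h) r.
  by have [_] := is_deriveB (step1_is_derive e (crd j q) r) (step1_is_derive e (crd j q + h) r).
have phiCk k i : Ck i (phi k).
  rewrite /phi; case: eqP => _; last exact: kern1_Ck.
  have -> : (fun r => step1 e (crd j q) r - step1 e (crd j q + h) r) =
     (fun r => step1 e (crd j q) r + -1 * step1 e (crd j q + h) r).
    by apply/funext => r; rewrite mulN1r.
  apply: CkD; first exact: step1_Ck.
  by apply: CkM; [exact: Ck_cst|exact: step1_Ck].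
have Dpsi z : 'D_(dir j) psi z = kern e q z - kern e q' z.
  rewrite /psi prodk_derive; last first.
    by have [_ /(_ 1)[d _]] := phiCk j 1%N; exact: d.
  rewrite /kern /prodk (bigD1 j)//= [in RHS](bigD1 j)//= [X in _ - X](bigD1 j)//= eqxx.
  rewrite /phi eqxx Dstep crdq' eqxx mulrBl; congr (_ * _ - _ * _).
    by apply: eq_bigr => k /negbTE ->.
  by apply: eq_bigr => k kj; rewrite (negbTE kj) crdq' (negbTE kj).
have sC : supported C psi.
  apply: prodk_supported => k r; rewrite /phi; case: eqP => [->|_].
    by rewrite addrA; exact: step1_diff_out.
  exact: kern1_out.
have psi0 z : 0 <= psi z.
  rewrite /psi /prodk prodr_ge0// => k _; rewrite /phi; case: eqP => _.
    exact: step1_diff_ge0.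
  exact: kern1_ge0.
have [I /andP[I0 Ile] hI] := @integral_step1_diff R e (crd j q) h e0 h0.
have mphi k : measurable_fun setT (phi k).
  by apply: continuous_measurableR; exact: (Ck_continuous (phiCk k 0%N)).
have Ipsi : (\int[mu]_s (psi (coord s))%:E = I%:E)%E.
  rewrite (@integral_prodk _ _ _ (fun k => if k == j then I else 1))//.
  - congr EFin; rewrite (bigD1 j)//= eqxx big1 ?mulr1// => k /negbTE ->.
    by [].
  - move=> k r; rewrite /phi; case: eqP => _; [exact: step1_diff_ge0|exact: kern1_ge0].
  - by move=> k; rewrite /phi; case: eqP => _; [exact: hI|exact: integral_kern1].
have cpsi : continuous psi by apply: (@Ck_continuous _ _ 0%N); exact: prodk_Ck.
have mpsi : measurable_fun setT (psi \o coord) by exact: measurable_prodk.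
have tpsi : test_function O psi.
  split; first by move=> k; exact: prodk_Ck.
  by exists C; split => //; exact: cube_compact.
have [_ lwj /(_ _ tpsi) weak] := hw j.
have L : (\int[mu]_(s in coord @^-1` O) (v0 (coord s) * 'D_(dir j) psi (coord s))%:E =
    (avg e q - avg e q')%:E)%E.
  have C1C : cell e q `<=` C.
    move=> z hz k; have := hz k => /andP[-> /le_trans]; apply.
    by rewrite lerD2l; case: eqP => // _; rewrite lerDr.
  have C2C : cell e q' `<=` C.
    move=> z hz k; have := hz k; rewrite crdq'; case: eqP => // _ /andP[h1 h2].
    by rewrite (le_trans _ h1) ?lerDl// addrA.
  have s1 : supported C (kern e q).
    by move=> z nC; apply: (kern_supported e0) => h'; apply: nC; exact: C1C.
  have s2 : supported C (kern e q').
    by move=> z nC; apply: (kern_supported e0) => h'; apply: nC; exact: C2C.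
  have s3 : supported C ('D_(dir j) psi).
    by move=> z nC; rewrite Dpsi s1// s2// subrr.
  have A1 := avgE C1 e0; have A2 := avgE C2 e0.
  rewrite (integral_cube v0 CO s1) in A1; rewrite (integral_cube v0 CO s2) in A2.
  apply: (etrans (integral_cube v0 CO s3)).
  apply: (@etrans _ _ ((avg e q)%:E - (avg e q')%:E)%E); last by rewrite EFinB.
  have i1 := integrable_cube (loc_integrable_cube lv0 CO) (@kern_continuous e q) (@measurable_kern e q).
  have i2 := integrable_cube (loc_integrable_cube lv0 CO) (@kern_continuous e q') (@measurable_kern e q').
  apply: (@etrans _ _ (\int[mu]_(s in coord @^-1` C)
      ((v0 (coord s) * kern e q (coord s))%:E - (v0 (coord s) * kern e q' (coord s))%:E))%E).
    by apply: eq_integral => s _; rewrite Dpsi mulrBr EFinB.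
  have mC : measurable (coord @^-1` C) by exact: measurable_cube.
  have H := integralB_EFin mC i1 i2.
  exact: (etrans H (congr2 (fun x y => (x - y)%E) A1 A2)).
rewrite L in weak.
have hNC : {ae mu, forall s, C (coord s) -> `|w j (coord s)| <= N j}.
  by apply: ae_imply1 (hN j) => s hs Cs; apply: hs; exact: CO.
have U : (\int[mu]_(s in coord @^-1` O) (w j (coord s) * psi (coord s))%:E <= (N j * I)%:E)%E.
  apply: (integral_test_le (loc_integrable_cube lwj CO) CO) => //.
  by apply: ae_imply1 hNC => s hs /hs; rewrite ler_norml => /andP[].
have Lo : ((- N j * I)%:E <= \int[mu]_(s in coord @^-1` O) (w j (coord s) * psi (coord s))%:E)%E.
  apply: (integral_test_ge (loc_integrable_cube lwj CO) CO) => //.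
  by apply: ae_imply1 hNC => s hs /hs; rewrite ler_norml => /andP[].
have E : (\int[mu]_(s in coord @^-1` O) (w j (coord s) * psi (coord s))%:E =
   (avg e q' - avg e q)%:E)%E.
  by rewrite -opprB EFinN weak oppeK.
rewrite E !lee_fin in U Lo.
apply: (@le_trans _ _ (N j * I)); last by rewrite ler_wpM2l.
by rewrite -/q' ler_norml U andbT -mulNr.
Qed.

End averages.

(** * Paths along coordinate directions *)

Section coordinate_path.
Context {R : realType} {n : nat}.
Local Notation XT := ('rV[R]_n * R)%type.
Implicit Types (p q z : XT) (j : option 'I_n).

Definition of_crd (c : option 'I_n -> R) : XT := (\row_i c (Some i), c None).

Lemma of_crdK c j : crd j (of_crd c) = c j.
Proof. by case: j => [i|] //=; rewrite mxE. Qed.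

Lemma crd_inj p q : (forall j, crd j p = crd j q) -> p = q.
Proof.
case: p q => [x s] [y t] h; congr pair; last exact: (h None).
by apply/rowP => i; exact: (h (Some i)).
Qed.

(** A telescoping sum over the points obtained from [p] by replacing its coordinates by those of [q]
    one after another. They are all vertices of the box spanned by [p] and [q], and only there is a
    bound assumed. *)
Lemma coordinate_path (D : XT -> R) (beta : option 'I_n -> R) p q :
  (forall j z, (forall k, crd k z = crd k p \/ crd k z = crd k q) -> crd j z = crd j p ->
     `|D ((crd j q - crd j p) *: dir j + z) - D z| <= beta j) ->
  `|D q - D p| <= \sum_j beta j.
Proof.
move=> h.
pose mix (l : seq (option 'I_n)) := of_crd (fun k => if k \in l then crd k q else crd k p).
have main l : uniq l -> `|D (mix l) - D p| <= \sum_(j <- l) beta j.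
  elim: l => [_|j l IH /= /andP[jl ul]].
    by rewrite big_nil (_ : mix [::] = p) ?subrr ?normr0//; apply: crd_inj => k; rewrite of_crdK.
  have E : mix (j :: l) = (crd j q - crd j p) *: dir j + mix l.
    apply: crd_inj => k; rewrite crd_lin crd_dir !of_crdK inE.
    have [->|kj] /= := eqVneq k j; first by rewrite (negbTE jl) mulr1 subrK.
    by rewrite mulr0 add0r.
  rewrite big_cons E.
  have -> : D ((crd j q - crd j p) *: dir j + mix l) - D p =
    (D ((crd j q - crd j p) *: dir j + mix l) - D (mix l)) + (D (mix l) - D p) by ring.
  apply: le_trans (ler_normD _ _) _; apply: lerD; last exact: IH.
  apply: h => [k|]; rewrite of_crdK; last by rewrite (negbTE jl).
  by case: ifP => _; [right|left].
have <- : mix (index_enum _) = q.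
  by apply: crd_inj => k; rewrite of_crdK mem_index_enum.
exact: (main _ (index_enum_uniq _)).
Qed.

End coordinate_path.

(** * The trace of a weakly differentiable function *)

Section trace.
Context {R : realType} {n : nat}.
Local Notation XT := ('rV[R]_n * R)%type.
Local Notation mu := (@leb_xt R n).
Local Notation coord := (@Defs.coord R n).
Implicit Types (q z : XT) (e h : R) (j : option 'I_n) (x y : 'rV[R]_n) (s t : R).
Variables (Omega : set 'rV[R]_n) (T : R).
Let O : set XT := Omega `*` [set t | 0 < t < T].
Variables (v0 : XT -> R) (w : option 'I_n -> XT -> R) (N0 : R) (N : option 'I_n -> R).
Hypothesis hw : forall j, weak_derivative O (dir j) v0 (w j).
Hypothesis N_ge0 : forall j, 0 <= N j.
Hypothesis hN : forall j, {ae mu, forall o, O (coord o) -> `|w j (coord o)| <= N j}.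
Hypothesis hN0 : {ae mu, forall o, O (coord o) -> `|v0 (coord o)| <= N0}.
Hypothesis oOmega : open Omega.

Definition rbox (rho : R) x : set 'rV[R]_n := [set y | forall i, `|y 0 i - x 0 i| <= rho].

Lemma open_rbox x : Omega x -> exists2 rho : R, 0 < rho & rbox rho x `<=` Omega.
Proof.
move=> Ox; have : nbhs x Omega by move: oOmega; rewrite openE => /(_ _ Ox).
move=> /nbhs_ballP[d /= d0]; rewrite -ball_normE => hd.
exists (d / 2); first by rewrite divr_gt0.
move=> y hy; apply: hd => /=; apply: (@le_lt_trans _ _ (d / 2)); last by rewrite ltr_pdivrMr// ltr_pMr// ltr1n.
rewrite distrC; apply: rV_norm_le => [|i]; first by rewrite divr_ge0// ltW.
by rewrite !mxE.
Qed.

Definition fwd e q : XT := (q.1, q.2 + e).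

(* The limsup of the averages over boxes just after q in time; looking forward makes it
   meaningful at t = 0. *)
Definition trace q : R := inf [set r | exists2 e0 : R, 0 < e0 &
  forall e, 0 < e -> e < e0 -> avg O v0 e (fwd e q) <= r].

Definition fbox (d : R) q : set XT :=
  [set z : XT | (forall i, `|z.1 0 i - q.1 0 i| <= d) /\ q.2 < z.2 < q.2 + d].

Lemma cell_fwd q (d : R) : Omega q.1 -> 0 <= q.2 < T -> 0 < d ->
  exists2 e0 : R, 0 < e0 & forall e, 0 < e -> e < e0 ->
    cell e (fwd e q) `<=` O `&` fbox d q.
Proof.
move=> Oq /andP[q0 qT] d0; have [rho rho0 hrho] := open_rbox Oq.
(* In time the cell extends from q.2 + e to q.2 + 2 e, hence the two halves. *)
exists (Num.min (Num.min rho (d / 2)) ((T - q.2) / 2)).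
  by rewrite !lt_min rho0 !divr_gt0// subr_gt0.
move=> e e0; rewrite !lt_min => /andP[/andP[e1 e2] e3] z hz.
have hi i : q.1 0 i <= z.1 0 i <= q.1 0 i + e by exact: (hz (Some i)).
have /= /andP[h1 h2] := hz None.
have hi' i : `|z.1 0 i - q.1 0 i| <= e.
  by have /andP[h3 h4] := hi i; rewrite ger0_norm ?subr_ge0//; lra.
split.
  split; first by apply: hrho => i; apply: le_trans (hi' i) (ltW e1).
  by apply/andP; split; lra.
split; first by move=> i; apply: le_trans (hi' i) _; lra.
by apply/andP; split; lra.
Qed.

Let S q := [set r | exists2 e0 : R, 0 < e0 &
  forall e, 0 < e -> e < e0 -> avg O v0 e (fwd e q) <= r].

Let S_pick q r (c : R) : S q r -> 0 < c -> exists e, [/\ 0 < e, e < c & avg O v0 e (fwd e q) <= r].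
Proof.
move=> [e0 e00 h] c0; exists (Num.min e0 c / 2).
have m0 : 0 < Num.min e0 c by rewrite lt_min e00.
have m2 : Num.min e0 c / 2 < Num.min e0 c by rewrite ltr_pdivrMr// ltr_pMr// ltr1n.
split; first by rewrite divr_gt0.
  by apply: lt_le_trans m2 _; rewrite ge_min lexx orbT.
apply: h; first by rewrite divr_gt0.
by apply: lt_le_trans m2 _; rewrite ge_min lexx.
Qed.

Lemma trace_avg_ge q (c phi : R) : 0 < c -> (forall e, 0 < e -> e < c ->
  phi <= avg O v0 e (fwd e q)) -> forall r, S q r -> phi <= r.
Proof.
move=> c0 h r Sr; have [e [e0 ec hr]] := S_pick Sr c0.
exact: le_trans (h e e0 ec) hr.
Qed.

(** [inf] is meaningful only for nonempty sets bounded below; the essential bound [N0] on v0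
    provides both. *)
Lemma trace_has_inf q : Omega q.1 -> 0 <= q.2 < T -> has_inf (S q).
Proof.
move=> Oq qT; have [e0 e00 he] := cell_fwd Oq qT (ltr01 : (0 : R) < 1).
have inO e : 0 < e -> e < e0 -> cell e (fwd e q) `<=` O by move=> h1 h2 z /(he _ h1 h2)[].
split.
  exists N0, e0 => // e h1 h2; apply: (avg_le hw (inO _ h1 h2)) => //.
  apply: ae_imply1 hN0 => s hs Cs; have := hs (inO _ h1 h2 _ Cs).
  by rewrite ler_norml => /andP[].
exists (- N0) => r; apply: (trace_avg_ge e00) => e h1 h2.
apply: (avg_ge hw (inO _ h1 h2)) => //.
apply: ae_imply1 hN0 => s hs Cs; have := hs (inO _ h1 h2 _ Cs).
by rewrite ler_norml => /andP[].
Qed.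

Lemma trace_le q (d phi : R) : Omega q.1 -> 0 <= q.2 < T -> 0 < d ->
  {ae mu, forall o, O (coord o) -> fbox d q (coord o) -> v0 (coord o) <= phi} ->
  trace q <= phi.
Proof.
move=> Oq qT d0 h; have [e0 e00 he] := cell_fwd Oq qT d0.
have [_ hlb] := trace_has_inf Oq qT.
apply: ge_inf => //.
exists e0 => // e h1 h2; apply: (avg_le hw) => //.
  by move=> z /(he _ h1 h2)[].
by apply: ae_imply1 h => s hs /(he _ h1 h2)[]; exact: hs.
Qed.

Lemma trace_ge q (d phi : R) : Omega q.1 -> 0 <= q.2 < T -> 0 < d ->
  {ae mu, forall o, O (coord o) -> fbox d q (coord o) -> phi <= v0 (coord o)} ->
  phi <= trace q.
Proof.
move=> Oq qT d0 h; have [e0 e00 he] := cell_fwd Oq qT d0.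
have [hne _] := trace_has_inf Oq qT.
apply: lb_le_inf => //; apply: (trace_avg_ge e00) => e h1 h2.
apply: (avg_ge hw) => //; first by move=> z /(he _ h1 h2)[].
by apply: ae_imply1 h => s hs /(he _ h1 h2)[]; exact: hs.
Qed.

(** [avg_shift] moves forward only; for d < 0 the two points exchange roles. *)
Lemma avg_step e z (d : R) j : 0 < e ->
  cube (fun k => crd k z + (if k == j then Num.min d 0 else 0))
       (fun k => crd k z + (if k == j then Num.max d 0 + e else e)) `<=` O ->
  `|avg O v0 e (d *: dir j + z) - avg O v0 e z| <= N j * (`|d| + e).
Proof.
move=> e0 CO; have [d0|d0] := leP 0 d.
  rewrite (ger0_norm d0); apply: (avg_shift hw) => //.
  move=> y hy; apply: CO => k; have := hy k.
  by case: eqP => _; rewrite ?(min_idPr d0) ?(max_idPl d0) addr0.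
have d0' := ltW d0.
rewrite (ltr0_norm d0) distrC.
have {1}-> : z = (- d) *: dir j + (d *: dir j + z) by rewrite addrA -scalerDl addNr scale0r add0r.
apply: (avg_shift hw) => //; first by rewrite oppr_ge0.
move=> y hy; apply: CO => k; have := hy k; rewrite crd_lin crd_dir.
case: eqP => _; rewrite ?(min_idPl d0') ?(max_idPr d0').
  by rewrite mulr1 => /andP[h1 h2]; apply/andP; split; lra.
by rewrite mulr0 !add0r addr0.
Qed.

(** The coordinate path between the points, thickened by a cell of size e, stays in a box contained
    in [Omega]. Each step costs its length plus e, and the part proportional to e vanishes in the
    limit. *)
Lemma trace_lip (c : 'rV[R]_n) (rho : R) q q' : rbox rho c `<=` Omega ->
  (forall i, `|q.1 0 i - c 0 i| < rho) -> (forall i, `|q'.1 0 i - c 0 i| < rho) ->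
  0 <= q.2 < T -> 0 <= q'.2 < T ->
  trace q' <= trace q + \sum_j N j * `|crd j q' - crd j q|.
Proof.
move=> cO hq hq' /andP[q0 qT] /andP[q'0 q'T].
have Oq : Omega q.1 by apply: cO => i; exact: ltW.
have Oq' : Omega q'.1 by apply: cO => i; exact: ltW.
set D := \sum_j _.
(* [g] is the room left to the walls of the box and to T. It counts twice in time because a cell
   ends 2 e after its point. *)
have [g g0 hg] : exists2 g : R, 0 < g & (forall i, `|q.1 0 i - c 0 i| + g <= rho /\
    `|q'.1 0 i - c 0 i| + g <= rho) /\ (q.2 + 2 * g < T /\ q'.2 + 2 * g < T).
  pose g1 : R := \big[Num.min/1]_i Num.min (rho - `|q.1 0 i - c 0 i|) (rho - `|q'.1 0 i - c 0 i|).
  have g10 : 0 < g1.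
    by rewrite /g1; apply/bigmin_gtP; split => // i _; rewrite lt_min !subr_gt0 hq hq'.
  pose g2 := Num.min ((T - q.2) / 4) ((T - q'.2) / 4).
  have g20 : 0 < g2 by rewrite lt_min !divr_gt0// subr_gt0.
  exists (Num.min g1 g2); first by rewrite lt_min g10.
  have l1 : Num.min g1 g2 <= g1 by rewrite ge_min lexx.
  have l2 : Num.min g1 g2 <= g2 by rewrite ge_min lexx orbT.
  have l3 : g2 <= (T - q.2) / 4 by rewrite ge_min lexx.
  have l4 : g2 <= (T - q'.2) / 4 by rewrite ge_min lexx orbT.
  split; last by split; lra.
  move=> i; have : g1 <= Num.min (rho - `|q.1 0 i - c 0 i|) (rho - `|q'.1 0 i - c 0 i|).
    by apply: bigmin_le_cond.
  by rewrite le_min => /andP[? ?]; split; lra.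
have step e : 0 < e -> e <= g ->
    `|avg O v0 e (fwd e q') - avg O v0 e (fwd e q)| <= D + (\sum_j N j) * e.
  move=> e0 eg.
  rewrite [leRHS](_ : _ = \sum_j N j * (`|crd j q' - crd j q| + e)); last first.
    by rewrite /D mulr_suml -big_split/=; apply: eq_bigr => j _; rewrite mulrDr.
  apply: coordinate_path => j z hz hjz.
  have crdf k p : crd k (fwd e p) = crd k p + (if k is None then e else 0).
    by case: k => [i|] //=; rewrite addr0.
  have -> : crd j (fwd e q') - crd j (fwd e q) = crd j q' - crd j q.
    by rewrite !crdf opprD addrACA subrr addr0.
  apply: avg_step => // y hy.
  (* Every coordinate of a point in a cell met along the path lies between those of the two ends, up
     to the cell size. *)
  have hx k : Num.min (crd k (fwd e q)) (crd k (fwd e q')) <= crd k y <=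
       Num.max (crd k (fwd e q)) (crd k (fwd e q')) + e.
    have := hy k; case: eqP => [->|_].
      rewrite hjz !crdf.
      set A := crd j q; set B := crd j q'; set u := (if j is None then e else 0).
      by case: (leP (B - A) 0) => BA; [have BA' : B + u <= A + u by lra|have BA' : A + u <= B + u by lra];
        rewrite ?(min_idPr BA') ?(max_idPl BA') ?(min_idPl BA') ?(max_idPr BA') => /andP[? ?];
        apply/andP; split; lra.
    rewrite addr0 -lerBlDr => /andP[h1 h2]; rewrite ge_min -lerBlDr le_max.
    by case: (hz k) => hk; rewrite -hk h1 h2 ?orbT.
  split.
    apply: cO => i; have := hx (Some i); have [/(_ i)[b1 b2] _] := hg; rewrite /= => /andP[h1 h2].
    have := ler_norm (q.1 0 i - c 0 i); have := lerNnormlW (lexx `|q.1 0 i - c 0 i|).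
    have := ler_norm (q'.1 0 i - c 0 i); have := lerNnormlW (lexx `|q'.1 0 i - c 0 i|).
    move: h1 h2; rewrite ge_min -lerBlDr le_max => /orP h1 /orP h2 *.
    by rewrite ler_norml; apply/andP; split; [case: h1; lra|case: h2; lra].
  have := hx None; have [_ [b1 b2]] := hg; rewrite /= => /andP[h1 h2].
  move: h1 h2; rewrite ge_min -lerBlDr le_max => /orP h1 /orP h2.
  by apply/andP; split; [case: h1; lra|case: h2; lra].
have [hne _] := @trace_has_inf q Oq (introT andP (conj q0 qT)).
have [_ hlb'] := @trace_has_inf q' Oq' (introT andP (conj q'0 q'T)).
rewrite -lerBlDr; apply: lb_le_inf => // r [e0 e00 hr].
apply/ler_addgt0Pr => eps eps0; rewrite lerBlDr.
have sN : 0 <= \sum_j N j by apply: sumr_ge0.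
apply: ge_inf => //.
exists (Num.min (Num.min e0 g) (eps / (\sum_j N j + 1))).
  by rewrite !lt_min e00 g0 divr_gt0// ltr_wpDl.
move=> e h1; rewrite !lt_min => /andP[/andP[h2 h3] h4].
have := step e h1 (ltW h3); rewrite ler_norml => /andP[_ h5].
have h6 := hr e h1 h2.
have h7 : (\sum_j N j) * e <= eps.
  apply: (@le_trans _ _ ((\sum_j N j + 1) * e)).
    by rewrite ler_wpM2r ?(ltW h1)// lerDl.
  by rewrite mulrC -ler_pdivlMr ?ltr_wpDl// ltW.
move: h5 h6 h7; rewrite lerBlDr => h5 h6 h7; apply: le_trans h5 _.
rewrite [leRHS](_ : _ = D + eps + r); last by ring.
by apply: lerD => //; rewrite lerD2l.
Qed.

End trace.

(** * Growth along curves, from slopes at every point and from below *)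

Section curve_growth.
Context {R : realType} {n : nat}.
Local Notation XT := ('rV[R]_n * R)%type.
Implicit Types (a b K : R) (X : R -> 'rV[R]_n).

(** With no exceptional point the open set of [slope_chain] can be taken empty, and absolute
    continuity is not assumed. This is the form that suits the trace. *)
Lemma slope_le_everywhere a b K (g : R -> R) : a <= b ->
  (forall s, a <= s <= b -> slope_le K a b g s) -> g b - g a <= K * (b - a).
Proof.
move=> ab h.
suff : g b - K * b - (g a - K * a) <= 0 by rewrite mulrBr; lra.
apply/ler_addgt0Pr => e e0; rewrite add0r.
have ba : 0 < b - a + 1 by rewrite ltr_wpDl// subr_ge0.
have e1 : 0 < e / (b - a + 1) by rewrite divr_gt0.
have h' s : a <= s <= b -> ~ (set0 : set R) s -> slope_le 0 a b (fun s => g s - K * s) s.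
  move=> sab _; rewrite -(subrr K); apply: slope_leB; first exact: h.
  have := @slope_le_linear R a b (- K) s.
  by congr slope_le; apply/funext => t; rewrite mulNr.
(* An interval of a chain contains its left end, so a chain inside the empty set has no interval. *)
have [[|p l] [h1 _ cl]] := slope_chain ab e1 open0 h'.
  rewrite big_nil addr0 => /le_trans; apply.
  by rewrite mulrAC ler_pdivrMr// ler_pM2l// lerDl.
have [_ p12 _] := h1 p (mem_head _ _).
by have := cl p (mem_head _ _) p.1; rewrite /= lexx p12 => /(_ isT).
Qed.

(** The upper estimate for - J and - h. *)
Lemma curve_growth_ge (J : XT -> R) (Jd : forall (v z : XT), derivable J z v)
    (Jc : forall v : XT, continuous ('D_v J))
    M a b X (G : R -> 'rV[R]_n) (h : R -> R) (N kappa : R) :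
  a <= b -> 0 <= M -> lip_rV M a b X ->
  {ae lebesgue_measure, forall s, a <= s <= b -> is_derive s 1 X (G s)} ->
  0 <= N -> measurable_fun `[a, b] h -> (forall s, a <= s <= b -> `|h s| <= N) ->
  {ae lebesgue_measure, forall s, a <= s <= b ->
    kappa <= h s + 'D_dt J (X s, s) + \sum_(i < n) 'D_(dx i) J (X s, s) * G s 0 i} ->
  kappa * (b - a) <= prim a h b + J (X b, b) - J (X a, a).
Proof.
move=> ab M0 lX dX N0 mh hN hk.
pose J' : XT -> R := fun z => - J z; pose h' : R -> R := fun s => - h s.
have Jd' (v z : XT) : derivable J' z v by apply: derivableN; exact: Jd.
have DJ' (v : XT) : 'D_v J' = (fun z => - 'D_v J z).
  by apply/funext => z; rewrite deriveN.
have Jc' (v : XT) : continuous ('D_v J').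
  by rewrite DJ' => z; apply: cvgN; exact: Jc.
have mh' : measurable_fun `[a, b] h' by apply: measurableT_comp.
have hN' s : a <= s <= b -> `|h' s| <= N by rewrite normrN; exact: hN.
have hk' : {ae lebesgue_measure, forall s, a <= s <= b ->
    h' s + 'D_dt J' (X s, s) + \sum_(i < n) 'D_(dx i) J' (X s, s) * G s 0 i <= - kappa}.
  apply: ae_imply1 hk => s hs sab; have := hs sab; rewrite (congr1 (@^~ (X s, s)) (DJ' dt)).
  have -> : \sum_(i < n) 'D_(dx i) J' (X s, s) * G s 0 i = - \sum_(i < n) 'D_(dx i) J (X s, s) * G s 0 i.
    by rewrite -sumrN; apply: eq_bigr => i _; rewrite (congr1 (@^~ (X s, s)) (DJ' (dx i))) mulNr.
  rewrite /h'; lra.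
have := curve_growth_le Jd' Jc' ab M0 lX dX N0 mh' hN' hk'.
have -> : prim a h' b = - prim a h b.
  rewrite /prim -[RHS]mulN1r -RintegralZl//; last exact: bounded_integrable mh hN.
  by apply: eq_Rintegral => x _; rewrite mulN1r.
by rewrite /J' mulNr; lra.
Qed.

End curve_growth.

(** * Costs and the value function *)

Section control.
Context {R : realType} {n m : nat}.
Local Notation XT := ('rV[R]_n * R)%type.
Implicit Types (x y : 'rV[R]_n) (s t r d e : R) (X Y : R -> 'rV[R]_n) (u : R -> 'rV[R]_m)
  (v : 'rV[R]_m).

Section short_time.
Variables (f : 'rV[R]_n * 'rV[R]_m -> 'rV[R]_n) (U : set 'rV[R]_m).
Hypotheses (flip : box_lip f U) (fbnd : box_bounded f U).

(** As long as the trajectory stays in the ball its speed is at most [M], so it cannot get farther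
    than rho / 2 and never leaves. The resulting constant [M] is the same for all inputs. *)
Lemma traj_short t T x u X (M rho : R) : t <= T -> 0 <= M -> 0 < rho ->
  (forall s, t <= s <= T -> U (u s)) ->
  (forall y v, `|y - x| <= rho -> U v -> `|f (y, v)| <= M) ->
  traj f t T x u X -> M * (T - t) <= rho / 2 ->
  lip_rV M t T X.
Proof.
move=> tT M0 rho0 Uu hM tX hT.
have [r [K [r0 K0 hr lX]]] := traj_bounded_lip fbnd Uu tX.
have [Xt acX dX] := tX.
have stay s : t <= s <= T -> (forall q, t <= q <= s -> `|X q - x| <= rho) -> lip_rV M t s X.
  move=> /andP[ts sT] hq; apply: (@ac_derive_lip _ _ _ _ _ (fun q => f (X q, u q)) _ M0).
    exact: ac_sub acX.
  apply: ae_imply1 dX => q h /andP[tq qs].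
  have qT : t <= q <= T by rewrite tq (le_trans qs).
  by split; [exact: h|apply: hM; [apply: hq; rewrite tq|exact: Uu]].
(* The constant [K] depends on the trajectory and only sets the step length: one step adds at most
   rho / 2 to the rho / 2 guaranteed by [M]. *)
pose eta := rho / (2 * (K + 1)).
have K1 : 0 < K + 1 by rewrite ltr_wpDl.
have eta0 : 0 < eta by rewrite divr_gt0// mulr_gt0.
have main k s : t <= s <= T -> s - t <= k%:R * eta -> forall q, t <= q <= s -> `|X q - x| <= rho.
  elim: k s => [|k IH] s /andP[ts sT] hs q /andP[tq qs].
    have -> : q = t by apply/eqP; rewrite eq_le tq andbT; move: hs; rewrite mul0r; lra.
    by rewrite Xt subrr normr0 ltW.
  have [qk|qk] := leP (q - t) (k%:R * eta).
    by apply: (IH q) => //; rewrite ?tq ?lexx ?(le_trans qs).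
  pose p := t + k%:R * eta.
  have tp : t <= p by rewrite lerDl mulr_ge0// ltW.
  have pq : p <= q by rewrite /p; lra.
  have pT : t <= p <= T by rewrite tp (le_trans pq)// (le_trans qs).
  have pk : p - t <= k%:R * eta by rewrite /p; lra.
  have lp := stay p pT (IH p pT pk).
  have h1 : `|X p - x| <= rho / 2.
    rewrite -Xt; apply: le_trans (lp _ _ (lexx t) tp (lexx p)) _; apply: le_trans hT.
    by rewrite ler_wpM2l// lerB//; case/andP: pT.
  have h2 : `|X q - X p| <= rho / 2.
    apply: le_trans (lX _ _ tp pq (le_trans qs sT)) _.
    apply: (@le_trans _ _ ((K + 1) * eta)).
      apply: ler_pM => //; first by rewrite subr_ge0.
        by rewrite lerDl.
      by move: hs; rewrite -natr1 mulrDl mul1r /p; lra.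
    by rewrite /eta le_eqVlt; apply/orP; left; apply/eqP; field; rewrite gt_eqF.
  have -> : X q - x = (X q - X p) + (X p - x) by rewrite addrA subrK.
  apply: le_trans (ler_normD _ _) _; lra.
apply: stay; first by rewrite tT lexx.
pose k := (Num.truncn ((T - t) / eta)).+1.
apply: (main k); first by rewrite tT lexx.
by rewrite -ler_pdivrMr//; apply: ltW; exact: truncnS_gt.
Qed.

End short_time.

Variable P : optctrl R n m.
Hypotheses (hP : MLip P) (hunc : state_unconstrained P).
Let f := oc_f P.
Let U := oc_U P.
Let T := oc_T P.

Lemma oc_flip : box_lip f U.
Proof. by case: hP => _ _ + cU; rewrite hunc; exact: loc_lip_f. Qed.

Lemma oc_fbnd : box_bounded f U.
Proof. by apply: box_lip_bounded oc_flip; case: hP. Qed.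

Lemma oc_clip : cost_lip (oc_c P) U T.
Proof. by case: hP => + _ _ cU; rewrite hunc; exact: loc_lip_c. Qed.

Let T0 : 0 <= T. Proof. exact: ltW (oc_T_gt0 P). Qed.

Lemma oc_cbnd : forall r, exists2 M : R, 0 <= M &
  forall x v s, `|x| <= r -> U v -> 0 <= s <= T -> `|oc_c P (x, v, s)| <= M.
Proof. by apply: (cost_lip_bounded T0 _ oc_clip); case: hP. Qed.

Lemma oc_glip : forall r, exists2 K : R, 0 <= K & forall x y, `|x| <= r -> `|y| <= r ->
    `|oc_g P x - oc_g P y| <= K * `|x - y|.
Proof. by case: hP => _ + _ _; rewrite hunc; exact: loc_lip_g. Qed.

Definition running X u (s : R) : R := oc_c P (X s, u s, s).

Definition costR t u X : R := prim t (running X u) T + oc_g P (X T).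

Lemma running_measurable_bounded t x u X : 0 <= t -> t <= T -> input U t T u -> traj f t T x u X ->
  measurable_fun `[t, T] (running X u) /\
  exists2 M : R, 0 <= M & forall s, t <= s <= T -> `|running X u s| <= M.
Proof.
move=> t0 tT [Uu mu_] tX.
have [r [M [r0 M0 hr lX]]] := traj_bounded_lip oc_fbnd Uu tX.
have in0 s : t <= s <= T -> 0 <= s <= T by move=> /andP[h ->]; rewrite (le_trans t0).
split; last first.
  have [N N0 hN] := oc_cbnd r; exists N => // s sT.
  by apply: hN; [exact: hr|exact: Uu|exact: in0].
have [K K0 hK] := oc_clip r.
apply: (@ctrl_lip_measurable _ _ _ _ (K * (M + 1)) u) => //.
  by rewrite mulr_ge0// addr_ge0.
move=> s q sT qT.
apply: le_trans (hK _ _ _ _ _ _ (hr _ sT) (hr _ qT) (Uu _ sT) (Uu _ qT) (in0 _ sT) (in0 _ qT)) _.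
rewrite -mulrA ler_wpM2l//.
have h : `|X s - X q| <= M * `|s - q|.
  case/andP: sT => ts sT; case/andP: qT => tq qT.
  have [sq|qs] := leP s q.
    by rewrite distrC (distrC s) (ger0_norm (_ : 0 <= q - s)) ?subr_ge0//; exact: lX.
  by rewrite (ger0_norm (_ : 0 <= s - q)) ?subr_ge0 ?(ltW qs)//; apply: lX => //; exact: ltW.
have h1 : 0 <= M * `|u s - u q| by rewrite mulr_ge0.
by rewrite mulrDl !mul1r mulrDr; lra.
Qed.

Lemma oc_admissible_traj t x u : oc_admissible P x t u <->
  input U t T u /\ exists X, traj f t T x u X.
Proof. by rewrite /oc_admissible hunc; exact: (admissible_traj oc_flip oc_fbnd). Qed.

Lemma oc_phi_traj t x u X : input U t T u -> traj f t T x u X ->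
  forall s, t <= s <= T -> oc_phi P x t u (s - t) = X s.
Proof. by move=> iu tX s sT; rewrite /oc_phi hunc; exact: (phi_traj oc_flip oc_fbnd iu tX). Qed.

Lemma cost_traj t x u X : 0 <= t -> t <= T -> input U t T u -> traj f t T x u X ->
  cost P x t u = (costR t u X)%:E.
Proof.
move=> t0 tT iu tX; have [mr [M M0 hM]] := running_measurable_bounded t0 tT iu tX.
have ir := bounded_integrable mr hM.
rewrite /cost /costR EFinD; congr (_ + _)%E; last first.
  by rewrite (oc_phi_traj iu tX)// tT lexx.
rewrite /prim fineK; last exact: integrable_fin_num.
apply: eq_integral => s; rewrite inE/= in_itv/= => sT.
by rewrite (oc_phi_traj iu tX).
Qed.

Lemma traj_costR_split t t' x u X : 0 <= t -> t <= t' -> t' <= T -> input U t T u ->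
  traj f t T x u X -> costR t u X = prim t (running X u) t' + costR t' u X.
Proof.
move=> t0 tt tT iu tX; have [mr [M M0 hM]] := running_measurable_bounded t0 (le_trans tt tT) iu tX.
by rewrite /costR (prim_split tt tT (bounded_integrable mr hM)) addrA.
Qed.

Variable V : 'rV[R]_n * R -> \bar R.
Hypothesis hV : is_value_function P V.

Lemma value_le t x u X : 0 <= t -> t <= T -> input U t T u -> traj f t T x u X ->
  (V (x, t) <= (costR t u X)%:E)%E.
Proof.
move=> t0 tT iu tX; rewrite hV ?hunc ?t0//.
rewrite -(cost_traj t0 tT iu tX); apply: ereal_inf_lbound; exists u => //.
by apply/oc_admissible_traj; split => //; exists X.
Qed.

(** A lower bound on all trajectory costs passes to V even when no input is admissible, V being +oo
    in that case. *)
Lemma value_ge t x (c : R) : 0 <= t -> t <= T ->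
  (forall u X, input U t T u -> traj f t T x u X -> c <= costR t u X) ->
  (c%:E <= V (x, t))%E.
Proof.
move=> t0 tT h; rewrite hV ?hunc ?t0//.
apply: le_ereal_inf_tmp => _ [u /oc_admissible_traj[iu [X tX]] <-].
by rewrite (cost_traj t0 tT iu tX) lee_fin; exact: h tX.
Qed.

End control.

(** * Auxiliary estimates and the linear inequalities of the main argument *)

Section auxiliary_estimates.
Context {R : realType}.

Lemma small_factor (d Q e : R) : 0 < d -> 0 <= Q -> 0 < e ->
  exists2 d', 0 < d' & d' <= d /\ Q * d' <= e.
Proof.
move=> d0 Q0 e0; have Q1 : 0 < Q + 1 by rewrite ltr_wpDl.
exists (Num.min d (e / (Q + 1))); first by rewrite lt_min d0 divr_gt0.
split; first by rewrite ge_min lexx.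
apply: (@le_trans _ _ ((Q + 1) * (e / (Q + 1)))).
  apply: ler_pM => //; first by rewrite le_min (ltW d0) divr_ge0// ltW.
    by rewrite lerDl.
  by rewrite ge_min lexx orbT.
by rewrite mulrC divfK// gt_eqF.
Qed.

Lemma prim_dist (a b e M : R) (h1 h2 : R -> R) : a <= b ->
  measurable_fun `[a, b] h1 -> measurable_fun `[a, b] h2 ->
  (forall s, a <= s <= b -> `|h1 s| <= M) -> (forall s, a <= s <= b -> `|h2 s| <= M) ->
  (forall s, a <= s <= b -> `|h1 s - h2 s| <= e) ->
  `|prim a h1 b - prim a h2 b| <= e * (b - a).
Proof.
move=> ab m1 m2 b1 b2 hd.
rewrite /prim -RintegralB//; last 2 first.
- exact: bounded_integrable m1 b1.
- exact: bounded_integrable m2 b2.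
apply: (@prim_norm_le R a b e (fun s => h1 s - h2 s)) => //.
exact: measurable_funB.
Qed.

Lemma sum_option n (F : option 'I_n -> R) : \sum_j F j = F None + \sum_(i < n) F (Some i).
Proof.
rewrite (bigD1 None)//=; congr (_ + _).
rewrite (reindex_omap Some id)/=; last by case.
by apply: eq_bigl => i; rewrite eqxx.
Qed.

End auxiliary_estimates.

(** Running cost plus J grows by at least [a9 + 2 * a8], while the trace changes by at most [a9]
    along the trajectory and by [a8] within the starting box; one [a8] is left over. *)
Lemma dynamic_programming_arith (R : realType) (a1 a2 a3 a4 a5 a6 a7 a8 a9 : R) :
  a9 + 2 * a8 <= a1 + a2 - a3 -> a4 <= a5 + a9 -> a5 <= a6 + a8 -> a2 - a4 <= a7 ->
  a3 - (a6 - a8) <= a1 + a7.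
Proof. lra. Qed.

Lemma terminal_cost_arith (R : realType) (A B C Mc Kg M M1 tau e : R) :
  - (Mc * tau) <= A -> - (Kg * ((M + 1 + M1) * tau)) <= B - C ->
  (Mc + Kg * (M + 1 + M1)) * tau <= e / 2 -> C - e / 2 <= A + B.
Proof.
have -> : (Mc + Kg * (M + 1 + M1)) * tau = Mc * tau + Kg * ((M + 1 + M1) * tau) by ring.
lra.
Qed.

Lemma slope_arith (R : realType) (A B k e x : R) :
  A <= B + k * x -> 0 <= e * x -> - B - - A <= (k + e) * x.
Proof. rewrite mulrDl; lra. Qed.

Lemma growth_arith (R : realType) (A B k s : R) :
  - A - - B <= k * (s - 0) -> B <= A + k * s.
Proof. rewrite subr0; lra. Qed.

Lemma terminal_trace_arith (R : realType) (A B C D e : R) :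
  A - B <= e / 2 -> D - e / 2 <= A - C -> C <= B - D + e.
Proof. lra. Qed.

(** [rT] is spent twice, on the growth of cost plus J and on the change of the trace, which gives
    the factor 2 of the final constant. *)
Lemma suboptimality_arith (R : realType) (p JT J0 g tr0 trs e rT rs : R) :
  p + JT - J0 <= rT -> trs <= JT - g + e -> tr0 <= trs + rs -> rs <= rT ->
  p + g - 2 * rT <= J0 - tr0 + e.
Proof. lra. Qed.

(** * Suboptimality of the feedback *)

Section suboptimality.
Context {R : realType} {n m : nat}.
Local Notation XT := ('rV[R]_n * R)%type.
Local Notation mu := (@leb_xt R n).
Local Notation coord := (@Defs.coord R n).
Implicit Types (x y : 'rV[R]_n) (s t r d e : R) (X Y : R -> 'rV[R]_n) (u : R -> 'rV[R]_m)
  (v : 'rV[R]_m) (p q z : XT).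
Variable P : optctrl R n m.
Hypotheses (hP : MLip P) (hunc : state_unconstrained P).
Let f := oc_f P.
Let U := oc_U P.
Let T := oc_T P.
Variable V : XT -> \bar R.
Hypothesis hV : is_value_function P V.
Variable J : XT -> R.
Hypothesis cJ : continuous J.
Hypothesis Jd : forall (e z : XT), derivable J z e.
Hypothesis Jc : forall e : XT, continuous ('D_e J).
Variable Omega : set 'rV[R]_n.
Hypothesis oOmega : open Omega.
Let O : set XT := Omega `*` [set t | 0 < t < T].
Variables (v0 : XT -> R) (w : option 'I_n -> XT -> R) (N0 : R) (N : option 'I_n -> R).
Hypothesis hw : forall j, weak_derivative O (dir j) v0 (w j).
Hypothesis N_ge0 : forall j, 0 <= N j.
Hypothesis hN : forall j, {ae mu, forall o, O (coord o) -> `|w j (coord o)| <= N j}.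
Hypothesis hN0 : {ae mu, forall o, O (coord o) -> `|v0 (coord o)| <= N0}.
Hypothesis hv0 : {ae mu, forall o, O (coord o) -> V (coord o) = (J (coord o) - v0 (coord o))%:E}.
Variable F : 'I_n -> R.
Hypothesis F_ge0 : forall i, 0 <= F i.
Hypothesis hF : forall i x v, Omega x -> U v -> `|f (x, v) 0 i| <= F i.

Let tr := trace Omega T v0.
Definition rate : R := N None + \sum_(i < n) N (Some i) * F i.

Let T0 : 0 < T. Proof. exact: oc_T_gt0. Qed.

Lemma rate_ge0 : 0 <= rate.
Proof. by rewrite addr_ge0// sumr_ge0// => i _; rewrite mulr_ge0. Qed.

Lemma fbox_in_box d q z : fbox d q z -> in_box q d z.
Proof.
move=> [h /andP[h1 h2]]; split => //; rewrite ger0_norm; lra.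
Qed.

Lemma continuous_in_box p e : 0 < e -> exists2 d : R, 0 < d & forall z, in_box p d z ->
  `|J z - J p| <= e.
Proof.
move=> e0; have /cvgrPdist_le/(_ _ e0) := @cJ p.
move=> /nbhs_ballP[d /= d0]; rewrite -ball_normE => hd.
exists (d / 2); first by rewrite divr_gt0.
move=> z hz; rewrite distrC; apply: hd => /=.
apply: le_lt_trans (in_box_norm _ hz) _; first by rewrite divr_ge0// ltW.
by rewrite ltr_pdivrMr// ltr_pMr// ltr1n.
Qed.

Lemma rV_dist_le x y d : 0 <= d -> (forall i, `|y 0 i - x 0 i| <= d) -> `|y - x| <= d.
Proof. by move=> d0 h; apply: rV_norm_le => // i; rewrite !mxE. Qed.

(* Restarting a nearby state with the same input costs almost the same, so V is upper
   semicontinuous forward in time. *)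
Lemma value_ge_trace x t : Omega x -> 0 <= t < T -> ((J (x, t) - tr (x, t))%:E <= V (x, t))%E.
Proof.
move=> Ox /andP[t0 tT]; have tT' := ltW tT.
apply: (value_ge hP hunc hV) => // u X iu tX.
have Uu := iu.1.
have [r [M1 [r0 M10 hr lX]]] := traj_bounded_lip (oc_fbnd hP hunc) Uu tX.
have Xt : X t = x by case: tX.
have [C [C0 hC]] := traj_near (oc_flip hP hunc) (oc_fbnd hP hunc) tT' Uu iu.2 tX.
have [Kc Kc0 hKc] := oc_clip hP hunc (r + 1).
have [Kg Kg0 hKg] := oc_glip hP hunc (r + 1).
have [mX [Mc Mc0 hMc]] := running_measurable_bounded hP hunc t0 tT' iu tX.
suff : J (x, t) - costR P t u X <= tr (x, t) by rewrite /costR; lra.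
apply/ler_addgt0Pr => e e0.
have e20 : 0 < e / 2 by rewrite divr_gt0.
have [d1 d10 hd1] := continuous_in_box (x, t) e20.
(* A restart within a forward box of size d lies within (1 + M1) d of [X], so [E * d] bounds the
   deviation of the restarted trajectory. [Q] collects the cost of this deviation and, through [Mc],
   the running cost before the restart. *)
pose E := C * (1 + M1).
have E0 : 0 <= E by rewrite mulr_ge0// addr_ge0.
pose Q := (Kc * T + Kg) * E + Mc.
have Q0 : 0 <= Q by rewrite addr_ge0// mulr_ge0// addr_ge0// mulr_ge0// ltW.
have [d2 d20 [d21 hQ2]] := small_factor d10 Q0 e20.
have [d d0 [dd2 hE]] := small_factor d20 E0 (ltr01 : (0 : R) < 1).
have hQ : Q * d <= e / 2 by apply: le_trans hQ2; rewrite ler_wpM2l.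
suff : J (x, t) - costR P t u X - e <= tr (x, t) by lra.
have qT : 0 <= (x, t).2 < T by rewrite t0.
apply: (trace_ge hw hN0 oOmega _ qT d0) => //.
apply: ae_imply1 hv0 => o ho Oo fo; have := ho Oo.
move: (coord o) Oo fo => [y s] [/= Oy /andP[s0 sT]] fo Vs.
have [hy /= /andP[ts std]] := fo.
have sT' := ltW sT; have ts' := ltW ts.
have stT : t <= s <= T by rewrite ts'.
have hyX : `|y - X s| <= (1 + M1) * d.
  have -> : y - X s = (y - x) - (X s - X t) by rewrite Xt opprB addrA subrK.
  apply: le_trans (ler_normB _ _) _; rewrite mulrDl mul1r; apply: lerD.
    by apply: rV_dist_le => //; exact: ltW.
  apply: le_trans (lX _ _ (lexx t) ts' sT') _; rewrite ler_wpM2l//; lra.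
pose D := E * d.
have hCy : C * `|y - X s| <= D.
  by rewrite /D /E -mulrA ler_wpM2l.
have D1 : D <= 1 by [].
have D0 : 0 <= D by rewrite mulr_ge0// ltW.
have [Y tY hY] := hC s y stT (le_trans hCy D1).
have hYD (q : R) : s <= q <= T -> `|Y q - X q| <= D by move=> /hY /le_trans; apply.
have ius := input_sub ts' (lexx T) iu.
have tXs := traj_sub ts' (lexx T) tX.
have subT (q : R) : s <= q <= T -> t <= q <= T by move=> /andP[h ->]; rewrite (le_trans ts').
have hX1 (q : R) : s <= q <= T -> `|X q| <= r + 1 by move=> /subT/hr; lra.
have hY1 (q : R) : s <= q <= T -> `|Y q| <= r + 1.
  move=> qT'; have := ler_normD (Y q - X q) (X q); rewrite subrK.
  have := hYD q qT'; have := hr q (subT q qT'); lra.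
have [mYs [My My0 hMy]] := running_measurable_bounded hP hunc (ltW s0) sT' ius tY.
have mXs : measurable_fun `[s, T] (running P X u).
  by apply: measurable_funS mX => // q /=; rewrite !in_itv/=; exact: subT.
have h1 : `|prim s (running P Y u) T - prim s (running P X u) T| <= Kc * D * (T - s).
  apply: (@prim_dist _ _ _ _ (My + Mc)) => //.
  - by move=> q qT'; have := hMy q qT'; lra.
  - by move=> q /subT qT'; have := hMc q qT'; lra.
  - move=> q qT'; have UuT := Uu _ (subT q qT').
    have q0T : 0 <= q <= T by case/andP: qT' => h ->; rewrite (le_trans _ h)// ltW.
    apply: le_trans (hKc _ _ _ _ _ _ (hY1 _ qT') (hX1 _ qT') UuT UuT q0T q0T) _.
    by rewrite !subrr !normr0 !addr0 ler_wpM2l//; exact: hYD.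
have TT : s <= T <= T by rewrite sT' lexx.
have h2 : `|oc_g P (Y T) - oc_g P (X T)| <= Kg * D.
  by apply: le_trans (hKg _ _ (hY1 _ TT) (hX1 _ TT)) _; rewrite ler_wpM2l//; exact: hYD.
have h3 : `|prim t (running P X u) s| <= Mc * d.
  apply: (@le_trans _ _ (Mc * (s - t))).
    apply: prim_norm_le => //.
      by apply: measurable_funS mX => // q /=; rewrite !in_itv/= => /andP[-> h]; exact: le_trans sT'.
    by move=> q /andP[tq qs]; apply: hMc; rewrite tq (le_trans qs).
  by rewrite ler_wpM2l//; lra.
have h4 : Kc * D * (T - s) <= Kc * D * T.
  by apply: ler_wpM2l; [exact: mulr_ge0|rewrite gerBl ltW].
have hQE : Q * d = Kc * D * T + Kg * D + Mc * d by rewrite /Q /D; ring.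
have := value_le hP hunc hV (ltW s0) sT' ius tY.
rewrite Vs lee_fin => h5.
have h6 := hd1 (y, s); have h7 : in_box (x, t) d1 (y, s).
  have [a b] := fbox_in_box fo; split => [i|]; first by apply: le_trans (a i) _; lra.
  by apply: le_trans b _; lra.
have {}h6 := h6 h7.
have := traj_costR_split hP hunc t0 ts' sT' iu tX.
move: h1 h2 h3 h5 h6; rewrite /costR !ler_norml => /andP[? ?] /andP[? ?] /andP[? ?] ? /andP[? ?] ?.
lra.
Qed.

(** Over a time b - a, coordinate i moves by at most F i (b - a) and time by b - a; weighted by the
    [N j] these sum to the rate. The bound on the trace is symmetric in its two points, hence both
    directions. *)
Lemma trace_along_le (c : 'rV[R]_n) rho a b X u : 0 <= a -> a <= b -> b < T ->
  rbox rho c `<=` Omega -> (forall s, a <= s <= b -> forall i, `|X s 0 i - c 0 i| < rho) ->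
  (forall s, a <= s <= b -> U (u s)) -> traj f a b (X a) u X ->
  tr (X b, b) <= tr (X a, a) + rate * (b - a) /\ tr (X a, a) <= tr (X b, b) + rate * (b - a).
Proof.
move=> a0 ab bT cO hX Uu [_ acX dX].
have inO s : a <= s <= b -> Omega (X s) by move=> sab; apply: cO => i; exact/ltW/hX.
have key : \sum_j N j * `|crd j (X b, b) - crd j (X a, a)| <= rate * (b - a).
  rewrite sum_option /= ger0_norm ?subr_ge0// /rate mulrDl lerD2l mulr_suml.
  apply: ler_sum => i _; rewrite -mulrA ler_wpM2l//.
  apply: (@ac_norm_le _ a b (F i) (fun s => X s 0 i) (fun s => f (X s, u s) 0 i)) => //.
    exact: ac_coord.
  apply: ae_imply1 dX => s h sab; split; first by have /is_derive_rV := h sab.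
  by apply: hF; [exact: inO|exact: Uu].
have aab : a <= a <= b by rewrite lexx.
have bab : a <= b <= b by rewrite lexx ab.
have aT : 0 <= a < T by rewrite a0 (le_lt_trans ab).
have bT' : 0 <= b < T by rewrite bT (le_trans a0).
split.
  apply: le_trans (trace_lip hw N_ge0 hN hN0 oOmega (q := (X a, a)) (q' := (X b, b)) cO
     (hX _ aab) (hX _ bab) aT bT') _.
  by rewrite lerD2l.
apply: le_trans (trace_lip hw N_ge0 hN hN0 oOmega (q := (X b, b)) (q' := (X a, a)) cO
   (hX _ bab) (hX _ aab) bT' aT) _.
rewrite lerD2l; apply: le_trans key.
by apply: ler_sum => j _; rewrite distrC.
Qed.

Definition full_hamiltonian z v : R := 'D_dt J z + hamiltonian P J z.1 z.2 v.

(** The radius does not depend on [v]: the competing trajectories through nearby points use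
    arbitrary controls. *)
Lemma full_hamiltonian_near p e : 0 <= p.2 <= T -> 0 < e -> exists2 rho : R, 0 < rho & forall z,
  in_box p rho z -> 0 <= z.2 <= T -> forall v, U v -> `|full_hamiltonian z v - full_hamiltonian p v| <= e.
Proof.
move=> pT e0; pose r := `|p.1| + 1.
have [Kc Kc0 hKc] := oc_clip hP hunc r.
have [Kf Kf0 hKf] := oc_flip hP hunc r.
have [M M0 hM] := oc_fbnd hP hunc r.
pose S := \sum_(i < n) `|'D_(dx i) J p|.
have S0 : 0 <= S by exact: sumr_ge0.
have e20 : 0 < e / 2 by rewrite divr_gt0.
have nM0 : 0 <= 1 + n%:R * M by rewrite addr_ge0// mulr_ge0.
have [eta eta0 [_ heta]] := small_factor (ltr01 : (0 : R) < 1) nM0 e20.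
have [rho1 rho10 hrho1] := c1_near Jc p eta0.
have m0 : 0 < Num.min rho1 1 by rewrite lt_min rho10 ltr01.
have K0 : 0 <= Kc * 2 + S * Kf by rewrite addr_ge0// mulr_ge0.
have [rho rho0 [rho_le hrho]] := small_factor m0 K0 e20.
move: rho_le; rewrite le_min => /andP[rho_1 rho_2].
exists rho => // z hz zT v Uv.
have [hz1 hz2] := hz.
have [hD1 hD2] : (forall i, `|'D_(dx i) J z - 'D_(dx i) J p| <= eta) /\ `|'D_dt J z - 'D_dt J p| <= eta.
  apply: hrho1; split => [i|]; [exact: le_trans (hz1 i) rho_1|exact: le_trans hz2 rho_1].
have hzp : `|z.1 - p.1| <= rho by apply: rV_dist_le => //; exact: ltW.
have zr : `|z.1| <= r.
  by have := ler_normD (z.1 - p.1) p.1; rewrite subrK /r; lra.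
have pr : `|p.1| <= r by rewrite /r lerDl.
have hc := hKc _ _ _ _ _ _ zr pr Uv Uv zT pT.
rewrite subrr normr0 addr0 in hc.
have hc' : `|oc_c P (z.1, v, z.2) - oc_c P (p.1, v, p.2)| <= Kc * 2 * rho.
  by apply: le_trans hc _; rewrite -mulrA ler_wpM2l//; lra.
have hf := hKf _ _ _ _ zr pr Uv Uv; rewrite subrr normr0 addr0 in hf.
have hf' i : `|f (z.1, v) 0 i - f (p.1, v) 0 i| <= Kf * rho.
  apply: le_trans (rV_norm_coordB _ _ _) _; apply: le_trans hf _; rewrite ler_wpM2l//.
have hs : `|\sum_(i < n) 'D_(dx i) J z * f (z.1, v) 0 i -
     \sum_(i < n) 'D_(dx i) J p * f (p.1, v) 0 i| <= n%:R * M * eta + S * Kf * rho.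
  rewrite -sumrB.
  apply: le_trans (ler_norm_sum _ _ _) _.
  apply: (@le_trans _ _ (\sum_(i < n) (M * eta + `|'D_(dx i) J p| * (Kf * rho)))).
    apply: ler_sum => i _.
    have -> : 'D_(dx i) J z * f (z.1, v) 0 i - 'D_(dx i) J p * f (p.1, v) 0 i =
      f (z.1, v) 0 i * ('D_(dx i) J z - 'D_(dx i) J p) +
      'D_(dx i) J p * (f (z.1, v) 0 i - f (p.1, v) 0 i) by ring.
    apply: le_trans (ler_normD _ _) _; rewrite !normrM; apply: lerD; last by rewrite ler_wpM2l.
    apply: ler_pM => //; apply: le_trans (rV_norm_coord _ _) _; exact: hM.
  rewrite big_split/= sumr_const card_ord -mulr_suml -/S -mulrA mulr_natl mulrA.
  by [].
rewrite /full_hamiltonian /hamiltonian -!surjective_pairing -/f.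
set A := \sum_(i < n) _ in hs *; set B := \sum_(i < n) _ in hs *.
have -> : 'D_dt J z + (oc_c P (z.1, v, z.2) + A) - ('D_dt J p + (oc_c P (p.1, v, p.2) + B)) =
  ('D_dt J z - 'D_dt J p) + ((oc_c P (z.1, v, z.2) - oc_c P (p.1, v, p.2)) + (A - B)) by ring.
apply: le_trans (ler_normD _ _) _.
have := ler_normD (oc_c P (z.1, v, z.2) - oc_c P (p.1, v, p.2)) (A - B).
have : (1 + n%:R * M) * eta = eta + n%:R * M * eta by ring.
have : (Kc * 2 + S * Kf) * rho = Kc * 2 * rho + S * Kf * rho by ring.
lra.
Qed.

Let tle := @trace_le _ _ _ _ _ _ _ hw hN0 oOmega.
Let tlip := @trace_lip _ _ _ _ _ _ _ _ hw N_ge0 hN hN0 oOmega.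

(* If the minimized Hamiltonian of J exceeded [rate] at a point, dynamic programming over a
   short time would push J - V strictly below its own averages nearby. *)
Lemma full_hamiltonian_le x t v : Omega x -> 0 <= t < T -> U v ->
  (forall v', U v' -> hamiltonian P J x t v <= hamiltonian P J x t v') ->
  full_hamiltonian (x, t) v <= rate.
Proof.
move=> Ox /andP[t0 tT] Uv vmin; rewrite leNgt; apply/negP => hlt.
(* One third of the excess is lost by moving to nearby points, one third to the variation of the
   trace over the starting box, and one third remains for the contradiction. *)
pose eps := (full_hamiltonian (x, t) v - rate) / 3.
have eps0 : 0 < eps by rewrite divr_gt0// subr_gt0.
have ptT : 0 <= (x, t).2 <= T by rewrite t0 ltW.
have [rho1 rho10 hrho1] := full_hamiltonian_near ptT eps0.
have [rho2 rho20 hrho2] := open_rbox oOmega Ox.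
pose rho := Num.min (Num.min rho1 rho2) 1.
have rho0 : 0 < rho by rewrite !lt_min rho10 rho20 ltr01.
have rho_1 : rho <= rho1 by rewrite !ge_min lexx.
have rho_2 : rho <= rho2 by rewrite !ge_min lexx orbT.
have rho_3 : rho <= 1 by rewrite !ge_min lexx orbT.
have hH z : in_box (x, t) rho z -> 0 <= z.2 <= T -> forall v', U v' -> rate + 2 * eps <= full_hamiltonian z v'.
  move=> [hz1 hz2] zT v' Uv'.
  have hz : in_box (x, t) rho1 z by split => [i|]; [apply: le_trans (hz1 i) _|apply: le_trans hz2 _].
  have := hrho1 z hz zT v' Uv'; rewrite ler_norml => /andP[h _].
  have h2 : full_hamiltonian (x, t) v <= full_hamiltonian (x, t) v' by rewrite /full_hamiltonian/= lerD2l; exact: vmin.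
  have h3 : 3 * eps = full_hamiltonian (x, t) v - rate by rewrite /eps mulrC divfK.
  move: h h2 h3; set A := full_hamiltonian z v'; set B := full_hamiltonian (x, t) v;
    set C := full_hamiltonian (x, t) v'; lra.
have cO : rbox rho x `<=` Omega.
  by move=> y hy; apply: hrho2 => i; apply: le_trans (hy i) _.
have [M M0 hM] := oc_fbnd hP hunc (`|x| + 1).
have Tt0 : 0 < (T - t) / 4 by rewrite divr_gt0// subr_gt0.
have r40 : 0 < Num.min (rho / 4) ((T - t) / 4) by rewrite lt_min Tt0 divr_gt0.
have r80 : 0 < rho / 8 by rewrite divr_gt0.
(* Over a time h trajectories move by at most rho / 8, half of the radius rho / 4 given to
   [traj_short]. *)
have [h h0 []] := small_factor r40 M0 r80.
rewrite le_min => /andP[h_1 h_2] h_3.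
have sN0 : 0 <= \sum_j N j by exact: sumr_ge0.
have eh0 : 0 < eps * h by rewrite mulr_gt0.
(* The starting box is chosen after [h], so that the trace varies by at most [eps * h] from its base
   point. *)
have [d d0 []] := small_factor r40 sN0 eh0.
rewrite le_min => /andP[d_1 d_2] d_3.
have d_rho : d < rho by lra.
(* Since V = J - v0 almost everywhere, this puts v0 below tr (x, t) - eps h on the whole forward
   box, which [trace_le] turns into the same bound for tr (x, t) itself. *)
have key q : O q -> fbox d (x, t) q -> ((J q - (tr (x, t) - eps * h))%:E <= V q)%E.
  move: q => [y s] [/= Oy /andP[s0 sT]] hq.
  have [/= hyx /andP[ts std]] := hq.
  have sT' := ltW sT; have s0' := ltW s0.
  have shT : s + h < T by lra.
  apply: (value_ge hP hunc hV) => // u X iu tX.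
  have Uu := iu.1.
  have Xs : X s = y by case: tX.
  have ssh : s <= s + h by rewrite lerDl ltW.
  have tX1 : traj f s (s + h) y u X.
    by rewrite -Xs; apply: (traj_sub (lexx s) (ltW shT) tX).
  have Uu1 r : s <= r <= s + h -> U (u r).
    by move=> /andP[h1 h2]; apply: Uu; rewrite h1 (le_trans h2)// ltW.
  have yx : `|y - x| <= d by apply: rV_dist_le => //; exact: ltW.
  have r4 : 0 < rho / 4 by rewrite divr_gt0.
  have lX : lip_rV M s (s + h) X.
    apply: (traj_short (oc_fbnd hP hunc) ssh M0 r4 Uu1 _ tX1); last first.
      by rewrite addrAC subrr add0r; apply: le_trans h_3 _; lra.
    move=> z v' hz Uv'; apply: hM => //.
    have := ler_normD (z - y) y; rewrite subrK.
    have := ler_normD (y - x) x; rewrite subrK; lra.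
  have hXy r : s <= r <= s + h -> `|X r - y| <= rho / 8.
    move=> /andP[sr rsh]; rewrite -Xs; apply: le_trans (lX _ _ (lexx s) sr rsh) _.
    apply: le_trans h_3; rewrite ler_wpM2l//; lra.
  have hXx r : s <= r <= s + h -> forall i, `|X r 0 i - x 0 i| < rho.
    move=> rsh i; apply: le_lt_trans (rV_norm_coordB _ _ _) _.
    have -> : X r - x = (X r - y) + (y - x) by rewrite addrA subrK.
    apply: le_lt_trans (ler_normD _ _) _; have := hXy r rsh; lra.
  have inb r : s <= r <= s + h -> in_box (x, t) rho (X r, r).
    move=> rsh; split => [i|] /=; first exact/ltW/hXx.
    case/andP: rsh => sr rsh; rewrite ger0_norm; lra.
  have ius : input U s (s + h) u by exact: input_sub (lexx s) (ltW shT) iu.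
  have [mX [Mc Mc0 hMc]] := running_measurable_bounded hP hunc s0' sT' iu tX.
  have subT r : s <= r <= s + h -> s <= r <= T.
    by move=> /andP[-> rh]; rewrite (le_trans rh)// ltW.
  have grow : (rate + 2 * eps) * (s + h - s) <=
      prim s (running P X u) (s + h) + J (X (s + h), s + h) - J (X s, s).
    apply: (curve_growth_ge Jd Jc ssh M0 lX (G := fun r => f (X r, u r)) (N := Mc)) => //.
    - by case: tX1.
    - by apply: measurable_funS mX => // r /=; rewrite !in_itv/=; exact: subT.
    - by move=> r /subT; exact: hMc.
    apply: aeW => r rsh.
    have := hH _ (inb r rsh) _ _ (Uu1 r rsh).
    rewrite /= (_ : (0 <= r <= T) = true); last first.
      by case/andP: rsh => sr rsh; rewrite (le_trans s0' sr) (le_trans rsh)// ltW.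
    move=> /(_ isT) /le_trans; apply.
    rewrite /full_hamiltonian /hamiltonian /running /=; set A := 'D_dt J _; set B := oc_c P _.
    by rewrite addrA [B + A]addrC.
  have [tr1 _] := trace_along_le s0' ssh shT cO hXx Uu1 (traj_sub (lexx s) (lexx _) tX1).
  have tr2 : tr (y, s) <= tr (x, t) + eps * h.
    have c1 i : `|x 0 i - x 0 i| < rho by rewrite subrr normr0.
    have c2 i : `|y 0 i - x 0 i| < rho := le_lt_trans (hyx i) d_rho.
    have c3 : 0 <= t < T by rewrite t0.
    have c4 : 0 <= s < T by rewrite s0'.
    apply: le_trans (@tlip x rho (x, t) (y, s) cO c1 c2 c3 c4) _.
    rewrite lerD2l; apply: le_trans d_3; rewrite mulr_suml; apply: ler_sum => j _.
    rewrite ler_wpM2l//; case: j => [i|] /=; first exact: hyx.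
    by rewrite ger0_norm ?subr_ge0 ?(ltW ts)// lerBlDl ltW.
  have OXh : Omega (X (s + h)).
    by apply: cO => i; apply: ltW; apply: hXx; rewrite ssh lexx.
  have shT2 : 0 <= s + h < T by rewrite shT addr_ge0// ltW.
  (* The endpoint depends on an arbitrary input and may fall in the null set where V is not J - v0,
     so the inequality valid everywhere is used. *)
  have v1 := value_ge_trace OXh shT2.
  have tX2 := traj_sub ssh (lexx T) tX.
  have sh0 : 0 <= s + h by case/andP: shT2.
  have v2 := value_le hP hunc hV sh0 (ltW shT) (input_sub ssh (lexx T) iu) tX2.
  have := le_trans v1 v2; rewrite lee_fin => v3.
  rewrite (traj_costR_split hP hunc s0' ssh (ltW shT) iu tX).
  have e1 : (rate + 2 * eps) * (s + h - s) = rate * h + 2 * (eps * h) by ring.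
  have e2 : rate * (s + h - s) = rate * h by ring.
  rewrite Xs in grow tr1.
  rewrite e1 in grow; rewrite -/rate e2 in tr1.
  exact: dynamic_programming_arith grow tr1 tr2 v3.
have pT : 0 <= (x, t).2 < T by rewrite t0.
have H : tr (x, t) <= tr (x, t) - eps * h.
  apply: (tle (q := (x, t)) Ox pT d0).
  apply: ae_imply1 hv0 => o ho Oo fo; have := key _ Oo fo; rewrite (ho Oo) lee_fin.
  by rewrite lerD2l lerN2.
by move: H; rewrite leNgt gtrBl eh0.
Qed.

Variables (x0 : 'rV[R]_n) (u0 : R -> 'rV[R]_m) (X : R -> 'rV[R]_n).
Hypotheses (iu : input U 0 T u0) (tX : traj f 0 T x0 u0 X).
Hypothesis XO : forall s, 0 <= s <= T -> Omega (X s).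

(** The boxes contained in [Omega] change along the trajectory, so the estimate is made near each
    time and then integrated by [slope_le_everywhere]. *)
Lemma trace_start s : 0 <= s < T -> tr (X 0, 0) <= tr (X s, s) + rate * s.
Proof.
move=> /andP[s0 sT].
have [r [M [r0 M0 hr lX]]] := traj_bounded_lip (oc_fbnd hP hunc) iu.1 tX.
have M1 : 0 < M + 1 by rewrite ltr_wpDl.
have main : - tr (X s, s) - - tr (X 0, 0) <= rate * (s - 0).
  apply: (slope_le_everywhere (g := fun s => - tr (X s, s)) s0) => a /andP[a0 as_] e e0.
  have aT := le_lt_trans as_ sT.
  have [rho rho0 cO] := open_rbox oOmega (XO (introT andP (conj a0 (ltW aT)))).
  have step b c : 0 <= b -> b <= c -> c < T -> (b = a \/ c = a) -> c - b < rho / (M + 1) ->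
      tr (X b, b) <= tr (X c, c) + rate * (c - b).
    move=> b0 bc cT bca hbc.
    have b2 k : b <= k <= c -> forall i, `|X k 0 i - X a 0 i| < rho.
      move=> /andP[bk kc] i; apply: le_lt_trans (rV_norm_coordB _ _ _) _.
      have kT : k <= T := le_trans kc (ltW cT).
      have k0 : 0 <= k := le_trans b0 bk.
      apply: (@le_lt_trans _ _ ((M + 1) * (c - b))); last by rewrite mulrC -ltr_pdivlMr.
      apply: (@le_trans _ _ (M * (c - b))); last by rewrite ler_wpM2r ?subr_ge0// lerDl.
      case: bca => E; rewrite -E.
        by apply: le_trans (lX _ _ b0 bk kT) _; rewrite ler_wpM2l// lerB.
      by rewrite distrC; apply: le_trans (lX _ _ k0 kc (ltW cT)) _; rewrite ler_wpM2l// lerB.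
    have Ub k : b <= k <= c -> U (u0 k).
      by move=> /andP[bk kc]; apply: iu.1; rewrite (le_trans b0 bk) (le_trans kc (ltW cT)).
    by have [] := trace_along_le b0 bc cT cO b2 Ub (traj_sub b0 (ltW cT) tX).
  have nb : \forall b \near a, `|b - a| < rho / (M + 1).
    have p : 0 < rho / (M + 1) by rewrite divr_gt0.
    by apply/nbhs_ballP; exists (rho / (M + 1)) => //= b; rewrite /ball/= distrC.
  apply: filterS nb => b hb /andP[b0 bs]; have bT := le_lt_trans bs sT.
  split => ab.
    have hab : b - a < rho / (M + 1) := le_lt_trans (ler_norm _) hb.
    have h2 : 0 <= e * (b - a) by rewrite mulr_ge0 ?subr_ge0// ltW.
    exact: slope_arith (step a b a0 ab bT (or_introl erefl) hab) h2.
  have hab : a - b < rho / (M + 1) by apply: le_lt_trans hb; rewrite distrC; exact: ler_norm.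
  have h2 : 0 <= e * (a - b) by rewrite mulr_ge0 ?subr_ge0// ltW.
  exact: slope_arith (step b a b0 ab aT (or_intror erefl) hab) h2.
exact: growth_arith main.
Qed.

(** At time T - tau little running cost can still accrue and the state can hardly move, whatever the
    input. Thus V is at least g (X T) minus a small error on the forward box, while J is close to
    its value at (X T, T). *)
Lemma trace_end e : 0 < e -> exists2 s, 0 <= s < T &
  tr (X s, s) <= J (X T, T) - oc_g P (X T) + e.
Proof.
move=> e0.
have [r [M1 [r0 M10 hr lX]]] := traj_bounded_lip (oc_fbnd hP hunc) iu.1 tX.
(* One unit for the distance of the starting point from [X], one for the motion from there to time
   T. *)
have [M M0 hM] := oc_fbnd hP hunc (r + 2).
have [Mc Mc0 hMc] := oc_cbnd hP hunc (r + 2).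
have [Kg Kg0 hKg] := oc_glip hP hunc (r + 2).
have e20 : 0 < e / 2 by rewrite divr_gt0.
have [dJ dJ0 hdJ] := continuous_in_box (X T, T) e20.
have half0 : 0 < 2^-1 :> R by rewrite invr_gt0.
have m0 : 0 < Num.min 1 T by rewrite lt_min ltr01 T0.
(* Three successive reductions of the remaining time: [t1] keeps trajectories within distance 1 of
   their start, [t2] keeps the box where J varies by at most e / 2, and [tau] makes the change of
   cost at most e / 2. *)
have [t1 t10 [t11 hMt1]] := small_factor m0 M0 half0.
have M11 : 0 <= 1 + M1 by rewrite addr_ge0.
have [t2 t20 [t21 hJt2]] := small_factor t10 M11 dJ0.
have Q0 : 0 <= Mc + Kg * (M + 1 + M1) by rewrite addr_ge0// mulr_ge0// !addr_ge0.
have [tau tau0 [tau2 hQ]] := small_factor t20 Q0 e20.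
have tau1 := le_trans tau2 t21.
have := le_trans tau1 t11; rewrite le_min => /andP[tau_1 tauT].
have hM' : M * tau <= 2^-1 by apply: le_trans hMt1; rewrite ler_wpM2l.
have hJ' : (1 + M1) * tau <= dJ by apply: le_trans hJt2; rewrite ler_wpM2l.
have s0 : 0 <= T - tau by rewrite subr_ge0.
have sT : T - tau < T by rewrite gtrBl.
exists (T - tau); first by rewrite s0.
have pT : 0 <= (X (T - tau), T - tau).2 < T by rewrite s0.
have Op : Omega (X (T - tau)) by apply: XO; rewrite s0 ltW.
apply: (tle (q := (X (T - tau), T - tau)) Op pT tau0).
have key q : O q -> fbox tau (X (T - tau), T - tau) q ->
    ((oc_g P (X T) - e / 2)%:E <= V q)%E.
  move: q => [y s] [/= Oy /andP[s0' sT']] [/= hyX /andP[hs _]].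
  apply: (value_ge hP hunc hV) => [||u Y iuY tY]; [exact: ltW|exact: ltW|].
  have sT2 := ltW sT'.
  have Ts : T - s <= tau by rewrite lerBlDr -lerBlDl ltW.
  have Ts0 : 0 <= T - s by rewrite subr_ge0.
  have yX : `|y - X (T - tau)| <= tau by apply: rV_dist_le => //; exact: ltW.
  have yr : `|y| <= r + 1.
    have := ler_normD (y - X (T - tau)) (X (T - tau)); rewrite subrK => /le_trans; apply.
    rewrite addrC; apply: lerD; first by apply: hr; rewrite s0 ltW.
    exact: le_trans yX tau_1.
  have Ys : Y s = y by case: tY.
  have MTs : M * (T - s) <= 2^-1 by apply: le_trans hM'; rewrite ler_wpM2l.
  have lY : lip_rV M s T Y.
    apply: (traj_short (oc_fbnd hP hunc) sT2 M0 (ltr01 : (0 : R) < 1) iuY.1 _ tY).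
      move=> z v hz Uv; apply: hM => //.
      have := ler_normD (z - y) y; rewrite subrK => /le_trans; apply.
      by rewrite addrC (_ : r + 2 = r + 1 + 1)//; [exact: lerD|ring].
    by rewrite div1r.
  have hYy k : s <= k <= T -> `|Y k - y| <= M * tau.
    move=> /andP[sk kT]; rewrite -Ys; apply: le_trans (lY _ _ (lexx s) sk kT) _.
    by rewrite ler_wpM2l//; apply: le_trans Ts; rewrite lerB.
  have hYr k : s <= k <= T -> `|Y k| <= r + 2.
    move=> hk; have := ler_normD (Y k - y) y; rewrite subrK => /le_trans; apply.
    rewrite addrC (_ : r + 2 = r + 1 + 1); last by ring.
    apply: lerD => //; apply: le_trans (hYy k hk) _; apply: le_trans hM' _.
    by rewrite invf_le1// ler1n.
  have [mY _] := running_measurable_bounded hP hunc (ltW s0') sT2 iuY tY.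
  have h1 : `|prim s (running P Y u) T| <= Mc * tau.
    apply: (@le_trans _ _ (Mc * (T - s))); last by rewrite ler_wpM2l.
    apply: prim_norm_le => // k hk; apply: hMc; [exact: hYr|exact: iuY.1|].
    by case/andP: hk => sk ->; rewrite (le_trans (ltW s0') sk).
  have TT : s <= T <= T by rewrite sT2 lexx.
  have XTr : `|X T| <= r + 2.
    by apply: (le_trans (hr T _)); [rewrite lexx ltW|rewrite lerDl].
  have h2 : `|Y T - X T| <= (M + 1 + M1) * tau.
    have -> : Y T - X T = (Y T - y) + (y - X (T - tau)) - (X T - X (T - tau)).
      by rewrite addrA subrK opprB addrA subrK.
    apply: le_trans (ler_normB _ _) _; rewrite !mulrDl mul1r; apply: lerD.
      by apply: le_trans (ler_normD _ _) _; apply: lerD => //; exact: hYy.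
    apply: le_trans (lX _ _ s0 (ltW sT) (lexx T)) _.
    by rewrite opprB addrCA subrr addr0.
  have h3 := le_trans (hKg _ _ (hYr T TT) XTr) (ler_wpM2l Kg0 h2).
  rewrite /costR; move: h1 h3 hQ; rewrite !ler_norml.
  set A := prim _ _ _; set B := oc_g P (Y T); set C := oc_g P (X T).
  move=> /andP[h1 _] /andP[h3 _] hQ'.
  exact: terminal_cost_arith h1 h3 hQ'.
apply: ae_imply1 hv0 => o ho Oo fo; have := key _ Oo fo; rewrite (ho Oo) lee_fin.
have inb : in_box (X T, T) dJ (coord o).
  move: (coord o) Oo fo => [y s] [/= Oy /andP[s0' sT']] [/= hyX /andP[hs _]].
  split => [i|] /=.
    apply: le_trans hJ'; rewrite mulrDl mul1r.
    have -> : y 0 i - X T 0 i = (y 0 i - X (T - tau) 0 i) - (X T 0 i - X (T - tau) 0 i) by ring.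
    apply: le_trans (ler_normB _ _) _; apply: lerD => //.
    apply: le_trans (rV_norm_coordB _ _ _) _; apply: le_trans (lX _ _ s0 (ltW sT) (lexx T)) _.
    by rewrite opprB addrCA subrr addr0.
  rewrite distrC ger0_norm ?subr_ge0 ?(ltW sT')//.
  apply: (@le_trans _ _ tau); first by rewrite lerBlDr -lerBlDl ltW.
  by apply: le_trans hJ'; rewrite mulrDl mul1r lerDl mulr_ge0// ltW.
have := hdJ _ inb; rewrite ler_norml => /andP[_].
set A := J _; set B := J _; set C := v0 _; set D := oc_g _ _.
exact: terminal_trace_arith.
Qed.

Variable kJ : XT -> 'rV[R]_m.
Hypothesis hk : is_feedback P J kJ.
Hypothesis uk : {ae lebesgue_measure, forall t : R, 0 <= t <= T -> u0 t = kJ (X t, t)}.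

Lemma feedback_suboptimality :
  ((costR P 0%R u0 X - 2 * T * rate)%:E <= V (x0, 0%R))%E.
Proof.
have [r [M [r0 M0 hr lX]]] := traj_bounded_lip (oc_fbnd hP hunc) iu.1 tX.
have T0' := ltW T0.
have X0 : X 0 = x0 by case: tX.
have OT : 0 <= (0 : R) <= T by rewrite lexx T0'.
have Ox0 : Omega x0 by rewrite -X0; exact: XO.
have [mX [Mc Mc0 hMc]] := running_measurable_bounded hP hunc (lexx 0) T0' iu tX.
(* The pointwise bound on the Hamiltonian is available before T only; a single time is
   negligible. *)
have notT : {ae lebesgue_measure, forall t : R, t != T}.
  have : lebesgue_measure.-negligible [set T].
    by apply/negligibleP => //; rewrite /= lebesgue_measure_set1.
  by apply: negligibleS => t /= /negP; rewrite negbK => /eqP.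
have grow : prim 0 (running P X u0) T + J (X T, T) - J (X 0, 0) <= rate * (T - 0).
  apply: (curve_growth_le Jd Jc T0' M0 lX (G := fun r => f (X r, u0 r)) (N := Mc)) => //.
    by case: tX.
  apply: ae_imply2 uk notT => s us sT sT'; have us' := us sT'.
  have sT2 : 0 <= s < T by case/andP: sT' => -> h; rewrite lt_neqAle sT.
  have [Uk kmin] := hk (X s) sT'.
  have := full_hamiltonian_le (XO sT') sT2 Uk kmin.
  rewrite -us' /full_hamiltonian /hamiltonian /running /=.
  by rewrite addrA [oc_c P _ + 'D_dt J _]addrC.
have v1 := value_ge_trace Ox0 (introT andP (conj (lexx 0) T0)).
apply: le_trans v1; rewrite lee_fin.
apply/ler_addgt0Pr => e e0.
have [s sT hs] := trace_end e0.
have h1 := trace_start sT.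
have h2 : rate * s <= rate * T.
  by apply: ler_wpM2l; [exact: rate_ge0|case/andP: sT => _ /ltW].
rewrite subr0 in grow; rewrite X0 in h1 grow.
have E : 2 * T * rate = 2 * (rate * T) by ring.
rewrite E /costR; exact: suboptimality_arith grow hs h1 h2.
Qed.

End suboptimality.

(** * Weak derivatives on smaller sets and essential suprema *)

Section restriction.
Context {R : realType} {n : nat}.
Local Notation XT := ('rV[R]_n * R)%type.
Local Notation mu := (@leb_xt R n).
Local Notation coord := (@Defs.coord R n).
Implicit Types (O K : set XT) (psi v w : XT -> R).

Lemma derive_off_compact K psi (e : XT) : compact K -> (forall z, ~ K z -> psi z = 0) ->
  forall z, ~ K z -> 'D_e psi z = 0.
Proof.
move=> cK hpsi z nKz.
have oC : open (~` K) by apply: closed_openC; apply: compact_closed => //; exact: norm_hausdorff.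
have nz : \forall y \near z, cst 0 y = psi y.
  move: oC; rewrite openE => /(_ _ nKz); apply: filterS => y nKy.
  by rewrite hpsi.
by rewrite -(near_eq_derive _ nz) derive_cst.
Qed.

Lemma integral_subset_support O O' v psi : O' `<=` O -> (forall z, ~ O' z -> psi z = 0) ->
  (\int[mu]_(s in coord @^-1` O') (v (coord s) * psi (coord s))%:E =
   \int[mu]_(s in coord @^-1` O) (v (coord s) * psi (coord s))%:E)%E.
Proof.
move=> OO hpsi; rewrite [LHS]integral_mkcond [RHS]integral_mkcond.
apply: eq_integral => s _; rewrite !patchE.
have [h|h] := pselect (O' (coord s)); first by rewrite !mem_set//=; exact: OO.
rewrite (hpsi _ h) mulr0 [X in (if X then _ else _) = _](_ : _ = false) ?if_same//.
by apply/negbTE/negP; rewrite inE.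
Qed.

(** A test function on the smaller set is one on the larger, and both it and its derivative vanish
    off the compact support, so no integral changes. *)
Lemma weak_derivative_sub O O' (e : XT) v w : O' `<=` O ->
  weak_derivative O e v w -> weak_derivative O' e v w.
Proof.
move=> OO [lv lw h]; split.
- by move=> K cK KO; apply: lv => //; exact: subset_trans KO OO.
- by move=> K cK KO; apply: lw => //; exact: subset_trans KO OO.
move=> psi [Cpsi [K [cK KO hK]]].
have tpsi : test_function O psi.
  by split => //; exists K; split => //; exact: subset_trans KO OO.
rewrite (integral_subset_support v (psi := 'D_e psi) OO); last first.
  by move=> z nO; apply: (derive_off_compact e cK hK) => Kz; apply: nO; exact: KO.
rewrite (integral_subset_support w OO); last first.
  by move=> z nO; apply: hK => Kz; apply: nO; exact: KO.
exact: h.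
Qed.

(** A kernel has integral 1, which is impossible for the zero measure. This guarantees that an
    essential supremum of nonnegative values is nonnegative. *)
Lemma leb_xt_gt0 : (0 < mu setT)%E.
Proof.
rewrite lt0e measure_ge0 andbT; apply/eqP => m0.
have := @integral_kern R n 1 0 ltr01.
have mk := @measurable_kern R n 1 0.
rewrite null_set_integral//; last exact/measurable_EFinP.
by move=> /eqP; rewrite eqe eq_sym oner_eq0.
Qed.

Lemma ess_sup_on_ge0 (D : set XT) v : (0 <= ess_sup_on D v)%E.
Proof.
apply: ess_sup_gee; first exact: leb_xt_gt0.
by apply: nearW => s; rewrite patchE; case: ifP => //; rewrite lee_fin.
Qed.

Lemma ess_sup_on_le (D : set XT) v (N : R) : (ess_sup_on D v <= N%:E)%E ->
  {ae mu, forall s, D (coord s) -> `|v (coord s)| <= N}.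
Proof.
move=> h; have := @ess_sup_ge _ _ _ mu ((fun z => `|v (coord z)|%:E) \_ (coord @^-1` D)).
apply: ae_imply1 => s; rewrite patchE => hs Ds; move: hs; rewrite mem_set// => hs.
by rewrite -lee_fin; apply: le_trans hs h.
Qed.

End restriction.

(** * From suboptimality to the Sobolev bound *)

Section loss_bound.
Context {R : realType} {n m : nat}.
Local Notation XT := ('rV[R]_n * R)%type.
Local Notation mu := (@leb_xt R n).
Local Notation coord := (@Defs.coord R n).
Variables (P : optctrl R n m) (x0 : 'rV[R]_n) (V : XT -> \bar R) (J : XT -> R).
Variables (kJ : XT -> 'rV[R]_m) (uJ : R -> 'rV[R]_m) (X : R -> 'rV[R]_n).
Hypotheses (hP : MLip P) (hunc : state_unconstrained P) (hV : is_value_function P V).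
Hypotheses (hJ : Ck 2 J) (hkJ : is_feedback P J kJ).
Hypotheses (iu : input (oc_U P) 0 (oc_T P) uJ) (tX : traj (oc_f P) 0 (oc_T P) x0 uJ X).
Hypothesis uk : {ae lebesgue_measure, forall t : R, 0 <= t <= oc_T P -> uJ t = kJ (X t, t)}.

(** The norm is taken on [Omega] and the argument runs on [Omega'], where [f] may be bounded even if
    it is not on [Omega]. Of the final constant it keeps just the two inequalities used: 2 T and all
    2 T |f_i| are at most [C]. *)
Lemma loss_le_W1oo (Omega Omega' : set 'rV[R]_n) (C : R) : open Omega' -> Omega' `<=` Omega ->
  (forall s, 0 <= s <= oc_T P -> Omega' (X s)) -> 2 * oc_T P <= C ->
  (forall i x v, Omega' x -> oc_U P v -> 2 * oc_T P * `|oc_f P (x, v) 0 i| <= C) ->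
  (loss P x0 uJ <= C%:E * W1oo_norm Omega (oc_T P) (fun z => (J z)%:E - V z))%E.
Proof.
move=> oO' OO XO hC hCf.
set T := oc_T P in hC hCf *.
have T0 : 0 < T := oc_T_gt0 P.
have T20 : 0 < 2 * T by rewrite mulr_gt0.
have C0 : 0 < C by apply: lt_le_trans hC.
(* Dividing by [C] turns the bound by an infimum into a bound by each representative with its weak
   derivatives. *)
rewrite -lee_pdivrMl//; apply: le_ereal_inf_tmp => _ [v0 [vx [vt [hv hvx hvt ->]]]].
rewrite lee_pdivrMl//.
set D := Omega `*` `[0, T]%classic.
pose w j := if j is Some i then vx i else vt.
have hw j : weak_derivative (Omega `*` [set t : R | 0 < t < T]) (dir j) v0 (w j) by case: j.
have E0 v : (0 <= ess_sup_on D v)%E by exact: ess_sup_on_ge0.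
rewrite -/T -/D.
set A := ess_sup_on D v0; set B := (\sum_(i < n) ess_sup_on D (vx i))%E.
have B0 : (0 <= B)%E by apply: sume_ge0.
have [->|Afin] := eqVneq A +oo%E.
  by rewrite addye ?gt_eqF ?(lt_le_trans _ B0)// addye ?gt_eqF ?(lt_le_trans _ (E0 _))// gt0_muley ?lte_fin// leey.
have [Bfin|Bfin] := eqVneq B +oo%E.
  rewrite Bfin addey ?gt_eqF ?(lt_le_trans _ (E0 _))// addye ?gt_eqF ?(lt_le_trans _ (E0 _))//.
  by rewrite gt0_muley ?lte_fin// leey.
have [->|Tfin] := eqVneq (ess_sup_on D vt) +oo%E.
  by rewrite addey ?gt0_muley ?lte_fin ?leey// gt_eqF// (lt_le_trans _ (adde_ge0 (E0 v0) B0)).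
have fin v : ess_sup_on D v != +oo%E -> ess_sup_on D v = (fine (ess_sup_on D v))%:E.
  by move=> h; rewrite fineK// ge0_fin_numE// ltey.
have hfin j : ess_sup_on D (w j) != +oo%E.
  case: j => [i|//]; apply: contra Bfin => /eqP h.
  rewrite /B (bigD1 i)//= [ess_sup_on D (vx i)]h addye// gt_eqF//.
  by apply: (@lt_le_trans _ _ 0%E) => //; apply: sume_ge0.
pose N j := fine (ess_sup_on D (w j)).
have N0 j : 0 <= N j by exact: fine_ge0.
pose O' : set XT := Omega' `*` [set t : R | 0 < t < T].
have O'D : O' `<=` D.
  move=> z [/OO h1 /= /andP[h2 h3]]; split => //=.
  by rewrite in_itv/= !ltW.
have hw' j : weak_derivative O' (dir j) v0 (w j).
  by apply: weak_derivative_sub (hw j) => z [/OO h1 h2].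
have hN j : {ae mu, forall o, O' (coord o) -> `|w j (coord o)| <= N j}.
  have := @ess_sup_on_le R n D (w j) (N j); rewrite -(fin _ (hfin j)) => /(_ (lexx _)).
  by apply: ae_imply1 => o h /O'D; exact: h.
have hN0 : {ae mu, forall o, O' (coord o) -> `|v0 (coord o)| <= fine A}.
  have := @ess_sup_on_le R n D v0 (fine A); rewrite -(fin _ Afin) => /(_ (lexx _)).
  by apply: ae_imply1 => o h /O'D; exact: h.
have hv0 : {ae mu, forall o, O' (coord o) -> V (coord o) = (J (coord o) - v0 (coord o))%:E}.
  apply: ae_imply1 hv => o h /O'D Do; have := h Do; case: (V (coord o)) => [r| |] //=.
  by move=> [<-]; congr EFin; rewrite opprB addrC subrK.
have [cJ hJ1] := hJ.
have Jd (e z : XT) : derivable J z e by have [h _] := hJ1 e; exact: h.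
have Jc (e : XT) : continuous ('D_e J) by have [_ [h _]] := hJ1 e.
(* The same speed bound for every coordinate, scaled so that each spatial term 2 T N_i F_i equals C
   N_i. *)
pose F (_ : 'I_n) := C / (2 * T).
have F0 i : 0 <= F i by rewrite divr_ge0// ltW.
have hF i x v : Omega' x -> oc_U P v -> `|oc_f P (x, v) 0 i| <= F i.
  by move=> Ox Uv; rewrite /F ler_pdivlMr// mulrC; exact: hCf.
have main := feedback_suboptimality hP hunc hV cJ Jd Jc oO' hw' N0 hN hN0 hv0 F0 hF iu tX XO hkJ uk.
have lossE : loss P x0 uJ = ((costR P 0%R uJ X)%:E - V (x0, 0%R))%E.
  rewrite /loss (cost_traj hP hunc (lexx 0) (ltW T0) iu tX) hV ?hunc//.
  by rewrite lexx ltW.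
have rateE : 2 * T * rate N F <= C * (fine A + \sum_(i < n) N (Some i) + N None).
  have -> : 2 * T * rate N F = 2 * T * N None + C * \sum_(i < n) N (Some i).
    rewrite /rate mulrDr; congr (_ + _).
    rewrite mulr_sumr mulr_sumr; apply: eq_bigr => i _; rewrite /F.
    by field; rewrite gt_eqF.
  rewrite !mulrDr.
  have h1 : 2 * T * N None <= C * N None by rewrite ler_wpM2r.
  have h2 : 0 <= C * fine A by apply: mulr_ge0; [exact: ltW|apply: fine_ge0; exact: E0].
  rewrite [leLHS]addrC [_ + C * \sum_(_ < _) _]addrC -addrA lerD2l -[leLHS]add0r; exact: lerD.
have sumE : (A + B + ess_sup_on D vt)%E = (fine A + \sum_(i < n) N (Some i) + N None)%:E.
  rewrite !EFinD -(fin _ Afin) -(fin _ Tfin) -sumEFin; congr (_ + _ + _)%E.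
  by apply: eq_bigr => i _; rewrite -(fin _ (hfin (Some i))).
rewrite sumE -EFinM lossE.
(* V = -oo contradicts the lower bound just obtained, and V = +oo would make the loss -oo. *)
move: main; case: (V (x0, 0%R)) => [r| |] //= main; last by rewrite leNye.
by rewrite -EFinB lee_fin; apply: le_trans rateE; rewrite lerBlDr -lerBlDl -lee_fin.
Qed.

End loss_bound.

Lemma W1oo_norm_ge0 (R : realType) n (Omega : set 'rV[R]_n) (T : R) v : (0 <= W1oo_norm Omega T v)%E.
Proof.
apply: le_ereal_inf_tmp => _ [v0 [vx [vt [_ _ _ ->]]]].
by apply: adde_ge0; [apply: adde_ge0; [|apply: sume_ge0 => i _]|]; exact: ess_sup_on_ge0.
Qed.

(** * Lower bounds for the constant *)

Section bound_const.
Context {R : realType} {n m : nat}.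
Variables (f : 'rV[R]_n * 'rV[R]_m -> 'rV[R]_n) (Omega : set 'rV[R]_n) (U : set 'rV[R]_m) (T : R).
Hypothesis T0 : 0 < T.
Local Notation C := (bound_const f Omega U T).

Lemma bound_const_ge2 : (2%:E <= C)%E.
Proof.
rewrite -[leLHS]mule1 /bound_const; apply: lee_wpmul2l; first by rewrite lee_fin.
by rewrite le_max lexx.
Qed.

Lemma bound_const_time : ((2 * T)%:E <= C)%E.
Proof.
rewrite EFinM /bound_const; apply: lee_wpmul2l; first by rewrite lee_fin.
by rewrite !le_max lexx orbT.
Qed.

Lemma bound_const_speed i x v : Omega x -> U v -> ((2 * T * `|f (x, v) 0 i|)%:E <= C)%E.
Proof.
move=> Ox Uv; rewrite -mulrA EFinM /bound_const; apply: lee_wpmul2l; first by rewrite lee_fin.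
rewrite !le_max; apply/orP; right; apply/orP; right.
rewrite EFinM; apply: lee_wpmul2l; first by rewrite lee_fin ltW.
apply: le_trans (le_bigmax _ _ i).
by apply: ereal_sup_ubound; exists (x, v).
Qed.

End bound_const.

Lemma traj_FR (R : realType) n m (P : optctrl R n m) x0 u X s :
  MLip P -> state_unconstrained P -> input (oc_U P) 0 (oc_T P) u ->
  traj (oc_f P) 0 (oc_T P) x0 u X -> 0 <= s <= oc_T P ->
  FR (oc_f P) [set x0] setT (oc_U P) `[0, oc_T P] (X s).
Proof.
move=> hP hunc iu tX /andP[s0 sT].
have iu' : input (oc_U P) 0 s u by exact: input_sub iu.
have X0 : X 0 = x0 by case: tX.
have tX' : traj (oc_f P) 0 s x0 u X by rewrite -X0; exact: traj_sub tX.
exists x0, s, u; split => //.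
- by rewrite /= in_itv/= s0.
- by apply/(admissible_traj (oc_flip hP hunc) (oc_fbnd hP hunc)); split => //; exists X.
have := phi_traj (oc_flip hP hunc) (oc_fbnd hP hunc) iu' tX' (s := s).
rewrite !subr0 (_ : Defs.shift 0 u = u); last by apply/funext => r; rewrite /Defs.shift add0r.
by apply; rewrite s0 lexx.
Qed.

Theorem theorem4 (R : realType) (n m : nat) (P : optctrl R n m)
    (x0 : 'rV[R]_n) (V : 'rV[R]_n * R -> \bar R) (Omega : set 'rV[R]_n)
    (J : 'rV[R]_n * R -> R) (kJ : 'rV[R]_n * R -> 'rV[R]_m)
    (uJ : R -> 'rV[R]_m)
    (hP : MLip P)
    (hunc : state_unconstrained P)
    (hV : is_value_function P V)
    (hOmega : open Omega)
    (hFR : FR (oc_f P) [set x0] setT (oc_U P) `[0, oc_T P] `<=` Omega)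
    (hJ : Ck 2 J)
    (hkJ : is_feedback P J kJ)
    (huJ : oc_admissible P x0 0 uJ)
    (huJk : {ae lebesgue_measure, forall t : R, 0 <= t <= oc_T P ->
               uJ t = kJ (oc_phi P x0 0 uJ t, t)}) :
  (loss P x0 uJ <=
   bound_const (oc_f P) Omega (oc_U P) (oc_T P) *
   W1oo_norm Omega (oc_T P) (fun z => (J z)%:E - V z))%E.
Proof.
have [iu [X tX]] := (oc_admissible_traj hP hunc 0 x0 uJ).1 huJ.
have T0 := oc_T_gt0 P.
have uk : {ae lebesgue_measure, forall t : R, 0 <= t <= oc_T P -> uJ t = kJ (X t, t)}.
  apply: ae_imply1 huJk => s hs sT; rewrite hs//.
  by have := oc_phi_traj hP hunc iu tX sT; rewrite subr0 => ->.
have XO s : 0 <= s <= oc_T P -> Omega (X s) by move=> sT; apply: hFR; exact: traj_FR tX sT.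
have main := loss_le_W1oo hP hunc hV hJ hkJ iu tX uk.
set W := W1oo_norm _ _ _.
have W0 : (0 <= W)%E by exact: W1oo_norm_ge0.
have := bound_const_ge2 (oc_f P) Omega (oc_U P) (oc_T P).
have := bound_const_time (oc_f P) Omega (oc_U P) (oc_T P).
have := fun i x v => @bound_const_speed R n m (oc_f P) Omega (oc_U P) (oc_T P) T0 i x v.
case: (bound_const _ _ _ _) => [c| |] // hf hT _.
  by apply: (main Omega Omega) => // i x v Ox Uv; rewrite -lee_fin; exact: hf.
(* If f is unbounded on Omega, the right-hand side is +oo * W, which is 0 when W = 0; the bound
   then has to come from a bounded subset of Omega containing the trajectory. *)
have [W00|Wn0] := eqVneq W 0%E; last first.
  by rewrite gt0_mulye ?leey// lt_def Wn0.
have [r [L [r0 L0 Xr _]]] := traj_bounded_lip (oc_fbnd hP hunc) iu.1 tX.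
have [M M0 fM] := oc_fbnd hP hunc (r + 1).
pose Omega' := Omega `&` [set x | `|x| < r + 1].
have T20 : 0 <= 2 * oc_T P by rewrite mulr_ge0// ltW.
have Xball s : 0 <= s <= oc_T P -> Omega' (X s).
  move=> sT; split; first exact: XO.
  by rewrite /= (le_lt_trans (Xr _ sT))// ltrDl.
have oO' : open Omega'.
  apply: openI; first exact: hOmega.
  by apply: (@open_comp _ _ (fun x : 'rV[R]_n => `|x|) [set y | y < r + 1]);
    [move=> x _; exact: norm_continuous|exact: open_lt].
have := main Omega Omega' (Num.max (2 * oc_T P) (2 * oc_T P * M)) oO' (@subIsetl _ _ _) Xball.
rewrite -/W W00 !mule0; apply; first by rewrite le_max lexx.
move=> i x v [_ /= /ltW xr] Uv.
rewrite le_max; apply/orP; right; apply: ler_wpM2l => //.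
by apply: le_trans (fM _ _ xr Uv); exact: rV_norm_coord.
Qed.
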